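(* Let $1<a_1<a_2$ be integers with $\gcd(a_1,a_2)=1$. Then $$a_1a_2\le G_{a_1,a_2}\le C\,a_1a_2(\log a_1a_2)^2,$$ where $C>0$ is an absolute constant.
   Context: $G_{a_1,a_2}$ denotes the least integer such that every integer $n>G_{a_1,a_2}$ can be written as $n=a_1x_1+a_2x_2$ with $x_1,x_2\in\mathbb{Z}_{\ge0}$ and $\gcd(x_1,x_2)=1$ (this is known to be finite). *)

(* Defs.v *)
From mathcomp Require Import all_boot all_order all_algebra.
Set Implicit Arguments.
Unset Strict Implicit.
Unset Printing Implicit Defensive.
Import Order.TTheory GRing.Theory Num.Theory.
Local Open Scope ring_scope.

(* [coprime 0 1] holds and [coprime 0 0] does not, so a zero coordinate is
   allowed exactly when the other one is 1. *)
Definition coprime_rep (a1 a2 n : int) : Prop :=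
  exists x1 x2 : nat, n = a1 * x1%:Z + a2 * x2%:Z /\ coprime x1 x2.

Definition coprime_rep_above (a1 a2 g : int) : Prop :=
  forall n : int, g < n -> coprime_rep a1 a2 n.

(* [G] is the number G_{a1,a2}; such a [G] is unique when it exists. *)
Definition is_coprime_frobenius (a1 a2 G : int) : Prop :=
  coprime_rep_above a1 a2 G /\
  forall g : int, coprime_rep_above a1 a2 g -> G <= g.

(* Main.v *)
(** Lower bound: in a representation of a1 a2 the number a2 divides x1 and a1
divides x2, so one coordinate is 0 and the other is a1 or a2, which is not
coprime to 0.

Upper bound: the representations of n are (u + a2 t, v - a1 t), with t in an
interval of length about n / (a1 a2).  A prime dividing both coordinates divides
n, and the t for which this happens lie in one residue class modulo that prime.
It is therefore enough that, given one residue class modulo each prime factor of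
n, every K log^2 n consecutive integers contain one outside all these classes:
Iwaniec's bound for Jacobsthal's function.

Take z of order log n and sift an interval of length X = M z^2 by the primes
below z, with the linear sieve.  Its bounds are proved by induction over the
primes: Buchstab's identity S(n + 1) = S(n) - S_n(n) is turned into the delay
equations (s F(s))' = f(s - 1), (s f(s))' = F(s - 1) of the functions of the
linear sieve, and terms of relative size 1 / log^2 absorb the error of a step.
Since f is positive to the right of s = 2, at least of order X V(z) / log z
integers survive, where V(z) is the product of 1 - 1/p over p < z.  The prime
factors of n above z number at most log n / log z, a small multiple of
z / log z, and by the upper bound of the sieve each removes a number of
survivors of order at most X V(z) / z, up to a smaller term. *)

Require Import Defs.
From mathcomp Require Import all_boot all_order all_algebra.
From mathcomp Require Import reals exp.
From mathcomp Require Import boolp zify.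
From Stdlib Require ZArith Reals Lra Psatz.
From Coquelicot Require Coquelicot.

(** The interval has length M z^2 with M constant, so s = ln X / t stays within O(1 / log z) of 2,
    where f(s) itself is only of order 1 / log z. In the step of a prime p the scale t advances by
    ln p / p. If each step left an error of order 1 / (p t), it could only be paid by moving the
    variable, and the shifts of ln X would add up to a multiple of log t, that is log log z, which
    no constant M allows. So the errors of first order have to cancel. They come from t - ln p,
    which is bounded but not small; the term in N cancels them, and N stays bounded because the
    scale is taken from Mertens' theorem with its second order term. What remains is of order 1 / (p
    t^2); the shifts then converge, and their sum only enters M. The induction starts at a fixed
    level n0, where Legendre's sieve with its error 2^n0 is good enough. *)

Module JacobsthalBound.
Import ZArith Reals Lra Psatz Coquelicot.Coquelicot.
Delimit Scope nat_scope with N.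
Local Open Scope R_scope.

(** * The functions of the linear sieve *)

(* [delay eps] solves (s f(s))' = eps f(s - 1) for s > 2 with s f(s) = 1 on
   (0, 2]; [delay_iter eps n] is its value up to s = n + 2.  The truncation at 1/2
   makes these functions continuous on the whole line. *)
Fixpoint delay_iter (eps : R) (n : nat) (s : R) : R :=
  match n with
  | 0%nat => / Rmax (1/2) s
  | S m => (1 + eps * RInt (fun u => delay_iter eps m (u - 1)) 2 (Rmax 2 s))
             / Rmax (1/2) s
  end.

Definition delay (eps s : R) : R := delay_iter eps (Z.to_nat (up s)) s.

Lemma continuous_ex_RInt (f : R -> R) (a b : R) :
  (forall x, continuous f x) -> ex_RInt f a b.
Proof. by move=> hf; apply: ex_RInt_continuous => z _; apply: hf. Qed.

Lemma RInt_Chasles_cont (f : R -> R) (a b c : R) : (forall x, continuous f x) ->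
  RInt f a b + RInt f b c = RInt f a c.
Proof. by move=> hf; apply: (RInt_Chasles f a b c); apply: continuous_ex_RInt. Qed.

Lemma continuous_prim (f : R -> R) (a x : R) :
  (forall x, continuous f x) -> continuous (fun b => RInt f a b) x.
Proof.
move=> hf; apply: (continuous_RInt_1 f a x (fun b => RInt f a b)).
apply: filter_forall => z; apply: RInt_correct; exact: continuous_ex_RInt.
Qed.

Lemma is_derive_prim (f : R -> R) (a x : R) :
  (forall x, continuous f x) -> is_derive (fun b => RInt f a b) x (f x).
Proof.
move=> hf; apply: (is_derive_RInt f (fun b => RInt f a b) a x) => //.
apply: filter_forall => z; apply: RInt_correct; exact: continuous_ex_RInt.
Qed.

Lemma continuous_Rmax (a x : R) : continuous (fun y => Rmax a y) x.
Proof.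
apply: (continuous_ext (fun y => (a + y + Rabs (a - y)) / 2)).
  by move=> y; rewrite /Rmax /Rabs; case: Rle_dec; case: Rcase_abs => *; lra.
apply: (continuous_mult (fun y => a + y + Rabs (a - y)) (fun _ => / 2)); last exact: continuous_const.
apply: (continuous_plus (fun y => a + y) (fun y => Rabs (a - y))).
  by apply: (continuous_plus (fun _ => a)); [exact: continuous_const|exact: continuous_id].
apply: continuous_comp; last exact: continuous_Rabs.
by apply: (continuous_minus (fun _ => a)); [exact: continuous_const|exact: continuous_id].
Qed.

Lemma Rmax_half_pos (s : R) : 0 < Rmax (1/2) s.
Proof. have := Rmax_l (1/2) s; lra. Qed.

Lemma continuous_shift (f : R -> R) (a x : R) :
  (forall x, continuous f x) -> continuous (fun u => f (u - a)) x.
Proof.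
move=> hf; apply: (continuous_comp (fun u => u - a)); last exact: hf.
by apply: (continuous_minus (fun u => u)); [exact: continuous_id|exact: continuous_const].
Qed.

Lemma delay_iter_continuous (eps : R) (n : nat) (x : R) :
  continuous (delay_iter eps n) x.
Proof.
elim: n x => [|n IHn] x /=.
  apply: continuous_Rinv_comp; first exact: continuous_Rmax.
  by have := Rmax_half_pos x; lra.
apply: (continuous_mult (fun s => 1 + eps * RInt (fun u => delay_iter eps n (u - 1)) 2 (Rmax 2 s))
                        (fun s => / Rmax (1/2) s)).
  apply: (continuous_plus (fun _ => 1)); first exact: continuous_const.
  apply: (continuous_mult (fun _ => eps)); first exact: continuous_const.
  apply: (continuous_comp (fun s => Rmax 2 s)); first exact: continuous_Rmax.
  apply: continuous_prim => z; exact: continuous_shift.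
apply: continuous_Rinv_comp; first exact: continuous_Rmax.
by have := Rmax_half_pos x; lra.
Qed.

(** Method of steps: for s <= n + 2 the integral only sees arguments up to n + 1, where one
    iteration fewer already gives the same value. *)
Lemma delay_iter_stable (eps : R) (n : nat) (s : R) :
  s <= INR n + 2 -> delay_iter eps (S n) s = delay_iter eps n s.
Proof.
elim: n s => [|n IHn] s hs.
  rewrite /= Rmax_left; last by simpl in hs; lra.
  by rewrite RInt_point /zero /=; field; have := Rmax_half_pos s; lra.
have E : RInt (fun u => delay_iter eps (S n) (u - 1)) 2 (Rmax 2 s)
       = RInt (fun u => delay_iter eps n (u - 1)) 2 (Rmax 2 s).
  apply: RInt_ext => x; rewrite (Rmin_left 2 (Rmax 2 s)) ?(Rmax_right 2 (Rmax 2 s)); try exact: Rmax_l.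
  move=> hx; apply: IHn; rewrite S_INR in hs.
  have : Rmax 2 s <= INR n + 3 by apply: Rmax_lub; have := pos_INR n; lra.
  lra.
change (delay_iter eps (S (S n)) s) with
  ((1 + eps * RInt (fun u => delay_iter eps (S n) (u - 1)) 2 (Rmax 2 s)) / Rmax (1/2) s).
by rewrite E.
Qed.

Lemma delayE (eps s : R) (n : nat) : s <= INR n + 2 -> delay eps s = delay_iter eps n s.
Proof.
move=> hs; rewrite /delay; set m := Z.to_nat (up s).
have hm : s <= INR m + 2.
  have [h1 _] := archimed s.
  have [h|h] := Rle_dec s 2; first by have := pos_INR m; lra.
  have h0 : (0 <= up s)%Z by apply: le_IZR; lra.
  by rewrite /m INR_IZR_INZ Z2Nat.id //; lra.
have key k l : (Peano.le k l) -> s <= INR k + 2 -> delay_iter eps l s = delay_iter eps k s.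
  elim=> [//|j hj IH] hk; rewrite -IH //; apply: delay_iter_stable.
  by have := le_INR _ _ hj; lra.
by have [h|h] := Nat.le_ge_cases m n; [rewrite -(key m n)|rewrite (key n m)].
Qed.

Lemma delay_continuous (eps x : R) : continuous (delay eps) x.
Proof.
have [h1 _] := archimed x.
pose n := Z.to_nat (up (x + 1)).
have hn : x + 1 <= INR n + 2.
  have [h _] := archimed (x + 1).
  have [h'|h'] := Rle_dec (x + 1) 2; first by have := pos_INR n; lra.
  have h0 : (0 <= up (x + 1))%Z by apply: le_IZR; lra.
  by rewrite /n INR_IZR_INZ Z2Nat.id //; lra.
apply: (continuous_ext_loc (delay eps) (delay_iter eps n) x); last exact: delay_iter_continuous.
exists (mkposreal 1 Rlt_0_1) => y hy; symmetry; apply: delayE.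
by move: hy; rewrite /ball /= /AbsRing_ball /= /abs /minus /plus /opp /= => /Rabs_def2; lra.
Qed.

Lemma delay_eq (eps s : R) : 1/2 <= s ->
  s * delay eps s = 1 + eps * RInt (fun u => delay eps (u - 1)) 2 (Rmax 2 s).
Proof.
move=> hs.
pose n := Z.to_nat (up s).
have hn : s <= INR n + 2.
  have [h1 _] := archimed s.
  have [h|h] := Rle_dec s 2; first by have := pos_INR n; lra.
  have h0 : (0 <= up s)%Z by apply: le_IZR; lra.
  by rewrite /n INR_IZR_INZ Z2Nat.id //; lra.
rewrite (delayE eps s (S n)); last by rewrite S_INR; lra.
rewrite /= (Rmax_right (1/2) s) //.
rewrite (RInt_ext (fun u => delay eps (u - 1)) (fun u => delay_iter eps n (u - 1))).
  by field; lra.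
move=> x; rewrite (Rmin_left 2 (Rmax 2 s)) ?(Rmax_right 2 (Rmax 2 s)); try exact: Rmax_l.
move=> hx; apply: delayE.
have : Rmax 2 s <= INR n + 3 by apply: Rmax_lub; have := pos_INR n; lra.
lra.
Qed.

Lemma delay_le2 (eps s : R) : 1/2 <= s <= 2 -> delay eps s = / s.
Proof.
move=> hs; have := delay_eq eps s (proj1 hs).
rewrite Rmax_left; last lra.
rewrite RInt_point /zero /= => h.
apply: (Rmult_eq_reg_l s); last lra.
by rewrite h; field; lra.
Qed.

Lemma delay_le2_indep (eps eps' s : R) : s <= 2 -> delay eps s = delay eps' s.
Proof. by move=> hs; rewrite !(delayE _ s 0) //=; lra. Qed.

Lemma delay_is_derive (eps s : R) : 2 < s ->
  is_derive (delay eps) s ((eps * delay eps (s - 1) - delay eps s) / s).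
Proof.
move=> hs.
pose I b := RInt (fun u => delay eps (u - 1)) 2 b.
have dI : is_derive I s (delay eps (s - 1)).
  apply: (is_derive_prim (fun u => delay eps (u - 1))) => x.
  apply: continuous_shift; exact: delay_continuous.
apply: (is_derive_ext_loc (fun s => (1 + eps * I s) / s)).
  have h : 0 < s - 2 by lra.
  exists (mkposreal _ h) => y; rewrite /ball /= /AbsRing_ball /= /abs /minus /plus /opp /=.
  move=> /Rabs_def2 hy; have := delay_eq eps y.
  rewrite Rmax_right /I; last lra.
  by move=> hh; rewrite -hh; [field|]; lra.
have := delay_eq eps s; rewrite Rmax_right; last lra.
rewrite -/(I s) => hI; have {}hI : s * delay eps s = 1 + eps * I s by apply: hI; lra.
have -> : (eps * delay eps (s - 1) - delay eps s) / s
        = (eps * delay eps (s - 1) * s - (1 + eps * I s) * 1) / s ^ 2.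
  by rewrite -hI; field; lra.
apply: is_derive_div; last lra; last exact: is_derive_id.
have := is_derive_plus (fun _ => 1) (fun s => eps * I s) s 0 (eps * delay eps (s - 1)).
rewrite /plus /= Rplus_0_l; apply; first exact: is_derive_const.
by apply: is_derive_scal.
Qed.

Lemma MVT_cont (f df : R -> R) (a b : R) : a < b ->
  (forall x, a < x < b -> is_derive f x (df x)) ->
  (forall x, continuous f x) ->
  exists2 c, a <= c <= b & f b - f a = df c * (b - a).
Proof.
move=> hab hd hc; case: (MVT_gen f a b df).
- by move=> x; rewrite Rmin_left ?Rmax_right; try lra; exact: hd.
- by move=> x _; apply/continuity_pt_filterlim; exact: hc.
by move=> c; rewrite Rmin_left ?Rmax_right; try lra; case=> h1 h2; exists c.
Qed.

(* [sg] is the function (F - f)/A and [om] the function (F + f)/A of the linear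
   sieve; [om] is Buchstab's function. *)
Definition sg := delay (-1).
Definition om := delay 1.

(** * Positivity and decay of [sg], limit of [om] *)

Definition Zsg (s : R) := s * sg s.

Lemma Zsg_continuous x : continuous Zsg x.
Proof. apply: (continuous_mult (fun s => s)); [exact: continuous_id|exact: delay_continuous]. Qed.

Lemma Zsg_is_derive s : 2 < s -> is_derive Zsg s (- sg (s - 1)).
Proof.
move=> hs.
have := is_derive_mult (fun s => s) sg s 1 _ (is_derive_id s) (delay_is_derive (-1) s hs) Rmult_comm.
rewrite /mult /plus /=; set l := (X in is_derive _ _ X -> _) => h.
have <- : l = - sg (s - 1) by rewrite /l /sg; field; lra.
exact: h.
Qed.

Lemma Zsg_le2 s : 1/2 <= s <= 2 -> Zsg s = 1.
Proof. by move=> hs; rewrite /Zsg /sg delay_le2 //; field; lra. Qed.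

(** A conserved quantity of the delay equation: since Zsg'(s) = - Zsg(s - 1) / (s - 1), the
    difference of the two sides has derivative 0, and at s = 2 it vanishes because [Zsg] is 1 on
    [1, 2]. It expresses [Zsg] through its own past, from which both positivity and decay are read
    off. *)
Lemma Zsg_int s : 2 <= s -> (s - 1) * Zsg s = RInt Zsg (s - 1) s.
Proof.
move=> hs.
pose I b := RInt Zsg 0 b.
have dI x : is_derive I x (Zsg x) by apply: is_derive_prim; exact: Zsg_continuous.
have cI x : continuous I x by apply: continuous_prim; exact: Zsg_continuous.
have E b : RInt Zsg (b - 1) b = I b - I (b - 1).
  have := RInt_Chasles_cont Zsg 0 (b - 1) b Zsg_continuous; rewrite /I; lra.
pose K x := (x - 1) * Zsg x - (I x - I (x - 1)).
have K2 : K 2 = 0.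
  rewrite /K -E (RInt_ext _ (fun _ => 1)).
    by rewrite RInt_const /scal /= /mult /= Zsg_le2; lra.
  move=> x; rewrite Rmin_left ?Rmax_right; try lra.
  by move=> hx; apply: Zsg_le2; lra.
rewrite E; suff : K s = 0 by rewrite /K; lra.
case: (Req_dec s 2) => [->//|hs'].
have [|||c hc E2] := MVT_cont K (fun _ => 0) 2 s; first lra; last by rewrite K2 in E2; lra.
- move=> x hx; rewrite /K.
  have d1 : is_derive (fun x => (x - 1) * Zsg x) x (1 * Zsg x + (x - 1) * (- sg (x - 1))).
    apply: (is_derive_mult (fun x => x - 1) Zsg x 1 (- sg (x - 1))).
    - by auto_derive.
    - by apply: Zsg_is_derive; lra.
    - exact: Rmult_comm.
  have d2 : is_derive (fun x => I (x - 1)) x (1 * Zsg (x - 1)).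
    apply: (is_derive_comp I (fun x => x - 1)); first exact: dI.
    by auto_derive.
  have := is_derive_minus _ _ _ _ _ d1 (is_derive_minus _ _ _ _ _ (dI x) d2).
  rewrite /minus /plus /opp /=.
  set l := (X in is_derive _ _ X -> _) => h.
  have <- : l = 0 by rewrite /l /Zsg; ring.
  exact: h.
- move=> x; rewrite /K.
  apply: (continuous_minus (fun x => (x - 1) * Zsg x) (fun x => I x - I (x - 1))).
    apply: (continuous_mult (fun x => x - 1)); last exact: Zsg_continuous.
    by apply: (continuous_minus (fun u => u)); [exact: continuous_id|exact: continuous_const].
  apply: (continuous_minus I); first exact: cI.
  exact: continuous_shift.
Qed.

(** Positivity of [sg] is asked for only up to y - 1, so that the lemma can serve inside the
    induction that proves this positivity. *)
Lemma Zsg_decr_aux x y : 1/2 <= x < y ->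
  (forall u, 1/2 <= u <= y - 1 -> 0 < sg u) -> Zsg y <= Zsg x /\ (2 < y -> Zsg y < Zsg x).
Proof.
move=> hxy hpos.
have key a : 2 <= a < y -> Zsg y < Zsg a.
  move=> ha; have [|||c hc E] := MVT_cont Zsg (fun s => - sg (s - 1)) a y; first lra.
  - by move=> z hz; apply: Zsg_is_derive; lra.
  - exact: Zsg_continuous.
  have : 0 < sg (c - 1) by apply: hpos; lra.
  nra.
case: (Rle_dec 2 x) => hx; first by have := key x; lra.
rewrite (Zsg_le2 x); last lra.
case: (Rle_dec y 2) => hy; first by rewrite Zsg_le2; lra.
by have := key 2; rewrite (Zsg_le2 2); lra.
Qed.

(** By induction over unit intervals: positivity up to s - 1 makes [Zsg] decrease on [s - 1, s], so
    [Zsg_int] gives (s - 1) Zsg(s) > Zsg(s), which for s > 2 forces Zsg(s) > 0. *)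
Lemma sg_pos s : 1/2 <= s -> 0 < sg s.
Proof.
have main n : forall s, 1/2 <= s <= 2 + INR n -> 0 < sg s.
  elim: n => [|n IHn] {}s hs.
    rewrite /sg delay_le2; last by simpl in hs; lra.
    by apply: Rinv_0_lt_compat; lra.
  rewrite S_INR in hs.
  case: (Rle_dec s (2 + INR n)) => h; first by apply: IHn; lra.
  have hn := pos_INR n.
  have E := Zsg_int s.
  have P : 0 < RInt (fun x => Zsg x - Zsg s) (s - 1) s.
    apply: RInt_gt_0; first lra.
    - move=> x hx.
      have [_ D] : Zsg s <= Zsg x /\ (2 < s -> Zsg s < Zsg x).
        by apply: Zsg_decr_aux; [lra|move=> u hu; apply: IHn; lra].
      by have := D ltac:(lra); lra.
    - move=> x _; apply: (continuous_minus Zsg); [exact: Zsg_continuous|exact: continuous_const].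
  rewrite RInt_minus in P; try (apply: continuous_ex_RInt => x); try exact: Zsg_continuous; try exact: continuous_const.
  rewrite RInt_const /minus /plus /opp /scal /= /mult /= -E in P; last lra.
  have : 0 < Zsg s by nra.
  by rewrite /Zsg; nra.
move=> hs; have [h1 _] := archimed s.
have h0 : (0 <= up s)%Z by apply: le_IZR; lra.
apply: (main (Z.to_nat (up s))); rewrite INR_IZR_INZ Z2Nat.id //; lra.
Qed.

Lemma Zsg_decr x y : 1/2 <= x <= y -> Zsg y <= Zsg x.
Proof.
move=> [h1 [h2|->]]; last exact: Rle_refl.
by apply: (proj1 (Zsg_decr_aux x y _ _)) => // u hu; apply: sg_pos; lra.
Qed.

Lemma sg_le s : 2 <= s -> sg s <= sg (s - 1) / s.
Proof.
move=> hs; have E := Zsg_int s hs.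
have : RInt Zsg (s - 1) s <= RInt (fun _ => Zsg (s - 1)) (s - 1) s.
  apply: RInt_le; first lra; try (apply: continuous_ex_RInt => x); try exact: Zsg_continuous; try exact: continuous_const.
  by move=> x hx; apply: Zsg_decr; lra.
rewrite RInt_const /scal /= /mult /= -E => h.
have {}h : Zsg s <= sg (s - 1) by rewrite {2}/Zsg in h; nra.
apply: (Rmult_le_reg_r s); first lra.
rewrite /Zsg in h; have -> : sg (s - 1) / s * s = sg (s - 1) by field; lra.
lra.
Qed.

Lemma sg_le_inv s : 1/2 <= s -> sg s <= / s.
Proof.
move=> hs; have := Zsg_decr (1/2) s; rewrite (Zsg_le2 (1/2)); last lra.
move=> h; have {}h : Zsg s <= 1 by apply: h; lra.
apply: (Rmult_le_reg_l s); first lra.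
by rewrite Rinv_r; [rewrite -/(Zsg s)|lra].
Qed.

Lemma exp4_le : exp 4 <= 81.
Proof.
have := exp_le_3; have -> : 4 = 1 + 1 + 1 + 1 by ring.
rewrite !exp_plus => h; have := exp_pos 1 => h0.
have h2 : exp 1 * exp 1 <= 9 by nra.
have h3 : exp 1 * exp 1 * exp 1 <= 27 by nra.
nra.
Qed.

Lemma exp_mono x y : x <= y -> exp x <= exp y.
Proof. by case=> [h|->]; [apply/Rlt_le/exp_increasing|apply: Rle_refl]. Qed.

Lemma exp_ge1 x : 0 <= x -> 1 <= exp x.
Proof. by move=> h; rewrite -exp_0; apply: exp_mono. Qed.

(** Each unit of length gains a factor 1 / s, which is at most e^(-4) from s = 81 on. The 84 is 81
    plus the starting point 2 plus 1 for rounding s - 2 down to an integer. *)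
Lemma delay_decay (f : R -> R) :
  (forall s, 2 <= s -> f s <= 1) ->
  (forall a B, 2 <= a -> 0 <= B -> (forall u, a <= u -> f u <= B) ->
     forall s, a + 1 <= s -> f s <= B / s) ->
  forall s, 2 <= s -> f s <= exp (4 * 84) * exp (- (4 * s)).
Proof.
move=> h1 hstep.
have main n : forall s, 2 + INR n <= s -> f s <= exp (4 * (81 - INR n)).
  elim: n => [|n IHn] s hs.
    apply: Rle_trans (h1 s _) _; first by simpl in hs; lra.
    by apply: exp_ge1; simpl; lra.
  rewrite S_INR in hs *; have hn := pos_INR n.
  case: (Rle_dec (INR n) 80) => h.
    apply: Rle_trans (h1 s _) _; first lra.
    by apply: exp_ge1; lra.
  have hB := exp_pos (4 * (81 - INR n)).
  have := hstep (2 + INR n) (exp (4 * (81 - INR n))) _ _ _ s.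
  move=> /(_ ltac:(lra) ltac:(lra) IHn ltac:(lra)) h2.
  apply: Rle_trans h2 _.
  have -> : 4 * (81 - INR n) = 4 * (81 - (INR n + 1)) + 4 by ring.
  rewrite exp_plus; have := exp_pos (4 * (81 - (INR n + 1))).
  set e := exp (4 * _) => he; have h4 := exp4_le.
  apply: (Rmult_le_reg_r s); first lra.
  have -> : e * exp 4 / s * s = e * exp 4 by field; lra.
  by apply: Rmult_le_compat_l; lra.
move=> s hs; rewrite -exp_plus.
have [h3 h4] := archimed (s - 2).
have h0 : (0 <= up (s - 2) - 1)%Z.
  suff : (0 < up (s - 2))%Z by lia.
  by apply: lt_IZR; lra.
have := main (Z.to_nat (up (s - 2) - 1)) s.
rewrite INR_IZR_INZ Z2Nat.id // minus_IZR => /(_ ltac:(lra)) h.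
apply: Rle_trans h _.
by apply: exp_mono; lra.
Qed.

Lemma sg_decay s : 1/2 <= s -> sg s <= 2 * exp (4 * 84) * exp (- (4 * s)).
Proof.
move=> hs; case: (Rle_dec 2 s) => h.
  have := delay_decay sg _ _ s h => H.
  have {}H : sg s <= exp (4 * 84) * exp (- (4 * s)).
    apply: H.
    - move=> u hu; apply: Rle_trans (sg_le_inv u _) _; first lra.
      by rewrite -Rinv_1; apply: Rinv_le_contravar; lra.
    - move=> a B ha hB H u hu; apply: Rle_trans (sg_le u _) _; first lra.
      apply: Rmult_le_compat_r; first by apply/Rlt_le/Rinv_0_lt_compat; lra.
      by apply: H; lra.
  by have := exp_pos (4 * 84); have := exp_pos (- (4 * s)); nra.
apply: Rle_trans (sg_le_inv s hs) _.
have h2 : / s <= 2 by apply: (Rmult_le_reg_l s); rewrite ?Rinv_r; lra.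
suff : 1 <= exp (4 * 84) * exp (- (4 * s)) by lra.
by rewrite -exp_plus; apply: exp_ge1; lra.
Qed.

(** Both bounds reproduce themselves in s om(s) = 1 + integral of om over [1, s - 1]: they give at
    least 1 + (s - 2) / 2 = s / 2 and at most s - 1. *)
Lemma om_bounds s : 1 <= s -> 1/2 <= om s <= 1.
Proof.
have main n : forall s, 1 <= s <= 2 + INR n -> 1/2 <= om s <= 1.
  elim: n => [|n IHn] {}s hs.
    rewrite /om delay_le2; last by simpl in hs; lra.
    simpl in hs; split.
      by rewrite /Rdiv Rmult_1_l; apply: Rinv_le_contravar; lra.
    by rewrite -Rinv_1; apply: Rinv_le_contravar; lra.
  rewrite S_INR in hs.
  case: (Rle_dec s (2 + INR n)) => h; first by apply: IHn; lra.
  have hn := pos_INR n.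
  have := delay_eq 1 s; rewrite Rmax_right; last lra.
  move=> /(_ ltac:(lra)); rewrite -/om; set I := RInt _ _ _ => E.
  have ci x : continuous (fun u => om (u - 1)) x by apply: continuous_shift; exact: delay_continuous.
  have i1 : I <= RInt (fun _ => 1) 2 s.
    apply: RInt_le; first lra; try (apply: continuous_ex_RInt => x //); try exact: continuous_const.
    by move=> x hx; have := IHn (x - 1); lra.
  have i2 : RInt (fun _ => 1/2) 2 s <= I.
    apply: RInt_le; first lra; try (apply: continuous_ex_RInt => x //); try exact: continuous_const.
    by move=> x hx; have := IHn (x - 1); lra.
  rewrite !RInt_const /scal /= /mult /= in i1 i2.
  by split; apply: (Rmult_le_reg_l s); lra.
move=> hs; have [h1 _] := archimed s.
have h0 : (0 <= up s)%Z by apply: le_IZR; lra.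
apply: (main (Z.to_nat (up s))); rewrite INR_IZR_INZ Z2Nat.id //; lra.
Qed.

Definition dom (s : R) := (om (s - 1) - om s) / s.

Lemma om_is_derive s : 2 < s -> is_derive om s (dom s).
Proof.
move=> hs; have := delay_is_derive 1 s hs.
by rewrite /dom /om Rmult_1_l.
Qed.

(** The difference om(s - 1) - om(s) is minus the derivative at a point between, so dom(s) is at
    most the past maximum of |dom| divided by s, as [delay_decay] requires. *)
Lemma dom_decay s : 2 <= s -> Rabs (dom s) <= exp (4 * 84) * exp (- (4 * s)).
Proof.
apply: (delay_decay (fun s => Rabs (dom s))) => {s}.
- move=> s hs; have h1 := om_bounds s; have h2 := om_bounds (s - 1).
  rewrite /dom Rabs_div; last lra.
  rewrite (Rabs_pos_eq s); last lra.
  apply: (Rmult_le_reg_r s); first lra.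
  have -> : Rabs (om (s - 1) - om s) / s * s = Rabs (om (s - 1) - om s) by field; lra.
  by apply: Rabs_le; lra.
move=> a B ha hB H s hs.
rewrite /dom Rabs_div; last lra.
rewrite (Rabs_pos_eq s); last lra.
apply: Rmult_le_compat_r; first by apply/Rlt_le/Rinv_0_lt_compat; lra.
have [|||c hc E] := MVT_cont om dom (s - 1) s; first lra.
- by move=> x hx; apply: om_is_derive; lra.
- exact: delay_continuous.
have -> : om (s - 1) - om s = - dom c by lra.
by rewrite Rabs_Ropp; apply: H; lra.
Qed.

Lemma MVT_decr (f df : R -> R) (a b : R) : a <= b ->
  (forall x, a < x < b -> is_derive f x (df x)) ->
  (forall x, continuous f x) ->
  (forall x, a <= x <= b -> df x <= 0) -> f b <= f a.
Proof.
case=> [hab|->] hd hc hn; last exact: Rle_refl.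
have [|||c h E] := MVT_cont f df a b => //.
by have := hn c h; nra.
Qed.

(** By [dom_decay], om + C e^(-4s) decreases and om - C e^(-4s) increases; L is the supremum of the
    latter. *)
Lemma om_limit : exists L, 1/4 <= L /\
  forall s, 2 <= s -> Rabs (om s - L) <= exp (4 * 84) * exp (- (4 * s)).
Proof.
set C := exp (4 * 84).
have hC : 0 < C by exact: exp_pos.
have dexp s : is_derive (fun s => C * exp (- (4 * s))) s (- (4 * C * exp (- (4 * s)))).
  by auto_derive => //; ring.
have cexp s : continuous (fun s => C * exp (- (4 * s))) s.
  by apply: ex_derive_continuous; eexists; exact: dexp.
have up_ s u : 2 <= s <= u -> om u + C * exp (- (4 * u)) <= om s + C * exp (- (4 * s)).
  move=> hsu; apply: (MVT_decr (fun s => om s + C * exp (- (4 * s)))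
      (fun s => dom s + - (4 * C * exp (- (4 * s))))); first lra.
  - move=> x hx; apply: (is_derive_plus om); last exact: dexp.
    by apply: om_is_derive; lra.
  - by move=> x; apply: (continuous_plus om) => //; exact: delay_continuous.
  move=> x hx; have := dom_decay x ltac:(lra); rewrite -/C.
  have := exp_pos (- (4 * x)) => h0 /Rabs_le_between h.
  by have : 0 < C * exp (- (4 * x)); [nra|lra].
have lo_ s u : 2 <= s <= u -> om s - C * exp (- (4 * s)) <= om u - C * exp (- (4 * u)).
  move=> hsu; have := (MVT_decr (fun s => - om s + C * exp (- (4 * s)))
      (fun s => - dom s + - (4 * C * exp (- (4 * s)))) s u ltac:(lra)).
  move=> H; suff : - om u + C * exp (- (4 * u)) <= - om s + C * exp (- (4 * s)) by lra.
  apply: H.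
  - move=> x hx; apply: (is_derive_plus (fun s => - om s)); last exact: dexp.
    by apply: (is_derive_opp om); apply: om_is_derive; lra.
  - move=> x; apply: (continuous_plus (fun s => - om s)) => //.
    by apply: (continuous_opp om); exact: delay_continuous.
  move=> x hx; have := dom_decay x ltac:(lra); rewrite -/C.
  have := exp_pos (- (4 * x)) => h0 /Rabs_le_between h.
  by have : 0 < C * exp (- (4 * x)); [nra|lra].
have he s : 0 < C * exp (- (4 * s)) by apply: Rmult_lt_0_compat => //; exact: exp_pos.
pose E y := exists2 s, 2 <= s & y = om s - C * exp (- (4 * s)).
have cross s u : 2 <= s -> 2 <= u -> om u - C * exp (- (4 * u)) <= om s + C * exp (- (4 * s)).
  move=> hs hu; have := he s; have := he u.
  case: (Rle_dec s u) => h; first by have := up_ s u; lra.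
  by have := lo_ u s; lra.
have [L [ub lub]] : {L | is_lub E L}.
  apply: completeness; last by exists (om 2 - C * exp (- (4 * 2))), 2; lra.
  exists 1 => y [s hs ->]; have := om_bounds s; have := he s; lra.
exists L; split.
  (* At s = 100 the error term is e^(336 - 400), far below 1/4, while om is at least 1/2. *)
  have h100 : om 100 - C * exp (- (4 * 100)) <= L by apply: ub; exists 100; lra.
  have := om_bounds 100 ltac:(lra).
  suff : C * exp (- (4 * 100)) <= 1/4 by lra.
  rewrite /C -exp_plus; have -> : 4 * 84 + - (4 * 100) = - 64 by ring.
  rewrite exp_Ropp; have := exp_ineq1 64 => h.
  apply: (Rmult_le_reg_l (exp 64)); first exact: exp_pos.
  by rewrite Rinv_r; lra.
move=> s hs; apply: Rabs_le; split.
  have : L <= om s + C * exp (- (4 * s)); last by lra.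
  by apply: lub => y [u hu ->]; exact: cross.
have : om s - C * exp (- (4 * s)) <= L by apply: ub; exists s.
lra.
Qed.

(** Induction along a half line: at the supremum of the initial segment where P holds, the first
    hypothesis gives P there and the second carries it beyond. *)
Lemma real_induction (P : R -> Prop) (a : R) :
  (forall s, a <= s -> (forall u, a <= u < s -> P u) -> P s) ->
  (forall s, a <= s -> P s -> exists2 d, 0 < d & forall u, s <= u < s + d -> P u) ->
  forall s, a <= s -> P s.
Proof.
move=> hstep hopen s hs.
pose E x := a <= x <= s /\ forall u, a <= u <= x -> P u.
have Pa : P a by apply: hstep; [lra|move=> u hu; lra].
have Ea : E a by split; [lra|move=> u hu; have -> : u = a by lra].
have [m [ub lub]] : {m | is_lub E m}.
  by apply: completeness; [exists s => x [hx _]; lra|exists a].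
have ham : a <= m by apply: ub.
have hms : m <= s by apply: lub => x [hx _]; lra.
have below u : a <= u < m -> P u.
  move=> hu; apply: Classical_Prop.NNPP => hn.
  suff : m <= u by lra.
  apply: lub => x [hx hP]; case: (Rle_dec x u) => // h.
  by case: hn; apply: hP; lra.
have Pm : P m by exact: hstep.
case: (Req_dec m s) => [<-//|hne].
have [d hd hP] := hopen m ham Pm.
have hx : E (Rmin s (m + d / 2)).
  split; first by split; [apply: Rmin_glb; lra|exact: Rmin_l].
  move=> u hu; case: (Rlt_dec u m) => h; first by apply: below; lra.
  by apply: hP; have := Rmin_r s (m + d / 2); lra.
have := ub _ hx; rewrite /Rmin; case: Rle_dec; lra.
Qed.

Lemma continuous_pos (f : R -> R) (s : R) : continuous f s -> 0 < f s ->
  exists2 d, 0 < d & forall u, s <= u < s + d -> 0 < f u.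
Proof.
move=> hc hp.
have := hc (fun y => 0 < y) => H.
have [|d hd] := H; first exists (mkposreal _ hp) => y.
  by rewrite /ball /= /AbsRing_ball /= /abs /minus /plus /opp /= => /Rabs_def2; lra.
exists d; first exact: cond_pos.
move=> u hu; apply: hd.
by rewrite /ball /= /AbsRing_ball /= /abs /minus /plus /opp /=; apply: Rabs_def1; lra.
Qed.

(** * Monotonicity of F and f, and their normalisation *)

Definition Fs s := om s + sg s.
Definition fs s := om s - sg s.

Lemma Fs_continuous x : continuous Fs x.
Proof. by apply: (continuous_plus om sg); exact: delay_continuous. Qed.

Lemma fs_continuous x : continuous fs x.
Proof. by apply: (continuous_minus om sg); exact: delay_continuous. Qed.

Lemma fs_le2 s : s <= 2 -> fs s = 0.
Proof. by move=> hs; rewrite /fs /om /sg (delay_le2_indep 1 (-1)) //; ring. Qed.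

Lemma Fs_is_derive s : 2 < s -> is_derive Fs s (- (Fs s - fs (s - 1)) / s).
Proof.
move=> hs; have := is_derive_plus _ _ _ _ _ (delay_is_derive 1 s hs) (delay_is_derive (-1) s hs).
rewrite /plus /=; set l := (X in is_derive _ _ X -> _) => h.
suff -> : - (Fs s - fs (s - 1)) / s = l by [].
by rewrite /l /Fs /fs /om /sg; field; lra.
Qed.

Lemma fs_is_derive s : 2 < s -> is_derive fs s ((Fs (s - 1) - fs s) / s).
Proof.
move=> hs; have := is_derive_minus _ _ _ _ _ (delay_is_derive 1 s hs) (delay_is_derive (-1) s hs).
rewrite /minus /plus /opp /=; set l := (X in is_derive _ _ X -> _) => h.
suff -> : (Fs (s - 1) - fs s) / s = l by [].
by rewrite /l /Fs /fs /om /sg; field; lra.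
Qed.

(** For s <= 3 the integrals in the equations of [om] and [sg] only see arguments up to 2, where the
    two functions agree, so the integrals cancel in the sum. *)
Lemma Fs_le3 s : 1/2 <= s <= 3 -> Fs s = 2 / s.
Proof.
move=> hs; apply: (Rmult_eq_reg_l s); last lra.
rewrite /Fs Rmult_plus_distr_l /om /sg !delay_eq; try lra.
have -> : RInt (fun u => delay (-1) (u - 1)) 2 (Rmax 2 s) = RInt (fun u => delay 1 (u - 1)) 2 (Rmax 2 s).
  apply: RInt_ext => x; rewrite (Rmin_left 2 (Rmax 2 s)) ?(Rmax_right 2 (Rmax 2 s)); try exact: Rmax_l.
  move=> hx; apply: delay_le2_indep.
  have : Rmax 2 s <= 3 by apply: Rmax_lub; lra.
  lra.
by field; lra.
Qed.

(* Since F > f, the first place where F stops decreasing or f stops increasing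
   would give F(s) = f(s - 1) <= f(s) or f(s) = F(s - 1) >= F(s). *)
Lemma Ff_gap s : 2 <= s -> 0 < Fs s - fs (s - 1) /\ 0 < Fs (s - 1) - fs s.
Proof.
apply: (real_induction (fun s => 0 < Fs s - fs (s - 1) /\ 0 < Fs (s - 1) - fs s)) => {}s hs.
  move=> H.
  have hF : Fs s <= Fs (s - 1).
    have key a : 2 <= a <= s -> Fs s <= Fs a.
      (* The gap is known to be positive only before s, whereas [MVT_decr] asks for the sign on the
         closed interval; truncating the derivative by [Rmax] provides it at the endpoint. *)
      move=> ha; apply: (MVT_decr Fs (fun x => - Rmax 0 (Fs x - fs (x - 1)) / x)); first lra.
      - move=> x hx; rewrite Rmax_right; first by apply: Fs_is_derive; lra.
        by have := H x; lra.
      - exact: Fs_continuous.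
      move=> x hx; have := Rmax_l 0 (Fs x - fs (x - 1)) => h.
      have : 0 <= Rmax 0 (Fs x - fs (x - 1)) / x by apply: Rdiv_le_0_compat; lra.
      lra.
    case: (Rle_dec 2 (s - 1)) => h; first by apply: key; lra.
    apply: Rle_trans (key 2 _) _; first lra.
    rewrite !Fs_le3; try lra.
    by apply: Rmult_le_compat_l; [lra|apply: Rinv_le_contravar; lra].
  have hf : fs (s - 1) <= fs s.
    have key a : 2 <= a <= s -> fs a <= fs s.
      move=> ha; have := (MVT_decr (fun x => - fs x) (fun x => - (Rmax 0 (Fs (x - 1) - fs x) / x)) a s) => M.
      suff : - fs s <= - fs a by lra.
      apply: M; first lra.
      - move=> x hx; rewrite Rmax_right; first by apply: (is_derive_opp fs); apply: fs_is_derive; lra.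
        by have := H x; lra.
      - by move=> x; apply: (continuous_opp fs); exact: fs_continuous.
      move=> x hx; have := Rmax_l 0 (Fs (x - 1) - fs x) => h.
      have : 0 <= Rmax 0 (Fs (x - 1) - fs x) / x by apply: Rdiv_le_0_compat; lra.
      lra.
    case: (Rle_dec 2 (s - 1)) => h; first by apply: key; lra.
    by rewrite (fs_le2 (s - 1)) -?(fs_le2 2); [apply: key; lra|lra|lra].
  have := sg_pos s; rewrite /Fs /fs in hF hf *; lra.
move=> [h1 h2].
have [|d1 hd1 H1] := continuous_pos (fun s => Fs s - fs (s - 1)) s _ h1.
  by apply: (continuous_minus Fs); [exact: Fs_continuous|apply: continuous_shift; exact: fs_continuous].
have [|d2 hd2 H2] := continuous_pos (fun s => Fs (s - 1) - fs s) s _ h2.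
  by apply: (continuous_minus (fun s => Fs (s - 1))); [apply: continuous_shift; exact: Fs_continuous|exact: fs_continuous].
exists (Rmin d1 d2); first exact: Rmin_glb_lt.
move=> u hu; have := Rmin_l d1 d2; have := Rmin_r d1 d2 => h3 h4.
by split; [apply: H1; lra|apply: H2; lra].
Qed.

Lemma Fs_decr a b : 2 <= a < b -> Fs b < Fs a.
Proof.
move=> h; have [|||c hc E] := MVT_cont Fs (fun s => - (Fs s - fs (s - 1)) / s) a b; first lra.
- by move=> x hx; apply: Fs_is_derive; lra.
- exact: Fs_continuous.
have [h1 _] := Ff_gap c ltac:(lra).
have : 0 < (Fs c - fs (c - 1)) / c by apply: Rdiv_lt_0_compat; lra.
rewrite /Rdiv in E *; nra.
Qed.

Lemma fs_incr a b : 2 <= a < b -> fs a < fs b.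
Proof.
move=> h; have [|||c hc E] := MVT_cont fs (fun s => (Fs (s - 1) - fs s) / s) a b; first lra.
- by move=> x hx; apply: fs_is_derive; lra.
- exact: fs_continuous.
have [_ h1] := Ff_gap c ltac:(lra).
have : 0 < (Fs (c - 1) - fs c) / c by apply: Rdiv_lt_0_compat; lra.
nra.
Qed.

(* [Ep] = F - 1 and [Em] = 1 - f, where F and f are the functions of the linear
   sieve. *)
Record profile (A C : R) (Ep Em : R -> R) : Prop := Profile {
  pr_A : 0 < A;
  pr_C : 0 < C;
  Em_le2 : forall s, s <= 2 -> Em s = 1;
  Ep_le3 : forall s, 1/2 <= s <= 3 -> Ep s = A / s - 1;
  Em_cont : forall s, continuous Em s;
  Ep_cont : forall s, continuous Ep s;
  Em_der : forall s, 2 < s -> is_derive Em s (- (Em s + Ep (s - 1)) / s);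
  Ep_der : forall s, 1/2 < s -> is_derive Ep s (- (Ep s + Em (s - 1)) / s);
  Em_pos : forall s, 0 < Em s;
  Ep_pos : forall s, 1/2 <= s -> 0 < Ep s;
  Em_decay : forall s, 1/2 <= s -> Em s <= C * exp (- (4 * s));
  Ep_decay : forall s, 1/2 <= s -> Ep s <= C * exp (- (4 * s)) }.

Lemma limit_le (f : R -> R) (x C : R) : 0 < C ->
  (forall u, 2 <= u -> f u <= x + C * exp (- (4 * u))) ->
  (forall u v, 2 <= u <= v -> f u <= f v) -> forall u, 2 <= u -> f u <= x.
Proof.
move=> hC H hm u hu; apply: Rnot_lt_le => hlt.
set e := f u - x; have he : 0 < e by rewrite /e; lra.
(* Beyond C / e one has C e^(-4v) <= C / (1 + 4v) < e, against the excess e that monotonicity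
   preserves. *)
pose v := Rmax u (C / e).
have := hm u v ltac:(split; [lra|exact: Rmax_l]).
have hv : 2 <= v by have := Rmax_l u (C / e); rewrite -/v; lra.
have := H v hv; have hv2 := Rmax_r u (C / e); rewrite -/v in hv2.
have h3 : C <= v * e.
  have -> : C = C / e * e by field; lra.
  by apply: Rmult_le_compat_r; lra.
have h4 : exp (- (4 * v)) * (1 + 4 * v) <= 1.
  rewrite exp_Ropp; have := exp_ineq1 (4 * v) ltac:(lra) => h.
  have := exp_pos (4 * v) => h5.
  have : / exp (4 * v) * (1 + 4 * v) <= / exp (4 * v) * exp (4 * v).
    by apply: Rmult_le_compat_l; [apply/Rlt_le/Rinv_0_lt_compat|lra].
  by rewrite Rinv_l; lra.
have := exp_pos (- (4 * v)); set y := exp _ in h4 * => hy h1 h2.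
have : C * y < e by nra.
rewrite /e; lra.
Qed.

(** Dividing by L gives both functions the limit 1. Monotonicity keeps [Fs] above and [fs] below L,
    which makes [Ep] and [Em] positive; A = 2 / L is the classical 2 e^gamma. *)
Lemma profile_exists : exists A C Ep Em, profile A C Ep Em.
Proof.
have [L [hL HL]] := om_limit.
set C0 := exp (4 * 84) in HL; have hC0 : 0 < C0 by exact: exp_pos.
have hexp s : 0 < exp (- (4 * s)) by exact: exp_pos.
have HF s : 2 <= s -> L <= Fs s.
  move=> hs; suff : - Fs s <= - L by lra.
  apply: (limit_le (fun s => - Fs s) (- L) C0) => //.
  - move=> u hu; have /Rabs_le_between := HL u hu; have := sg_pos u; rewrite /Fs; lra.
  - by move=> u v [h1 [h2|->]]; [have := Fs_decr u v|]; lra.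
have Hf s : 2 <= s -> fs s <= L.
  apply: (limit_le fs L C0) => //.
  - move=> u hu; have /Rabs_le_between := HL u hu; have := sg_pos u; rewrite /fs; lra.
  - by move=> u v [h1 [h2|->]]; [have := fs_incr u v|]; lra.
have HF' s : 1/2 <= s -> L < Fs s.
  move=> hs; case: (Rle_dec 2 s) => h.
    by have := Fs_decr s (s + 1); have := HF (s + 1); lra.
  apply: Rle_lt_trans (HF 2 _) _; first lra.
  rewrite !Fs_le3; try lra.
  by apply: Rmult_lt_compat_l; [lra|apply: Rinv_lt_contravar; lra].
have Hf' s : fs s < L.
  case: (Rle_dec 2 s) => h; last by rewrite fs_le2; lra.
  by have := fs_incr s (s + 1); have := Hf (s + 1); lra.
have big s : s <= 2 -> 1 <= C0 * exp (- (4 * s)).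
  by move=> hs; rewrite /C0 -exp_plus; apply: exp_ge1; lra.
have hLi : 0 < / L by apply: Rinv_0_lt_compat; lra.
have LL : L * / L = 1 by apply: Rinv_r; lra.
pose C := 4 * C0 * / L.
exists (2 / L), C, (fun s => Fs s / L - 1), (fun s => 1 - fs s / L); split.
- by apply: Rdiv_lt_0_compat; lra.
- by apply: Rmult_lt_0_compat; lra.
- by move=> s hs; rewrite fs_le2 //; field; lra.
- by move=> s hs; rewrite Fs_le3 //; field; lra.
- move=> s; apply: (continuous_minus (fun _ => 1) (fun s => fs s / L)); first exact: continuous_const.
  by apply: (continuous_mult fs (fun _ => / L)); [exact: fs_continuous|exact: continuous_const].
- move=> s; apply: (continuous_minus (fun s => Fs s / L) (fun _ => 1)); last exact: continuous_const.
  by apply: (continuous_mult Fs (fun _ => / L)); [exact: Fs_continuous|exact: continuous_const].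
- move=> s hs.
  have := is_derive_minus _ _ _ _ _ (is_derive_const 1 s) (is_derive_scal _ _ (/ L) _ (fs_is_derive s hs)).
  rewrite /minus /plus /opp /zero /=; set l := (X in is_derive _ _ X -> _) => h.
  suff -> : - (1 - fs s / L + (Fs (s - 1) / L - 1)) / s = l.
    have E x : 1 + - (/ L * fs x) = 1 - fs x / L :> R by rewrite /Rdiv; ring.
    by apply: is_derive_ext h => x; exact: E.
  by rewrite /l; field; lra.
(* The delay equation is available only past 2. Below 3 the derivative is read off from F = A / s,
   with [Em (s - 1)] = 1. *)
- move=> s hs; case: (Rlt_dec s 3) => h3.
    apply: (is_derive_ext_loc (fun s => 2 / L / s - 1)).
      have hd : 0 < Rmin (s - 1/2) (3 - s) by apply: Rmin_glb_lt; lra.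
      exists (mkposreal _ hd) => y; rewrite /ball /= /AbsRing_ball /= /abs /minus /plus /opp /=.
      move=> /Rabs_def2 hy; have := Rmin_l (s - 1/2) (3 - s); have := Rmin_r (s - 1/2) (3 - s) => h4 h5.
      by rewrite Fs_le3; [field|]; lra.
    rewrite Fs_le3; last lra.
    rewrite fs_le2; last lra.
    by auto_derive; [lra|field; lra].
  have := is_derive_minus _ _ _ _ _ (is_derive_scal _ _ (/ L) _ (Fs_is_derive s ltac:(lra))) (is_derive_const 1 s).
  rewrite /minus /plus /opp /zero /=; set l := (X in is_derive _ _ X -> _) => h.
  suff -> : - (Fs s / L - 1 + (1 - fs (s - 1) / L)) / s = l.
    have E x : / L * Fs x + - 1 = Fs x / L - 1 :> R by rewrite /Rdiv; ring.
    by apply: is_derive_ext h => x; exact: E.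
  by rewrite /l; field; lra.
- move=> s; have := Hf' s; rewrite /Rdiv; nra.
- move=> s hs; have := HF' s hs; rewrite /Rdiv; nra.
- move=> s hs; case: (Rle_dec 2 s) => h; last first.
    rewrite fs_le2; last lra.
    by have := big s; have := om_bounds; rewrite /C; have := Hf' 2; have := HF' 2; rewrite Fs_le3; nra.
  have /Rabs_le_between h1 := HL s h; have h2 := sg_decay s hs.
  have -> : 1 - fs s / L = (L - fs s) * / L by rewrite /Rdiv; nra.
  have -> : C * exp (- (4 * s)) = (4 * C0 * exp (- (4 * s))) * / L by rewrite /C; ring.
  apply: Rmult_le_compat_r; first lra.
  by rewrite -/C0 in h2; have := Rmult_lt_0_compat _ _ hC0 (hexp s); rewrite /fs; lra.
- move=> s hs.
  have -> : Fs s / L - 1 = (Fs s - L) * / L by rewrite /Rdiv; nra.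
  have -> : C * exp (- (4 * s)) = (4 * C0 * exp (- (4 * s))) * / L by rewrite /C; ring.
  apply: Rmult_le_compat_r; first lra.
  case: (Rle_dec 2 s) => h.
    have /Rabs_le_between h1 := HL s h; have h2 := sg_decay s hs.
    by rewrite -/C0 in h2; have := Rmult_lt_0_compat _ _ hC0 (hexp s); rewrite /Fs; lra.
  have := big s; rewrite Fs_le3; last lra.
  have : / s <= 2 by apply: (Rmult_le_reg_l s); rewrite ?Rinv_r; lra.
  rewrite /Rdiv; lra.
Qed.

(** * One step of Buchstab's identity *)

Lemma Rabs_mul_le x y a b : Rabs x <= a -> Rabs y <= b -> Rabs (x * y) <= a * b.
Proof. by move=> h1 h2; rewrite Rabs_mult; apply: Rmult_le_compat => //; exact: Rabs_pos. Qed.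

(** In this lemma and the next three, h = 1/(p - 1), q = 1/p, a = 1/t, M = t - ln p and x = e^(-s).
    Then ht = ln p / (p t) is the relative growth of the scale, so the variable moves from s to s /
    (1 + ht). By the delay equation the profile gains about ht Y, where Y is the sum of E0 and the
    complementary profile at s - 1. Compared with the h Y that Buchstab's identity consumes, a first
    order deficit h M a Y remains. *)
Lemma main_part (h q a M K C ht E0 E1 Y x : R) :
  0 < h -> 0 <= q <= h -> 0 < a -> K * a <= 1/4 -> Rabs M <= K -> h <= 1/100 ->
  ht = h * (1 - M * a) * (1 - q) -> 0 <= C -> 0 <= x ->
  E0 + ht / (1 + ht) * Y - C * ht ^ 2 * x <= E1 -> 0 <= Y <= C * x ->
  [/\ h / 2 <= ht, ht <= 5/4 * h & E0 + h * Y - h * (M * a) * Y - 10 * C * h ^ 2 * x <= E1].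
Proof.
move=> hh hq ha hKa /Rabs_le_between hM hs E hC hx hE hY.
have hMa : - (1/4) <= M * a <= 1/4 by nra.
have h1 : h / 2 <= ht.
  have : 3/4 * (99/100) <= (1 - M * a) * (1 - q) by apply: Rmult_le_compat; lra.
  by rewrite E Rmult_assoc; nra.
have h2 : ht <= 5/4 * h.
  have : (1 - M * a) * (1 - q) <= 5/4 * 1 by apply: Rmult_le_compat; lra.
  by rewrite E Rmult_assoc; nra.
split=> //; apply: Rle_trans hE.
have hY1 : ht - ht ^ 2 <= ht / (1 + ht).
  apply: (Rmult_le_reg_r (1 + ht)); first lra.
  have -> : ht / (1 + ht) * (1 + ht) = ht by field; lra.
  by have : 0 <= ht ^ 3; [apply: pow_le; lra|nra].
have hY2 : (ht - ht ^ 2) * Y <= ht / (1 + ht) * Y by apply: Rmult_le_compat_r; lra.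
have hht : ht ^ 2 <= 2 * h ^ 2 by nra.
have h3 : ht ^ 2 * Y <= 2 * h ^ 2 * (C * x) by apply: Rmult_le_compat; try lra; apply: pow_le; lra.
have hCx : 0 <= C * x by nra.
have h4 : C * ht ^ 2 * x <= 2 * h ^ 2 * (C * x).
  have -> : C * ht ^ 2 * x = ht ^ 2 * (C * x) by ring.
  exact: Rmult_le_compat_r.
have h5 : h * (1 - M * a) * Y - 2 * h ^ 2 * (C * x) <= ht * Y.
  rewrite E.
  have : h * (1 - M * a) * q * Y <= h * (5/4) * h * (C * x).
    apply: Rmult_le_compat; try lra; first by apply: Rmult_le_pos; nra.
    by apply: Rmult_le_compat; nra.
  have : 0 <= h ^ 2 * (C * x) by apply: Rmult_le_pos => //; apply: pow_le; lra.
  nra.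
nra.
Qed.

(** The growth of N by (ht / a) M adds about h M a G0 to the bound. With G0 = D + Y, where D is the
    derivative of the complementary profile at s - 1, this cancels the deficit h M a Y of the main
    part and the term M a D in the expansion of the complementary profile at s - 1 + M a. All the
    rest is of order h a^2 x. *)
Lemma corrector_part (h q a y M K C ht N N' G0 G1 x : R) :
  0 < h -> 0 <= q <= h -> 0 < a -> K * a <= 1/4 -> Rabs M <= K -> h <= 1/100 -> h <= a ^ 2 -> a <= 1 ->
  ht = h * (1 - M * a) * (1 - q) -> h / 2 <= ht -> ht <= 5/4 * h ->
  y = / (1 + ht) -> 0 <= C -> 0 <= x -> Rabs N <= K ->
  N' = N + ht / a * M -> Rabs G0 <= C * x -> Rabs (G1 - G0) <= C * ht * x ->
  N * a ^ 2 * G0 + h * (M * a) * G0 - (20 * K * C + 2 * K ^ 2 * C) * h * a ^ 2 * x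
    <= N' * (a * y) ^ 2 * G1.
Proof.
move=> hh hq ha hKa hM hs hha ha1 E h1 h2 Ey hC hx hN EN hG0 hG1.
have hK : 0 <= K by have := Rabs_pos M; lra.
have hy : 1 - ht <= y <= 1.
  have hy0 : 0 < y by rewrite Ey; apply: Rinv_0_lt_compat; lra.
  have hy1 : y * (1 + ht) = 1 by rewrite Ey; field; lra.
  by nra.
have hy2 : 1 - 2 * ht <= y ^ 2 <= 1 by nra.
have hCx : 0 <= C * x by nra.
have hq1 : Rabs q <= h by rewrite Rabs_pos_eq; lra.
have hMa : Rabs (M * a) <= K * a by apply: Rabs_mul_le => //; rewrite Rabs_pos_eq; lra.
have aK : 0 <= a * K by nra.
have hth : Rabs (ht - h) <= h * (K * a) + 2 * h ^ 2.
  rewrite E; have -> : h * (1 - M * a) * (1 - q) - h = - h * (M * a + (1 - M * a) * q) by ring.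
  rewrite Rabs_mult Rabs_Ropp (Rabs_pos_eq h); last lra.
  have : Rabs (M * a + (1 - M * a) * q) <= K * a + 2 * h.
    apply: Rle_trans (Rabs_triang _ _) _; apply: Rplus_le_compat => //.
    apply: Rabs_mul_le => //; move/Rabs_le_between: hMa => hMa; apply: Rabs_le; lra.
  by nra.
have hz : Rabs (ht * y ^ 2 - h) <= h * (K * a) + 6 * h ^ 2.
  have -> : ht * y ^ 2 - h = (ht - h) + ht * (y ^ 2 - 1) by ring.
  apply: Rle_trans (Rabs_triang _ _) _.
  have : Rabs (ht * (y ^ 2 - 1)) <= 4 * h ^ 2.
    apply: Rle_trans (_ : (5/4 * h) * (5/2 * h) <= _); last by nra.
    by apply: Rabs_mul_le; [rewrite Rabs_pos_eq; lra|apply: Rabs_le; lra].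
  lra.
have hG1' : Rabs G1 <= 2 * (C * x).
  have -> : G1 = G0 + (G1 - G0) by ring.
  apply: Rle_trans (Rabs_triang _ _) _.
  have : C * ht * x <= C * x by have := Rmult_le_compat_l (C * x) ht 1 hCx ltac:(lra); lra.
  lra.
have t1 : Rabs (ht / a * M * (a * y) ^ 2 * G1 - h * (M * a) * G0) <=
    (a * K) * ((h * (K * a) + 6 * h ^ 2) * (2 * (C * x)) + h * (C * ht * x)).
  have -> : ht / a * M * (a * y) ^ 2 * G1 - h * (M * a) * G0
          = (M * a) * ((ht * y ^ 2 - h) * G1 + h * (G1 - G0)) by field; lra.
  rewrite (Rmult_comm a K); apply: Rabs_mul_le => //.
  apply: Rle_trans (Rabs_triang _ _) _; apply: Rplus_le_compat; first exact: Rabs_mul_le.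
  by apply: Rabs_mul_le => //; rewrite Rabs_pos_eq; lra.
have t2 : Rabs (N * ((a * y) ^ 2 * G1 - a ^ 2 * G0)) <= K * (a ^ 2 * (C * ht * x + 5/2 * h * (2 * (C * x)))).
  apply: Rabs_mul_le => //.
  have -> : (a * y) ^ 2 * G1 - a ^ 2 * G0 = a ^ 2 * ((G1 - G0) + (y ^ 2 - 1) * G1) by ring.
  apply: Rabs_mul_le; first by rewrite Rabs_pos_eq; [lra|apply: pow_le; lra].
  apply: Rle_trans (Rabs_triang _ _) _; apply: Rplus_le_compat => //.
  by apply: Rabs_mul_le => //; apply: Rabs_le; lra.
have {}t1 := proj1 (proj1 (Rabs_le_between _ _) t1).
have {}t2 := proj1 (proj1 (Rabs_le_between _ _) t2).
have -> : N' * (a * y) ^ 2 * G1 = N * a ^ 2 * G0 + h * (M * a) * G0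
   + (ht / a * M * (a * y) ^ 2 * G1 - h * (M * a) * G0) + N * ((a * y) ^ 2 * G1 - a ^ 2 * G0).
  by rewrite EN; ring.
suff : (a * K) * ((h * (K * a) + 6 * h ^ 2) * (2 * (C * x)) + h * (C * ht * x))
   + K * (a ^ 2 * (C * ht * x + 5/2 * h * (2 * (C * x))))
   <= (20 * K * C + 2 * K ^ 2 * C) * h * a ^ 2 * x by lra.
have hha2 : h <= a by nra.
have b1 : C * ht * x <= 5/4 * h * (C * x) by have := Rmult_le_compat_l (C * x) _ _ hCx h2; lra.
have hhc : 0 <= h * (C * x) by nra.
have b2 : (h * (K * a) + 6 * h ^ 2) * (2 * (C * x)) + h * (C * ht * x)
   <= h * (C * x) * (2 * K * a + 12 * a + 5/4 * a).
  have e1 : h ^ 2 * (C * x) <= h * (C * x) * a by nra.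
  have e2 : h * (C * ht * x) <= 5/4 * (h * (C * x) * a) by nra.
  nra.
have b3 : (a * K) * ((h * (K * a) + 6 * h ^ 2) * (2 * (C * x)) + h * (C * ht * x))
   <= (a * K) * (h * (C * x) * (2 * K * a + 12 * a + 5/4 * a)) by apply: Rmult_le_compat_l.
have b4 : K * (a ^ 2 * (C * ht * x + 5/2 * h * (2 * (C * x)))) <= K * (a ^ 2 * (25/4 * (h * (C * x)))).
  apply: Rmult_le_compat_l => //; apply: Rmult_le_compat_l; [apply: pow_le|]; lra.
have : 0 <= K * a ^ 2 * (h * (C * x)) by apply: Rmult_le_pos => //; apply: Rmult_le_pos => //; apply: pow_le; lra.
nra.
Qed.

(** Moving from s to s / (1 + ht) multiplies e^(-s) by at least 1 + s ht / (1 + ht). Against this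
    gain stand the shrinking of a^2, the factor 1 + h and the barrier of the complementary bound, so
    the balance is favourable only for large s. *)
Lemma barrier_part (h q a y M K B ht s x x1 xa : R) :
  0 < h -> h <= 1/100 -> h / 2 <= ht -> ht <= 5/4 * h -> 0 < a -> 0 <= B -> 0 <= s ->
  y = / (1 + ht) -> 0 <= x -> x * (1 + ht / (1 + ht) * s) <= x1 -> xa <= 4 * x ->
  (1 + h) * (B * a ^ 2 * x) + h * (B * a ^ 2 * xa) + (s / 4 - 9) * h * (B * a ^ 2 * x)
    <= B * (a * y) ^ 2 * x1.
Proof.
move=> hh hs h1 h2 ha hB hs0 Ey hx hx1 hxa.
have hy0 : 0 < y by rewrite Ey; apply: Rinv_0_lt_compat; lra.
have hy1 : y * (1 + ht) = 1 by rewrite Ey; field; lra.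
have hy : 1 - ht <= y <= 1 by nra.
have hy2 : 1 - 2 * ht <= y ^ 2 <= 1 by nra.
have hBa : 0 <= B * a ^ 2 by apply: Rmult_le_pos => //; apply: pow_le; lra.
have -> : B * (a * y) ^ 2 * x1 = B * a ^ 2 * (y ^ 2 * x1) by ring.
have -> : (1 + h) * (B * a ^ 2 * x) + h * (B * a ^ 2 * xa) + (s / 4 - 9) * h * (B * a ^ 2 * x)
  = B * a ^ 2 * ((1 + h) * x + h * xa + (s / 4 - 9) * h * x) by ring.
apply: Rmult_le_compat_l => //.
have : (1 - 2 * ht) * (x * (1 + ht / (1 + ht) * s)) <= y ^ 2 * x1.
  apply: Rmult_le_compat; try lra.
  apply: Rmult_le_pos => //; have : 0 <= ht / (1 + ht) by apply: Rdiv_le_0_compat; lra.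
  nra.
apply: Rle_trans.
have e : (1 - 2 * ht) * (ht / (1 + ht) * s) >= h * s / 4.
  have : 4/5 * ht <= ht / (1 + ht).
    apply: (Rmult_le_reg_r (1 + ht)); first lra.
    have -> : ht / (1 + ht) * (1 + ht) = ht by field; lra.
    nra.
  set z := ht / (1 + ht) => hz.
  have : 0 <= (1 - 2 * ht) * (z - 4/5 * ht) by apply: Rmult_le_pos; lra.
  have : h / 4 <= (1 - 2 * ht) * (4/5 * ht) by nra.
  nra.
nra.
Qed.

(** The three parts together. B outweighs the sum of all errors of order h a^2 x; the primed values
    belong to s1 - tau, the place reached after the slow shift, and the change of the corrector
    under this shift is paid by the increase of e^(-s). *)
Lemma step_algebra (h q a y M K C ht N N' s tau E0 E1 E' Y P D Pa G0 G1 G' x x1 x' xa B K2 c C4 C7 : R) :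
  0 < h -> 0 <= q <= h -> 0 < a -> a <= 1 -> K * a <= 1/4 -> Rabs M <= K -> h <= 1/100 -> h <= a ^ 2 ->
  ht = h * (1 - M * a) * (1 - q) -> y = / (1 + ht) -> 0 <= C -> Rabs N <= K -> Rabs N' <= K ->
  N' = N + ht / a * M -> 0 <= s ->
  0 <= x -> x <= 1 -> x * (1 + ht / (1 + ht) * s) <= x1 -> x1 <= x' -> 0 <= xa -> xa <= 4 * x ->
  E0 + ht / (1 + ht) * Y - C * ht ^ 2 * x <= E1 -> E1 <= E' -> (s <= 44 -> E1 + c * tau <= E') ->
  tau = K2 * ht * (a * y) ^ 2 -> 0 <= Y <= C * x -> Y = E0 + P ->
  Pa <= P + M * a * D + C * (M * a) ^ 2 * x ->
  G0 = D + Y -> Rabs G0 <= C * x -> Rabs (G1 - G0) <= C * ht * x -> Rabs (G' - G1) <= C * (x' - x1) ->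
  0 < c -> 0 <= C4 -> 0 <= C7 ->
  10 * C + 21 * K * C + 3 * K ^ 2 * C + 4 * C4 + C7 <= B ->
  40 * B <= c * K2 ->
  (1 + h) * (E0 + N * a ^ 2 * G0 + B * a ^ 2 * x) + h * (Pa + (C4 + B) * a ^ 2 * xa) + C7 * h * a ^ 2 * x
    <= E' + N' * (a * y) ^ 2 * G' + B * (a * y) ^ 2 * x'.
Proof.
move=> hh hq ha ha1 hKa hM hs hha E Ey hC hN hN' EN hs0 hx hx1 hxx1 hx1' hxa0 hxa.
move=> hE1 hE' hEs Etau hY EY hPa EG hG0 hG1 hG' hc hC4 hC7 hB hK2.
have [h1 h2 hmain] := main_part h q a M K C ht E0 E1 Y x hh hq ha hKa hM hs E hC hx hE1 hY.
have hK : 0 <= K by have := Rabs_pos M; lra.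
have hcor := corrector_part h q a y M K C ht N N' G0 G1 x hh hq ha hKa hM hs hha ha1 E h1 h2 Ey hC hx hN EN hG0 hG1.
have KC : 0 <= K * C by nra.
have K2C : 0 <= K ^ 2 * C by apply: Rmult_le_pos => //; apply: pow_le.
have hB0 : 0 <= B by lra.
have hbar := barrier_part h q a y M K B ht s x x1 xa hh hs h1 h2 ha hB0 hs0 Ey hx hxx1 hxa.
have hay : 0 <= (a * y) ^ 2 by apply: pow_le; apply: Rmult_le_pos; [lra|rewrite Ey; apply/Rlt_le/Rinv_0_lt_compat; lra].
have hshift : N' * (a * y) ^ 2 * G1 + B * (a * y) ^ 2 * x1 <= N' * (a * y) ^ 2 * G' + B * (a * y) ^ 2 * x'.
  have : Rabs (N' * (G' - G1)) <= K * (C * (x' - x1)) by apply: Rabs_mul_le.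
  move=> /Rabs_le_between [h3 _].
  have : 0 <= N' * (G' - G1) + B * (x' - x1) by nra.
  nra.
have ha2 : 0 < a ^ 2 by apply: pow_lt.
pose z := h * a ^ 2 * x.
have hz : 0 <= z by apply: Rmult_le_pos => //; apply: Rmult_le_pos; lra.
have r1 : h * (N * a ^ 2 * G0) <= K * C * z.
  have : Rabs (N * G0) <= K * (C * x) by apply: Rabs_mul_le.
  move=> /Rabs_le_between [_ h3]; rewrite /z.
  have : 0 < h * a ^ 2 by nra.
  nra.
have r2 : h * (C * (M * a) ^ 2 * x) <= K ^ 2 * C * z.
  have : M ^ 2 <= K ^ 2 by move/Rabs_le_between: hM; nra.
  move=> h3; rewrite /z.
  have -> : h * (C * (M * a) ^ 2 * x) = M ^ 2 * (C * (h * a ^ 2 * x)) by ring.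
  have -> : K ^ 2 * C * (h * a ^ 2 * x) = K ^ 2 * (C * (h * a ^ 2 * x)) by ring.
  by apply: Rmult_le_compat_r => //; apply: Rmult_le_pos.
have r3 : h * Pa <= h * (P + M * a * D) + K ^ 2 * C * z.
  have : h * Pa <= h * (P + M * a * D + C * (M * a) ^ 2 * x) by apply: Rmult_le_compat_l; lra.
  lra.
have r4 : h * (C4 * a ^ 2 * xa) <= 4 * C4 * z.
  rewrite /z; have : 0 <= h * a ^ 2 * C4 by apply: Rmult_le_pos => //; nra.
  nra.
have r5 : 10 * C * h ^ 2 * x <= 10 * C * z.
  have -> : 10 * C * h ^ 2 * x = 10 * (C * (h * x)) * h by ring.
  have -> : 10 * C * z = 10 * (C * (h * x)) * a ^ 2 by rewrite /z; ring.
  apply: Rmult_le_compat_l => //; apply: Rmult_le_pos; first lra.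
  by apply: Rmult_le_pos => //; nra.
have r6 : (s / 4 - 9) * h * (B * a ^ 2 * x) = (s / 4 - 9) * (B * z) by rewrite /z; ring.
have hBz : 0 <= B * z by apply: Rmult_le_pos.
have hEz : (10 * C + 21 * K * C + 3 * K ^ 2 * C + 4 * C4 + C7) * z <= B * z by apply: Rmult_le_compat_r.
have K2Cz : 0 <= K ^ 2 * C * z by apply: Rmult_le_pos.
have hcor2 : (20 * K * C + 2 * K ^ 2 * C) * h * a ^ 2 * x = (20 * K * C + 2 * K ^ 2 * C) * z by rewrite /z; ring.
have hlast : C7 * h * a ^ 2 * x = C7 * z by rewrite /z; ring.
have hmid : E1 + N' * (a * y) ^ 2 * G1 + B * (a * y) ^ 2 * x1 >=
  (1 + h) * (E0 + N * a ^ 2 * G0 + B * a ^ 2 * x) + h * (Pa + (C4 + B) * a ^ 2 * xa) + C7 * h * a ^ 2 * x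
   + (s / 4 - 10) * (B * z).
  have e1 : E0 + h * Y - h * (M * a) * Y + h * (M * a) * G0 = E0 + h * E0 + h * (P + M * a * D).
    by rewrite EG EY; ring.
  nra.
(* Past 44 the balance (s / 4 - 10) of the barrier is positive. Up to 44 it may be as low as -10 B
   z, and the slow shift pays: ht >= h / 2 and y^2 >= 1/2 turn 40 B <= c K2 into 10 B z <= c tau. *)
case: (Rle_dec s 44) => hs44; last first.
  have : 0 <= (s / 4 - 10) * (B * z) by apply: Rmult_le_pos => //; lra.
  lra.
have hE := hEs hs44.
have htau : 10 * (B * z) <= c * tau.
  have hha2 : 0 <= h * a ^ 2 by apply: Rmult_le_pos; lra.
  have hzz : z <= h * a ^ 2 by have := Rmult_le_compat_l _ _ _ hha2 hx1; rewrite /z; lra.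
  have hyy : 1/2 <= y ^ 2.
    have hy0 : 0 < y by rewrite Ey; apply: Rinv_0_lt_compat; lra.
    have hy1 : y * (1 + ht) = 1 by rewrite Ey; field; lra.
    have hy3 : 3/4 <= y by apply: (Rmult_le_reg_r (1 + ht)); lra.
    by have := Rmult_le_compat (3/4) y (3/4) y; lra.
  have -> : c * tau = (c * K2) * (ht * (a ^ 2 * y ^ 2)) by rewrite Etau; ring.
  have e1 : h / 4 * a ^ 2 <= ht * (a ^ 2 * y ^ 2).
    have -> : h / 4 * a ^ 2 = h / 2 * (a ^ 2 * (1/2)) by field.
    apply: Rmult_le_compat; try lra.
    by apply: Rmult_le_compat_l; lra.
  have e2 : 0 <= h / 4 * a ^ 2 by lra.
  have : 40 * B * (h / 4 * a ^ 2) <= c * K2 * (ht * (a ^ 2 * y ^ 2)) by apply: Rmult_le_compat; lra.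
  have : B * z <= B * (h * a ^ 2) by apply: Rmult_le_compat_l.
  lra.
have := Rmult_le_pos _ _ hs0 hBz.
lra.
Qed.

(** The rate 3 leaves room: after s moves to s1 = s / (1 + ht), e^(-3 s1) is still at most e^(-2s),
    and one factor e^(-s) absorbs the s or s^2 that comes from s - s1 <= ht s. *)
Definition decay_lip (D : R -> Prop) (C : R) (f : R -> R) : Prop :=
  (forall a, D a -> Rabs (f a) <= C * exp (- (3 * a))) /\
  (forall a b, D a -> D b -> a <= b -> Rabs (f a - f b) <= C * (b - a) * exp (- (3 * a))).

(** The complementary bound is evaluated at s - L / t with L / t <= 5/4; this is the origin of the 4
    in [xa <= 4 * x]. *)
Lemma exp_quarter : exp (5/4) <= 4.
Proof.
have h : exp (1/4) <= 4/3.
  apply: Rnot_lt_le => h.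
  have : exp 1 = exp (1/4) * exp (1/4) * (exp (1/4) * exp (1/4)).
    by rewrite -!exp_plus; congr exp; field.
  have := exp_le_3; have : 16/9 < exp (1/4) * exp (1/4) by nra.
  nra.
have -> : 5/4 = 1 + 1/4 by field.
by rewrite exp_plus; have := exp_le_3; have := exp_pos 1; have := exp_pos (1/4); nra.
Qed.

Lemma exp_ge_sq x : 0 <= x -> x ^ 2 <= 4 * exp x.
Proof.
move=> hx; have -> : exp x = exp (x / 2) * exp (x / 2) by rewrite -exp_plus; congr exp; field.
by have := exp_ineq1_le (x / 2); nra.
Qed.

(** Lets the variation of a decaying Lipschitz function be charged to that of e^(-s): the Lipschitz
    bound serves for b - a <= 1, the decay alone for longer distances. *)
Lemma exp_gap a b : 0 <= a <= b -> (forall C Z, 0 <= C ->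
  Z <= C * (b - a) * exp (- (3 * a)) -> Z <= C * exp (- (3 * a)) + C * exp (- (3 * b)) ->
  Z <= 4 * C * (exp (- a) - exp (- b))).
Proof.
move=> [ha hab] C Z hC h1 h2.
have e1 : exp (- (3 * a)) <= exp (- a) by apply: exp_mono; lra.
have e2 : exp (- (3 * b)) <= exp (- a) by apply: exp_mono; lra.
have pa := exp_pos (- a); have pb := exp_pos (- b).
have eE : exp (- a) = exp (- b) * exp (b - a) by rewrite -exp_plus; congr exp; ring.
case: (Rle_dec (b - a) 1) => h.
  apply: Rle_trans h1 _.
  have h3 : exp (- b) * (b - a) <= exp (- a) - exp (- b).
    by rewrite eE; have := exp_ineq1_le (b - a); nra.
  have h4 : exp (- a) <= 3 * exp (- b).
    rewrite eE; have : exp (b - a) <= 3 by apply: Rle_trans exp_le_3; apply: exp_mono.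
    nra.
  have h5 : (b - a) * exp (- (3 * a)) <= 3 * (exp (- a) - exp (- b)) by nra.
  have := Rmult_le_compat_l C _ _ hC h5.
  have := Rmult_le_pos _ _ hC (_ : 0 <= exp (- a) - exp (- b)); nra.
apply: Rle_trans h2 _.
have h3 : 2 * exp (- b) <= exp (- a).
  rewrite eE; have : 2 <= exp (b - a) by have := exp_ineq1_le (b - a); lra.
  nra.
have h5 : exp (- (3 * a)) + exp (- (3 * b)) <= 4 * (exp (- a) - exp (- b)) by lra.
by have := Rmult_le_compat_l C _ _ hC h5; lra.
Qed.

(** The step in a form that covers the lower bound, the upper bound, and the range where F is kept
    as A / s. Here e1 is the profile of the bound being advanced, e2 that of the complementary
    bound, d1 and d2 stand for their derivatives, and g is the corrector. C4 allows for the second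
    order terms inside the complementary bound, C7 for a further loss that the caller has to pay. *)
Lemma step_gen (D : R -> Prop) (e1 d1 e2 d2 g : R -> R) (C c K K2 B C4 C7 : R) :
  (forall a b u, D a -> D b -> a <= u <= b -> D u) -> (forall a, D a -> 0 <= a) ->
  (forall a b, D a -> D b -> a <= b ->
     e1 b + (a - b) * d1 b - C * (b - a) ^ 2 * exp (- (3 * a)) <= e1 a) ->
  (forall a b, D a -> D b -> a <= b -> e1 b <= e1 a) ->
  (forall a b, D a -> D b -> a <= b -> b <= 44 -> e1 b + c * (b - a) <= e1 a) ->
  decay_lip D C g ->
  0 <= C -> 0 < c -> 0 <= C4 -> 0 <= C7 ->
  10 * (4 * C) + 21 * K * (4 * C) + 3 * K ^ 2 * (4 * C) + 4 * C4 + C7 <= B ->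
  40 * B <= c * K2 ->
  forall t t' N N' p L s s' : R,
  1 < p -> / (p - 1) <= 1/100 -> / (p - 1) <= (/ t) ^ 2 -> 1 <= t -> K / t <= 1/4 ->
  Rabs (t - L) <= K -> 0 <= L -> t' = t + L / p -> Rabs N <= K -> Rabs N' <= K ->
  N' = N + L / p * (t - L) -> s' * t' = s * t - K2 * (/ t - / t') ->
  D s -> D s' ->
  - s * d1 s = e1 s + e2 (s - 1) -> 0 <= e1 s + e2 (s - 1) <= 4 * C * exp (- s) ->
  e2 (s - L / t) <= e2 (s - 1) + (t - L) / t * d2 (s - 1) + 4 * C * ((t - L) / t) ^ 2 * exp (- s) ->
  g s = d2 (s - 1) + (e1 s + e2 (s - 1)) ->
  let h := / (p - 1) in
  (1 + h) * (e1 s + N / t ^ 2 * g s + B / t ^ 2 * exp (- s))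
    + h * (e2 (s - L / t) + (C4 + B) / t ^ 2 * exp (- (s - L / t))) + C7 * h / t ^ 2 * exp (- s)
    <= e1 s' + N' / t' ^ 2 * g s' + B / t' ^ 2 * exp (- s').
Proof.
move=> Dconv Dpos HT Hm1 Hm2 [Hg1 Hg2] hC hc hC4 hC7 hB hK2.
move=> t t' N N' p L s s' hp hh1 hh2 ht hKt hM hL Et' hN hN' EN' Es' Ds Ds' Ed HY HPa Eg h; rewrite -/h in hh1 hh2.
set M := t - L in hM EN' HPa.
set a := / t.
have ha : 0 < a by apply: Rinv_0_lt_compat; lra.
have hat : a * t = 1 by apply: Rinv_l; lra.
have ha1 : a <= 1 by nra.
have hh : 0 < h by apply: Rinv_0_lt_compat; lra.
set ht_ := L / p * a.
have hLp : 0 <= L / p by apply: Rdiv_le_0_compat; lra.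
have hht0 : 0 <= ht_ by apply: Rmult_le_pos; lra.
have EM : M * a = 1 - L * a by rewrite /M; nra.
have Eht : ht_ = h * (1 - M * a) * (1 - / p).
  by rewrite EM /ht_ /h; field; lra.
pose y := / (1 + ht_).
have hy0 : 0 < y by apply: Rinv_0_lt_compat; lra.
have hy1 : y * (1 + ht_) = 1 by apply: Rinv_l; lra.
have Et2 : t' = t * (1 + ht_) by rewrite Et' /ht_; nra.
have ht'0 : 0 < t' by rewrite Et2; nra.
have Ea' : / t' = a * y by rewrite Et2 /a /y; field; lra.
have hK : 0 <= K by have := Rabs_pos M; lra.
have hKa : K * a <= 1/4 by [].
have hq : 0 <= / p <= h.
  by split; [apply/Rlt_le/Rinv_0_lt_compat; lra|apply: Rinv_le_contravar; lra].
have hMa : Rabs (M * a) <= 1/4.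
  by apply: Rle_trans hKa; apply: Rabs_mul_le => //; rewrite Rabs_pos_eq; lra.
have [hMa1 hMa2] : -(1/4) <= M * a <= 1/4 by apply/Rabs_le_between.
have hht1 : ht_ <= 1/10.
  rewrite Eht; apply: Rle_trans (_ : (1/100 * (5/4)) * 1 <= _); last lra.
  apply: Rmult_le_compat; try lra; first by apply: Rmult_le_pos; lra.
  by apply: Rmult_le_compat; lra.
have hy9 : 9/10 <= y <= 1 by nra.
pose s1 := s * y.
pose tau := K2 * ht_ * (a * y) ^ 2.
have hs0 := Dpos _ Ds.
have ha'a : / t - / t' = a * ht_ * y.
  rewrite Ea' -/a; have -> : a * ht_ * y = a * (ht_ * y) by ring.
  have -> : ht_ * y = 1 - y by lra.
  ring.
(* The new scale alone would give s1 = s t / t'; the growth of k accounts for the further decrease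
   tau. *)
have Es1 : s' = s1 - tau.
  apply: (Rmult_eq_reg_r t'); last lra.
  rewrite Es' ha'a /s1 /tau Et2.
  have -> : (s * y - K2 * ht_ * (a * y) ^ 2) * (t * (1 + ht_))
     = s * t * (y * (1 + ht_)) - K2 * (a * ht_ * y) * (a * t) * (y * (1 + ht_)) by ring.
  by rewrite hy1 hat; ring.
have hB0 : 0 <= B.
  have : 0 <= K * (4 * C) by apply: Rmult_le_pos; lra.
  have : 0 <= K ^ 2 * (4 * C) by apply: Rmult_le_pos; [apply: pow_le|lra].
  lra.
have hK20 : 0 <= K2 by apply: (Rmult_le_reg_l c) => //; lra.
have htau : 0 <= tau.
  by apply: Rmult_le_pos; [apply: Rmult_le_pos|apply: pow_le; apply: Rmult_le_pos; lra].
have hs1s : s1 <= s by rewrite /s1; nra.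
have Ds1 : D s1 by apply: (Dconv s' s) => //; lra.
have Ess : s - s1 = ht_ / (1 + ht_) * s.
  by rewrite /s1 /y; field; lra.
have hss : s - s1 <= ht_ * s.
  rewrite Ess; apply: Rmult_le_compat_r => //.
  apply: (Rmult_le_reg_r (1 + ht_)); first lra.
  have -> : ht_ / (1 + ht_) * (1 + ht_) = ht_ by field; lra.
  nra.
have hx1 : exp (- (3 * s1)) <= exp (- s) * exp (- s).
  by rewrite -exp_plus; apply: exp_mono; rewrite /s1; nra.
have hx0 := exp_pos (- s).
have hxx : exp (- s) * exp s = 1 by rewrite -exp_plus -exp_0; congr exp; ring.
have := step_algebra h (/ p) a y M K (4 * C) ht_ N N' s tau (e1 s) (e1 s1) (e1 s')
  (e1 s + e2 (s - 1)) (e2 (s - 1)) (d2 (s - 1)) (e2 (s - L / t)) (g s) (g s1) (g s')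
  (exp (- s)) (exp (- s1)) (exp (- s')) (exp (- (s - L / t))) B K2 c C4 C7.
have E2 z : z / t ^ 2 = z * a ^ 2 by rewrite /a; field; lra.
have E3 z : z / t' ^ 2 = z * (a * y) ^ 2 by rewrite -Ea'; field; lra.
rewrite !E2 !E3 => H.
apply: H => //.
- lra.
- by rewrite EN' /ht_; field; lra.
- lra.
- by rewrite -exp_0; apply: exp_mono; lra.
- rewrite -Ess; have -> : exp (- s1) = exp (- s) * exp (s - s1) by rewrite -exp_plus; congr exp; ring.
  by apply: Rmult_le_compat_l; [lra|exact: exp_ineq1_le].
- by apply: exp_mono; lra.
- exact/Rlt_le/exp_pos.
- have -> : - (s - L / t) = - s + (1 - M * a) by rewrite EM /a; field; lra.
  rewrite exp_plus Rmult_comm; apply: Rmult_le_compat_r; first lra.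
  by apply: Rle_trans exp_quarter; apply: exp_mono; lra.
- have := HT s1 s Ds1 Ds hs1s.
  have -> : (s1 - s) * d1 s = ht_ / (1 + ht_) * (e1 s + e2 (s - 1)).
    have E5 : s1 - s = - (ht_ / (1 + ht_) * s) by rewrite -Ess; ring.
    by rewrite -Ed E5; ring.
  move=> hT; apply: Rle_trans hT.
  suff : C * (s - s1) ^ 2 * exp (- (3 * s1)) <= 4 * C * ht_ ^ 2 * exp (- s) by lra.
  have h3 : (s - s1) ^ 2 <= ht_ ^ 2 * s ^ 2.
    have -> : ht_ ^ 2 * s ^ 2 = (ht_ * s) ^ 2 by ring.
    by apply: pow_incr; lra.
  have h4 : s ^ 2 * exp (- (3 * s1)) <= 4 * exp (- s).
    apply: Rle_trans (_ : 4 * exp s * (exp (- s) * exp (- s)) <= _); last first.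
      by rewrite Rmult_assoc -(Rmult_assoc (exp s)) (Rmult_comm (exp s)) hxx; lra.
    apply: Rmult_le_compat => //; [exact: pow2_ge_0|exact/Rlt_le/exp_pos|exact: exp_ge_sq].
  apply: Rle_trans (_ : C * (ht_ ^ 2 * s ^ 2) * exp (- (3 * s1)) <= _).
    apply: Rmult_le_compat_r; first exact/Rlt_le/exp_pos.
    exact: Rmult_le_compat_l.
  have -> : C * (ht_ ^ 2 * s ^ 2) * exp (- (3 * s1)) = C * ht_ ^ 2 * (s ^ 2 * exp (- (3 * s1))) by ring.
  have -> : 4 * C * ht_ ^ 2 * exp (- s) = C * ht_ ^ 2 * (4 * exp (- s)) by ring.
  by apply: Rmult_le_compat_l => //; apply: Rmult_le_pos => //; exact: pow2_ge_0.
- by apply: Hm1 => //; lra.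
- move=> h44; have -> : tau = s1 - s' by lra.
  by apply: Hm2 => //; lra.
- apply: Rle_trans (Hg1 s Ds) _; have : exp (- (3 * s)) <= exp (- s) by apply: exp_mono; lra.
  nra.
- apply: Rle_trans (Hg2 s1 s Ds1 Ds hs1s) _.
  have h4 : s * exp (- (3 * s1)) <= exp (- s).
    apply: Rle_trans (_ : exp s * (exp (- s) * exp (- s)) <= _); last first.
      by rewrite -(Rmult_assoc (exp s)) (Rmult_comm (exp s)) hxx; lra.
    apply: Rmult_le_compat => //; first exact/Rlt_le/exp_pos.
    by have := exp_ineq1_le s; lra.
  apply: Rle_trans (_ : C * (ht_ * s) * exp (- (3 * s1)) <= _).
    apply: Rmult_le_compat_r; first exact/Rlt_le/exp_pos.
    by apply: Rmult_le_compat_l => //; lra.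
  have -> : C * (ht_ * s) * exp (- (3 * s1)) = C * ht_ * (s * exp (- (3 * s1))) by ring.
  apply: Rle_trans (_ : C * ht_ * exp (- s) <= _).
    by apply: Rmult_le_compat_l => //; apply: Rmult_le_pos.
  have : 0 <= C * ht_ * exp (- s) by apply: Rmult_le_pos; [apply: Rmult_le_pos|lra].
  lra.
- apply: (exp_gap s' s1 _ C) => //; first by split; [exact: Dpos|lra].
    by apply: Hg2 => //; lra.
  apply: Rle_trans (Rabs_triang _ _) _; rewrite Rabs_Ropp.
  by apply: Rplus_le_compat; apply: Hg1.
Qed.

(** * Decay and smoothness of the profile *)

Definition from (lo : R) : R -> Prop := fun s => lo <= s.

Lemma decay_lip_weaken (D D' : R -> Prop) C C' f :
  (forall s, D' s -> D s) -> C <= C' -> decay_lip D C f -> decay_lip D' C' f.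
Proof.
move=> hD hC [h1 h2]; split=> [a Da|a b Da Db hab].
  apply: Rle_trans (h1 a (hD a Da)) _.
  by apply: Rmult_le_compat_r => //; exact/Rlt_le/exp_pos.
apply: Rle_trans (h2 a b (hD a Da) (hD b Db) hab) _.
apply: Rmult_le_compat_r; first exact/Rlt_le/exp_pos.
by apply: Rmult_le_compat_r; lra.
Qed.

Lemma decay_lip_add D C1 C2 f1 f2 : decay_lip D C1 f1 -> decay_lip D C2 f2 ->
  decay_lip D (C1 + C2) (fun s => f1 s + f2 s).
Proof.
move=> [h1 h2] [h3 h4]; split=> [a Da|a b Da Db hab].
  apply: Rle_trans (Rabs_triang _ _) _; rewrite Rmult_plus_distr_r.
  by apply: Rplus_le_compat; [apply: h1|apply: h3].
have -> : f1 a + f2 a - (f1 b + f2 b) = (f1 a - f1 b) + (f2 a - f2 b) by ring.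
apply: Rle_trans (Rabs_triang _ _) _.
have := h2 a b Da Db hab; have := h4 a b Da Db hab; lra.
Qed.

Lemma decay_lip_opp D C f : decay_lip D C f -> decay_lip D C (fun s => - f s).
Proof.
move=> [h1 h2]; split=> [a Da|a b Da Db hab]; first by rewrite Rabs_Ropp; apply: h1.
have -> : - f a - - f b = - (f a - f b) by ring.
by rewrite Rabs_Ropp; apply: h2.
Qed.

Lemma decay_lip_shift lo C f : decay_lip (from lo) C f ->
  decay_lip (from (lo + 1)) (C * exp 3) (fun s => f (s - 1)).
Proof.
rewrite /from; move=> [h1 h2].
have E a : C * exp (- (3 * (a - 1))) = C * exp 3 * exp (- (3 * a)).
  by rewrite Rmult_assoc -exp_plus; congr (_ * exp _); ring.
split=> [a Da|a b Da Db hab].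
  by rewrite -E; apply: h1; lra.
have -> : C * exp 3 * (b - a) * exp (- (3 * a)) = C * ((b - 1) - (a - 1)) * exp (- (3 * (a - 1))).
  have -> : C * ((b - 1) - (a - 1)) * exp (- (3 * (a - 1))) = (b - a) * (C * exp (- (3 * (a - 1)))) by ring.
  by rewrite E; ring.
by apply: h2; lra.
Qed.

Lemma decay_lip_clamp C f : 0 <= C -> decay_lip (from 2) C f ->
  decay_lip (from (1/2)) (C * exp 3) (fun s => f (Rmax 2 (s - 1))).
Proof.
rewrite /from; move=> hC [h1 h2].
have E a : C * exp (- (3 * (Rmax 2 (a - 1)))) <= C * exp 3 * exp (- (3 * a)).
  rewrite Rmult_assoc -exp_plus; apply: Rmult_le_compat_l => //; apply: exp_mono.
  by have := Rmax_r 2 (a - 1); lra.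
split=> [a Da|a b Da Db hab].
  by apply: Rle_trans (E a); apply: h1; exact: Rmax_l.
have hm : Rmax 2 (a - 1) <= Rmax 2 (b - 1) by apply: Rle_max_compat_l; lra.
have hm2 : Rmax 2 (b - 1) - Rmax 2 (a - 1) <= b - a.
  by rewrite /Rmax; case: Rle_dec => h3; case: Rle_dec => h4; lra.
apply: Rle_trans (h2 _ _ (Rmax_l _ _) (Rmax_l _ _) hm) _.
have e1 := E a; have e2 := exp_pos (- (3 * Rmax 2 (a - 1))).
have e3 : 0 <= C * exp (- (3 * Rmax 2 (a - 1))) by apply: Rmult_le_pos; lra.
set x := exp (- (3 * Rmax _ _)) in e1 e2 e3 *; set y := exp (- (3 * a)) in e1 *.
apply: Rle_trans (_ : (b - a) * (C * x) <= _).
  have -> : C * (Rmax 2 (b - 1) - Rmax 2 (a - 1)) * x = (Rmax 2 (b - 1) - Rmax 2 (a - 1)) * (C * x) by ring.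
  exact: Rmult_le_compat_r.
have -> : C * exp 3 * (b - a) * y = (b - a) * (C * exp 3 * y) by ring.
by apply: Rmult_le_compat_l; lra.
Qed.

Lemma decay_lip_div D C f : (forall s, D s -> 1/2 <= s) -> 0 <= C ->
  decay_lip D C f -> decay_lip D (6 * C) (fun s => f s / s).
Proof.
move=> hD hC [h1 h2].
have hi s : D s -> 0 < / s <= 2.
  move=> /hD hs; split; first by apply: Rinv_0_lt_compat; lra.
  by apply: (Rmult_le_reg_l s); rewrite ?Rinv_r; lra.
split=> [a Da|a b Da Db hab].
  rewrite /Rdiv Rabs_mult (Rabs_pos_eq (/ a)); last by have := hi a Da; lra.
  have := h1 a Da; have := Rabs_pos (f a); have := hi a Da => e1 e2 e3.
  have : Rabs (f a) * / a <= C * exp (- (3 * a)) * 2 by apply: Rmult_le_compat; lra.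
  lra.
have -> : f a / a - f b / b = (f a - f b) * / a + f b * ((b - a) * (/ a * / b)).
  by have := hD a Da; have := hD b Db => *; field; lra.
have [p1 p2] := hi a Da; have [p3 p4] := hi b Db.
have pe := exp_pos (- (3 * a)).
apply: Rle_trans (Rabs_triang _ _) _.
rewrite Rabs_mult (Rabs_pos_eq (/ a)); last lra.
rewrite Rabs_mult (Rabs_pos_eq ((b - a) * _)); last first.
  by apply: Rmult_le_pos; [lra|apply: Rmult_le_pos; lra].
have t1 : Rabs (f a - f b) * / a <= (C * (b - a) * exp (- (3 * a))) * 2.
  by apply: Rmult_le_compat; try lra; [exact: Rabs_pos|exact: h2].
have t2 : Rabs (f b) * ((b - a) * (/ a * / b)) <= (C * exp (- (3 * a))) * ((b - a) * 4).
  apply: Rmult_le_compat; first exact: Rabs_pos.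
  - by apply: Rmult_le_pos; [lra|apply: Rmult_le_pos; lra].
  - apply: Rle_trans (h1 b Db) _; apply: Rmult_le_compat_l => //; apply: exp_mono; lra.
  - apply: Rmult_le_compat_l; first lra.
    by have := Rmult_le_compat (/ a) 2 (/ b) 2; lra.
lra.
Qed.

Lemma decay_lip_deriv lo C (f d : R -> R) : 0 <= C ->
  (forall a, lo <= a -> Rabs (f a) <= C * exp (- (3 * a))) ->
  (forall x, continuous f x) -> (forall x, lo < x -> is_derive f x (d x)) ->
  (forall a, lo <= a -> Rabs (d a) <= C * exp (- (3 * a))) -> decay_lip (from lo) C f.
Proof.
move=> hC hf hc hd hdb; split=> // a b Da Db; rewrite /from in Da Db.
case=> [hab|->]; last by rewrite Rminus_diag_eq // Rabs_R0 Rminus_diag_eq // Rmult_0_r Rmult_0_l; apply: Rle_refl.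
have [|||xi hxi E] := MVT_cont f d a b => //; first by move=> x hx; apply: hd; lra.
rewrite Rabs_minus_sym E Rabs_mult (Rabs_pos_eq (b - a)); last lra.
have -> : C * (b - a) * exp (- (3 * a)) = (C * exp (- (3 * a))) * (b - a) by ring.
apply: Rmult_le_compat_r; first lra.
apply: Rle_trans (hdb xi _) _; first lra.
by apply: Rmult_le_compat_l => //; apply: exp_mono; lra.
Qed.

Lemma taylor_left lo C (f d : R -> R) a b :
  (forall x, continuous f x) -> (forall x, lo < x -> is_derive f x (d x)) ->
  decay_lip (from lo) C d -> lo <= a <= b ->
  Rabs (f a - f b - (a - b) * d b) <= C * (b - a) ^ 2 * exp (- (3 * a)).
Proof.
move=> hc hd [h1 h2] [hla]; case=> [hab|->]; last first.
  by rewrite !Rminus_diag_eq ?Rmult_0_l ?Rminus_0_r ?Rabs_R0 //; lra.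
have [|||xi hxi E] := MVT_cont f d a b => //; first by move=> x hx; apply: hd; lra.
have -> : f a - f b - (a - b) * d b = - ((d xi - d b) * (b - a)) by nra.
rewrite Rabs_Ropp Rabs_mult (Rabs_pos_eq (b - a)); last lra.
have hC : 0 <= C.
  have := h1 a hla; have := Rabs_pos (d a); have := exp_pos (- (3 * a)) => e1 e2 e3.
  by apply: (Rmult_le_reg_r (exp (- (3 * a)))); lra.
have -> : C * (b - a) ^ 2 * exp (- (3 * a)) = (C * (b - a) * exp (- (3 * a))) * (b - a) by ring.
apply: Rmult_le_compat_r; first lra.
apply: Rle_trans (h2 xi b _ _ _) _; rewrite /from; try lra.
apply: Rmult_le_compat; try exact/Rlt_le/exp_pos.
- by apply: Rmult_le_pos; lra.
- by apply: Rmult_le_compat_l; lra.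
- by apply: exp_mono; lra.
Qed.

Lemma taylor_right lo C (f d : R -> R) a b :
  (forall x, continuous f x) -> (forall x, lo < x -> is_derive f x (d x)) ->
  decay_lip (from lo) C d -> lo <= a <= b ->
  Rabs (f b - f a - (b - a) * d a) <= C * (b - a) ^ 2 * exp (- (3 * a)).
Proof.
move=> hc hd [h1 h2] [hla]; case=> [hab|->]; last first.
  by rewrite !Rminus_diag_eq ?Rmult_0_l ?Rminus_0_r ?Rabs_R0 //; lra.
have [|||xi hxi E] := MVT_cont f d a b => //; first by move=> x hx; apply: hd; lra.
have -> : f b - f a - (b - a) * d a = - ((d a - d xi) * (b - a)) by nra.
rewrite Rabs_Ropp Rabs_mult (Rabs_pos_eq (b - a)); last lra.
have hC : 0 <= C.
  have := h1 a hla; have := Rabs_pos (d a); have := exp_pos (- (3 * a)) => e1 e2 e3.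
  by apply: (Rmult_le_reg_r (exp (- (3 * a)))); lra.
have -> : C * (b - a) ^ 2 * exp (- (3 * a)) = (C * (b - a) * exp (- (3 * a))) * (b - a) by ring.
apply: Rmult_le_compat_r; first lra.
apply: Rle_trans (h2 a xi _ _ _) _; rewrite /from; try lra.
apply: Rmult_le_compat_r; first exact/Rlt_le/exp_pos.
by apply: Rmult_le_compat_l; lra.
Qed.

Definition Dm (Ep Em : R -> R) s := - (Em s + Ep (s - 1)) / s.
Definition Dp (Ep Em : R -> R) s := - (Ep s + Em (s - 1)) / s.
(** The correctors D + Y of [corrector_part]. In [Gp] the argument is clamped at 2: [Em] has a
    corner there and [Dm] is its derivative only to the right, while the corrector has to be
    Lipschitz for all s >= 1/2, since a step may end below s = 3. *)
Definition Gm (Ep Em : R -> R) s := Dp Ep Em (s - 1) + (Em s + Ep (s - 1)).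
Definition Gp (Ep Em : R -> R) s := Dm Ep Em (Rmax 2 (s - 1)) + (Ep s + Em (s - 1)).

(** The equation of [Ep] at s >= 1/2 reads [Em] at s - 1, hence the range from -1/2 for [Em]. *)
Lemma profile_smooth A C0 Ep Em : profile A C0 Ep Em -> exists2 C, 0 < C &
  [/\ decay_lip (from (-1/2)) C Em, decay_lip (from (1/2)) C Ep,
      decay_lip (from 2) C (Dm Ep Em) & decay_lip (from (1/2)) C (Dp Ep Em)] /\
      decay_lip (from 2) C (Gm Ep Em) /\ decay_lip (from (1/2)) C (Gp Ep Em).
Proof.
case=> hA hC0 Em2 Ep3 cEm cEp dEm dEp pEm pEp bEm bEp.
have e3 := exp_pos 3; have e6 := exp_pos 6.
have e31 : 1 <= exp 3 by apply: exp_ge1; lra.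
(* The summand e^6 makes C1 e^(-3a) at least 1 up to a = 2, where [Em] equals 1. *)
pose C1 := C0 + exp 6.
have bEm1 a : -1/2 <= a -> Rabs (Em a) <= C1 * exp (- (3 * a)).
  move=> ha; rewrite Rabs_pos_eq; last exact/Rlt_le/pEm.
  have pe := exp_pos (- (3 * a)).
  case: (Rle_dec a 2) => h.
    rewrite Em2 // /C1 Rmult_plus_distr_r -exp_plus.
    have : 1 <= exp (6 + - (3 * a)) by apply: exp_ge1; lra.
    by have := Rmult_lt_0_compat _ _ hC0 pe; lra.
  apply: Rle_trans (bEm a _) _; first lra.
  apply: Rmult_le_compat; try lra; first exact/Rlt_le/exp_pos.
    by rewrite /C1; lra.
  by apply: exp_mono; lra.
have bEp1 a : 1/2 <= a -> Rabs (Ep a) <= C1 * exp (- (3 * a)).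
  move=> ha; rewrite Rabs_pos_eq; last exact/Rlt_le/pEp.
  apply: Rle_trans (bEp a ha) _; apply: Rmult_le_compat; try lra; first exact/Rlt_le/exp_pos.
    by rewrite /C1; lra.
  by apply: exp_mono; lra.
have hC1 : 0 < C1 by rewrite /C1; lra.
pose C2 := 4 * C1 * exp 3.
have hC12 : C1 <= C2 by rewrite /C2; nra.
have dbound (f g : R -> R) a : 1/2 <= a -> Rabs (f a) <= C1 * exp (- (3 * a)) ->
    Rabs (g (a - 1)) <= C1 * exp (- (3 * (a - 1))) ->
    Rabs (- (f a + g (a - 1)) / a) <= C2 * exp (- (3 * a)).
  move=> ha h1 h2; have hi : / a <= 2 by apply: (Rmult_le_reg_l a); rewrite ?Rinv_r; lra.
  have hi0 : 0 < / a by apply: Rinv_0_lt_compat; lra.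
  rewrite /Rdiv Rabs_mult Rabs_Ropp (Rabs_pos_eq (/ a)); last lra.
  have : Rabs (f a + g (a - 1)) <= 2 * C1 * exp 3 * exp (- (3 * a)).
    apply: Rle_trans (Rabs_triang _ _) _.
    have E : exp (- (3 * (a - 1))) = exp 3 * exp (- (3 * a)) by rewrite -exp_plus; congr exp; ring.
    rewrite E in h2; have := exp_pos (- (3 * a)) => pe.
    have : C1 * exp (- (3 * a)) <= C1 * (exp 3 * exp (- (3 * a))) by apply: Rmult_le_compat_l; nra.
    lra.
  move=> h3; have := Rmult_le_compat _ _ _ _ (Rabs_pos _) (Rlt_le _ _ hi0) h3 hi.
  rewrite /C2; lra.
have lEp : decay_lip (from (1/2)) C2 Ep.
  apply: (decay_lip_deriv _ _ _ (Dp Ep Em)) => //; first lra.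
  - move=> a ha; apply: Rle_trans (bEp1 a ha) _.
    by apply: Rmult_le_compat_r => //; exact/Rlt_le/exp_pos.
  - by move=> a ha; apply: dbound => //; [apply: bEp1|apply: bEm1; lra].
have lEm2 : decay_lip (from 2) C2 Em.
  apply: (decay_lip_deriv _ _ _ (Dm Ep Em)) => //; first lra.
  - move=> a ha; apply: Rle_trans (bEm1 a _) _; first lra.
    by apply: Rmult_le_compat_r => //; exact/Rlt_le/exp_pos.
  - by move=> a ha; apply: dbound; [lra|apply: bEm1; lra|apply: bEp1; lra].
have lEm : decay_lip (from (-1/2)) C2 Em.
  split=> [a ha|a b ha hb hab].
    apply: Rle_trans (bEm1 a ha) _.
    by apply: Rmult_le_compat_r => //; exact/Rlt_le/exp_pos.
  case: (Rle_dec 2 a) => h2a; first by apply: (proj2 lEm2) => //; rewrite /from; lra.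
  have pe := exp_pos (- (3 * a)).
  case: (Rle_dec 2 b) => h2b; last first.
    rewrite !Em2; try lra.
    by rewrite Rminus_diag_eq // Rabs_R0; apply: Rmult_le_pos; [apply: Rmult_le_pos|]; lra.
  have -> : Em a = Em 2 by rewrite !Em2; lra.
  apply: Rle_trans (proj2 lEm2 2 b _ _ _) _; rewrite /from; try lra.
  apply: Rmult_le_compat; try exact/Rlt_le/exp_pos.
  - by apply: Rmult_le_pos; lra.
  - by apply: Rmult_le_compat_l; lra.
  - by apply: exp_mono; lra.
have C2e : 0 < C2 * exp 3 by apply: Rmult_lt_0_compat; lra.
have C2e1 : C2 <= C2 * exp 3 by nra.
pose C3 := C2 + C2 * exp 3.
have lS1 : decay_lip (from (1/2)) C3 (fun s => Ep s + Em (s - 1)).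
  apply: decay_lip_add => //.
  apply: decay_lip_weaken (decay_lip_shift _ _ _ lEm); [rewrite /from => s; lra|lra].
have lS2 : decay_lip (from 2) C3 (fun s => Em s + Ep (s - 1)).
  apply: decay_lip_add => //.
  apply: decay_lip_weaken (decay_lip_shift _ _ _ lEp); [rewrite /from => s; lra|lra].
have hC3 : 0 < C3 by rewrite /C3; lra.
have lDp : decay_lip (from (1/2)) (6 * C3) (Dp Ep Em).
  by apply: (decay_lip_div _ _ (fun s => - (Ep s + Em (s - 1)))); [|lra|exact: decay_lip_opp].
have lDm : decay_lip (from 2) (6 * C3) (Dm Ep Em).
  apply: (decay_lip_div _ _ (fun s => - (Em s + Ep (s - 1)))); [|lra|exact: decay_lip_opp].
  by rewrite /from => s; lra.
pose C4 := 6 * C3 * exp 3 + C3.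
have c3e : 0 < C3 * exp 3 by apply: Rmult_lt_0_compat.
have c3e1 : C3 <= C3 * exp 3 by nra.
exists C4; first by rewrite /C4; lra.
have hC23 : C2 <= C3 by rewrite /C3; lra.
have hC24 : C2 <= C4 by rewrite /C4; lra.
have hC34 : 6 * C3 <= C4 by rewrite /C4; lra.
split; first split.
- exact: decay_lip_weaken lEm.
- exact: decay_lip_weaken lEp.
- exact: decay_lip_weaken lDm.
- exact: decay_lip_weaken lDp.
split.
  apply: (decay_lip_add _ _ _ (fun s => Dp Ep Em (s - 1))) => //.
  apply: decay_lip_weaken (decay_lip_shift _ _ _ lDp); [rewrite /from => s; lra|lra].
apply: (decay_lip_add _ _ _ (fun s => Dm Ep Em (Rmax 2 (s - 1)))) => //.
by apply: decay_lip_clamp => //; lra.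
Qed.

(* With X = e^x and t the logarithmic scale of the sifting range, [EEm] bounds
   1 - S^-/(XV) and [EEp] bounds S^+/(XV) - 1.  The term in N, the accumulated
   deviation of the scale from the logarithms of the primes, corrects the first
   order error of a step; the term in B and the slow shift k of the variable
   absorb the second order errors. *)
Definition EEm (Ep Em : R -> R) (B t N k x : R) : R :=
  let s := (x - k) / t in
  Em s + N / t ^ 2 * Gm Ep Em s + B / t ^ 2 * exp (- s).

(** The threshold 3t + K is where the lower bound becomes available for X / p: since ln p <= t + K,
    it ensures x - ln p - k >= 2t. Below it the shape A / s is kept slightly beyond s = 3, and J /
    t^2 covers the difference of profiles and correctors when a step passes from one formula to the
    other. *)
Definition EEp (A J K : R) (Ep Em : R -> R) (B t N k x : R) : R :=
  let s := (x - k) / t in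
  if Rle_dec (3 * t + K) (x - k)
  then Ep s + N / t ^ 2 * Gp Ep Em s + B / t ^ 2 * exp (- s)
  else A / s - 1 + N / t ^ 2 * (A / s) + B / t ^ 2 * exp (- s) + J / t ^ 2.

(* The passage from the primes below p to the primes up to p, with L = ln p. *)
Record transition (T0 K K2 t t' N N' p L k k' : R) : Prop := Transition {
  tr_p : 1 < p;
  tr_h1 : / (p - 1) <= 1/100;
  tr_h2 : / (p - 1) <= (/ t) ^ 2;
  tr_t : T0 <= t;
  tr_M : Rabs (t - L) <= K;
  tr_L : 0 <= L;
  tr_t' : t' = t + L / p;
  tr_N : Rabs N <= K;
  tr_N' : Rabs N' <= K;
  tr_NN' : N' = N + L / p * (t - L);
  tr_k : k' = k + K2 * (/ t - / t') }.

(** * The step for [EEm] and [EEp] *)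

Lemma from_conv lo a b u : from lo a -> from lo b -> a <= u <= b -> from lo u.
Proof. rewrite /from; lra. Qed.

(** The derivative is -(Em(s) + Ep(s - 1)) / s, and [Em] decreases, so up to 44 the slope is at
    least Em(44) / 44 in absolute value. This makes the slow shift profitable, and at s = 2 it makes
    the lower bound positive. *)
Lemma Em_slope A C Ep Em : profile A C Ep Em -> forall a b, 2 <= a -> a <= b ->
  Em b <= Em a /\ (b <= 44 -> Em b + Em 44 / 44 * (b - a) <= Em a).
Proof.
case=> hA hC0 Em2 Ep3 cEm cEp dEm dEp pEm pEp bEm bEp.
have mono a b : 2 <= a -> a <= b -> Em b <= Em a.
  move=> ha hab; apply: (MVT_decr Em (Dm Ep Em)) => //; first by move=> x hx; apply: dEm; lra.
  move=> x hx; rewrite /Dm; have := pEm x; have := pEp (x - 1) ltac:(lra) => h1 h2.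
  have : 0 < (Em x + Ep (x - 1)) / x by apply: Rdiv_lt_0_compat; lra.
  by rewrite /Rdiv; lra.
move=> a b ha hab; split=> [|hb]; first exact: mono.
case: (hab) => [h|->]; last lra.
have [|||xi hxi E] := MVT_cont Em (Dm Ep Em) a b => //; first by move=> x hx; apply: dEm; lra.
have h1 : Em 44 / 44 <= (Em xi + Ep (xi - 1)) / xi.
  apply: Rmult_le_compat; [exact/Rlt_le/pEm| |have := mono xi 44; have := pEp (xi - 1); lra|].
    by apply/Rlt_le/Rinv_0_lt_compat; lra.
  by apply: Rinv_le_contravar; lra.
have := Rmult_le_compat_r (b - a) _ _ ltac:(lra) h1.
rewrite /Dm /Rdiv in E *; lra.
Qed.

Lemma Ep_slope A C Ep Em : profile A C Ep Em -> forall a b, 1/2 <= a -> a <= b ->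
  Ep b <= Ep a /\ (b <= 44 -> Ep b + Ep 44 / 44 * (b - a) <= Ep a).
Proof.
case=> hA hC0 Em2 Ep3 cEm cEp dEm dEp pEm pEp bEm bEp.
have mono a b : 1/2 <= a -> a <= b -> Ep b <= Ep a.
  move=> ha hab; apply: (MVT_decr Ep (Dp Ep Em)) => //; first by move=> x hx; apply: dEp; lra.
  move=> x hx; rewrite /Dp; have := pEp x ltac:(lra); have := pEm (x - 1) => h1 h2.
  have : 0 < (Ep x + Em (x - 1)) / x by apply: Rdiv_lt_0_compat; lra.
  by rewrite /Rdiv; lra.
move=> a b ha hab; split=> [|hb]; first exact: mono.
case: (hab) => [h|->]; last lra.
have [|||xi hxi E] := MVT_cont Ep (Dp Ep Em) a b => //; first by move=> x hx; apply: dEp; lra.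
have p44 := pEp 44 ltac:(lra).
have h1 : Ep 44 / 44 <= (Ep xi + Em (xi - 1)) / xi.
  apply: Rmult_le_compat; [lra| |have := mono xi 44; have := pEm (xi - 1); lra|].
    by apply/Rlt_le/Rinv_0_lt_compat; lra.
  by apply: Rinv_le_contravar; lra.
have := Rmult_le_compat_r (b - a) _ _ ltac:(lra) h1.
rewrite /Dp /Rdiv in E *; lra.
Qed.

(* Past s = 3 the function s (1 + Ep s) leaves the constant value A only to
   second order. *)
Lemma Ep_near3 A C0 C Ep Em : profile A C0 Ep Em -> decay_lip (from (-1/2)) C Em -> 0 < C ->
  forall s, 1/2 <= s -> A / s - 1 <= Ep s /\ (forall d, 0 <= d -> s <= 3 + d -> Ep s <= A / s - 1 + C * d ^ 2).
Proof.
case=> hA hC0 Em2 Ep3 cEm cEp dEm dEp pEm pEp bEm bEp lEm hC s hs.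
case: (Rle_dec s 3) => h3.
  rewrite Ep3; last lra.
  split; first lra.
  by move=> d _ _; have := Rmult_le_pos C (d ^ 2) ltac:(lra) (pow2_ge_0 d); lra.
pose phi s := s * Ep s + s.
have [|||xi hxi E] := MVT_cont phi (fun s => 1 - Em (s - 1)) 3 s; first lra.
- move=> x hx; rewrite /phi.
  have d1 := is_derive_mult (fun s => s) Ep x 1 _ (is_derive_id x) (dEp x ltac:(lra)) Rmult_comm.
  have := is_derive_plus _ _ _ _ _ d1 (is_derive_id x).
  rewrite /plus /mult /one /=; set l := (X in is_derive _ _ X -> _) => h.
  suff -> : 1 - Em (x - 1) = l by [].
  by rewrite /l; field; lra.
- move=> x; apply: (continuous_plus (fun s => s * Ep s) (fun s => s)); last exact: continuous_id.
  by apply: (continuous_mult (fun s => s) Ep) => //; exact: continuous_id.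
have hp3 : phi 3 = A by rewrite /phi Ep3; [field|lra].
have hphi : Ep s = phi s / s - 1 by rewrite /phi; field; lra.
have hi : 0 < / s <= 1.
  split; first by apply: Rinv_0_lt_compat; lra.
  by rewrite -Rinv_1; apply: Rinv_le_contravar; lra.
have E1 : Em 2 = 1 by apply: Em2; lra.
have hEm : Em (xi - 1) <= 1.
  have [] := Em_slope _ _ _ _ (Profile _ _ _ _ hA hC0 Em2 Ep3 cEm cEp dEm dEp pEm pEp bEm bEp) 2 (xi - 1); lra.
split.
  rewrite hphi /Rdiv.
  have : A * / s <= phi s * / s by apply: Rmult_le_compat_r; [lra|nra].
  lra.
move=> d hd hsd.
have hl : 1 - Em (xi - 1) <= C * d.
  have := proj2 lEm 2 (xi - 1); rewrite /from E1 => /(_ ltac:(lra) ltac:(lra) ltac:(lra)) h.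
  apply: Rle_trans (Rle_abs _) _; apply: Rle_trans h _.
  have : exp (- (3 * 2)) <= 1 by rewrite -exp_0; apply: exp_mono; lra.
  have := exp_pos (- (3 * 2)) => h1 h2.
  have : C * (xi - 1 - 2) * exp (- (3 * 2)) <= C * d * 1.
    apply: Rmult_le_compat; try lra; first by apply: Rmult_le_pos; lra.
    by apply: Rmult_le_compat_l; lra.
  lra.
have hq : (1 - Em (xi - 1)) * (s - 3) <= C * d * d by apply: Rmult_le_compat; lra.
have hCd : 0 <= C * d ^ 2 by apply: Rmult_le_pos; [lra|exact: pow2_ge_0].
rewrite hphi /Rdiv.
have : phi s * / s <= (A + C * d ^ 2) * / s by apply: Rmult_le_compat_r; lra.
have : C * d ^ 2 * / s <= C * d ^ 2 * 1 by apply: Rmult_le_compat_l; lra.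
lra.
Qed.

Lemma decay_lip_le_exp D C f s : (forall s, D s -> 0 <= s) -> decay_lip D C f -> D s ->
  0 <= C -> Rabs (f s) <= C * exp (- s).
Proof.
move=> hD [h _] Ds hC; apply: Rle_trans (h s Ds) _.
by apply: Rmult_le_compat_l => //; apply: exp_mono; have := hD s Ds; lra.
Qed.

(* Where the complementary bound is not available (s - 1 <= 2), it is replaced by
   the trivial bound 1, so that F keeps the shape A/s. *)
Lemma post_step (A J K K2 B : R) : 0 < A -> 0 <= J -> 0 <= K ->
  let C := 4 * A * exp 12 in let C7 := 4 * J * exp 4 in
  10 * (4 * C) + 21 * K * (4 * C) + 3 * K ^ 2 * (4 * C) + C7 <= B ->
  40 * B <= A / 16 * K2 ->
  forall t t' N N' p L k k' s s',
  transition (4 * K + 1) K K2 t t' N N' p L k k' ->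
  1/2 <= s <= 4 -> 1/2 <= s' <= 4 -> s' * t' = s * t - K2 * (/ t - / t') ->
  let h := / (p - 1) in
  (1 + h) * (A / s - 1 + N / t ^ 2 * (A / s) + B / t ^ 2 * exp (- s) + J / t ^ 2) + h
   <= A / s' - 1 + N' / t' ^ 2 * (A / s') + B / t' ^ 2 * exp (- s') + J / t' ^ 2.
Proof.
move=> hA hJ hK C C7 hB hK2 t t' N N' p L k k' s s' [hp h1 h2 hT hM hL Et' hN hN' EN' Ek'] hs hs' Es h.
have hC : 0 < C by have := exp_pos 12; rewrite /C; nra.
have he4 := exp_pos 4.
have hC7 : 0 <= C7 by rewrite /C7; nra.
have ht1 : 1 <= t by lra.
have hKt : K / t <= 1/4.
  apply: (Rmult_le_reg_r t); first lra.
  have -> : K / t * t = K by field; lra.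
  lra.
have e12 s0 : s0 <= 4 -> 1 <= exp 12 * exp (- (3 * s0)).
  by move=> h0; rewrite -exp_plus; apply: exp_ge1; lra.
have e4 s0 : s0 <= 4 -> 1 <= exp 4 * exp (- s0).
  by move=> h0; rewrite -exp_plus; apply: exp_ge1; lra.
have inv s0 : 1/2 <= s0 -> 0 < / s0 <= 2.
  move=> h0; split; first by apply: Rinv_0_lt_compat; lra.
  by apply: (Rmult_le_reg_l s0); rewrite ?Rinv_r; lra.
have hiv x y : 1/2 <= x -> 1/2 <= y -> A / x - A / y = A * (y - x) * (/ x * / y).
  by move=> *; field; lra.
pose D s := 1/2 <= s <= 4.
(* With the constant 1 as complementary profile the delay equation holds exactly: (A / s - 1) + 1 =
   A / s = - s d1(s). On s <= 4 the slope is at least A / 16, and e^12 e^(-3s) >= 1 accounts for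
   C. *)
have := step_gen D (fun s => A / s - 1) (fun s => - A / s ^ 2) (fun _ => 1) (fun _ => 0) (fun s => A / s)
  C (A / 16) K K2 B 0 C7.
move=> /(_ _ _ _ _ _ _ (Rlt_le _ _ hC) _ (Rle_refl 0) hC7 _ hK2) H.
have hBnn : 0 <= B.
  have : 0 <= K * (4 * C) by apply: Rmult_le_pos; lra.
  have : 0 <= K ^ 2 * (4 * C) by apply: Rmult_le_pos; [apply: pow_le|]; lra.
  lra.
have {}H : (1 + h) * (A / s - 1 + N / t ^ 2 * (A / s) + B / t ^ 2 * exp (- s))
   + h * (1 + (0 + B) / t ^ 2 * exp (- (s - L / t))) + C7 * h / t ^ 2 * exp (- s)
    <= A / s' - 1 + N' / t' ^ 2 * (A / s') + B / t' ^ 2 * exp (- s').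
  apply: (H _ _ _ _ _ _ _ _ t t' N N' p L s s') => //.
  - rewrite /D; move=> *; lra.
  - rewrite /D; move=> *; lra.
  - move=> a b [ha _] [hb _] hab.
    have -> : A / b - 1 + (a - b) * (- A / b ^ 2) = A / a - 1 - A * (b - a) ^ 2 * (/ a * / b * / b) by field; lra.
    have [i1 _] := inv a ha; have [i2 _] := inv b hb.
    have : 0 <= A * (b - a) ^ 2 * (/ a * / b * / b).
      apply: Rmult_le_pos; first by apply: Rmult_le_pos; [lra|exact: pow2_ge_0].
      by apply: Rmult_le_pos; [apply: Rmult_le_pos|]; lra.
    have : 0 <= C * (b - a) ^ 2 * exp (- (3 * a)).
      apply: Rmult_le_pos; last exact/Rlt_le/exp_pos.
      by apply: Rmult_le_pos; [lra|exact: pow2_ge_0].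
    lra.
  - move=> a b [ha _] [hb _] hab; have := hiv a b ha hb.
    have [i1 _] := inv a ha; have [i2 _] := inv b hb.
    have : 0 <= A * (b - a) * (/ a * / b).
      by apply: Rmult_le_pos; [apply: Rmult_le_pos|apply: Rmult_le_pos]; lra.
    lra.
  - move=> a b [ha ha4] [hb hb4] hab _; have := hiv a b ha hb.
    have : A * (b - a) * (/ 4 * / 4) <= A * (b - a) * (/ a * / b).
      apply: Rmult_le_compat_l; first by apply: Rmult_le_pos; lra.
      by apply: Rmult_le_compat; try lra; apply: Rinv_le_contravar; lra.
    lra.
  - split=> [a [ha ha4]|a b [ha ha4] [hb hb4] hab].
      have [i1 i2] := inv a ha; have := e12 a ha4 => e.
      rewrite Rabs_pos_eq; last by apply: Rmult_le_pos; lra.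
      have : A * / a <= A * 2 by apply: Rmult_le_compat_l; lra.
      rewrite /C /Rdiv; have : A * 1 <= A * (exp 12 * exp (- (3 * a))) by apply: Rmult_le_compat_l; lra.
      lra.
    rewrite hiv //; have [i1 i2] := inv a ha; have [i3 i4] := inv b hb; have := e12 a ha4 => e.
    have nn : 0 <= A * (b - a) by apply: Rmult_le_pos; lra.
    rewrite Rabs_pos_eq; last by apply: Rmult_le_pos => //; apply: Rmult_le_pos; lra.
    have : A * (b - a) * (/ a * / b) <= A * (b - a) * (2 * 2).
      by apply: Rmult_le_compat_l => //; apply: Rmult_le_compat; lra.
    rewrite /C; have : A * (b - a) * 1 <= A * (b - a) * (exp 12 * exp (- (3 * a))) by apply: Rmult_le_compat_l; lra.
    lra.
  - by apply: Rdiv_lt_0_compat; lra.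
  - lra.
  - by field; lra.
  - have [i1 i2] := inv s (proj1 hs); have := e4 s (proj2 hs) => e.
    have e' : exp 4 <= exp 12 by apply: exp_mono; lra.
    have -> : A / s - 1 + 1 = A * / s by rewrite /Rdiv; ring.
    split; first by apply: Rmult_le_pos; lra.
    have : A * / s <= A * 2 by apply: Rmult_le_compat_l; lra.
    have : exp 4 * exp (- s) <= exp 12 * exp (- s) by apply: Rmult_le_compat_r => //; exact/Rlt_le/exp_pos.
    rewrite /C => h3; have : A * 1 <= A * (exp 12 * exp (- s)) by apply: Rmult_le_compat_l; lra.
    lra.
  - have : 0 <= 4 * C * ((t - L) / t) ^ 2 * exp (- s).
      apply: Rmult_le_pos; last exact/Rlt_le/exp_pos.
      by apply: Rmult_le_pos; [lra|exact: pow2_ge_0].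
    lra.
  - by rewrite /Rdiv; ring.
have hh0 : 0 < h by apply: Rinv_0_lt_compat; lra.
have hx : 0 <= B / t ^ 2 * exp (- (s - L / t)).
  apply: Rmult_le_pos; last exact/Rlt_le/exp_pos.
  by apply: Rdiv_le_0_compat => //; apply: pow_lt; lra.
(* The term in J has no gain of its own: it loses h from the factor 1 + h and at most 5h/2 from the
   growth of t, together below 4h, which C7 pays since e^4 e^(-s) >= 1. *)
have hJJ : (1 + h) * (J / t ^ 2) <= J / t' ^ 2 + C7 * h / t ^ 2 * exp (- s).
  set a := / t.
  have hat : a * t = 1 by apply: Rinv_l; lra.
  have ha : 0 < a by apply: Rinv_0_lt_compat; lra.
  set w := L / p * a.
  have hw0 : 0 <= w by apply: Rmult_le_pos; [apply: Rdiv_le_0_compat|]; lra.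
  have hw : w <= 5/4 * h.
    have hLa : L * a <= 5/4.
      have /Rabs_le_between [h3 _] := hM.
      have : L * a <= (t + K) * a by apply: Rmult_le_compat_r; lra.
      rewrite /Rdiv -/a in hKt; lra.
    have hph : / p <= h by apply: Rinv_le_contravar; lra.
    have hp0 : 0 < / p by apply: Rinv_0_lt_compat; lra.
    have -> : w = L * a * / p by rewrite /w /Rdiv; ring.
    by apply: Rmult_le_compat; try lra; apply: Rmult_le_pos; lra.
  have Et2 : t' = t * (1 + w).
    have -> : t * (1 + w) = t + L / p * (a * t) by rewrite /w; ring.
    by rewrite hat Et'; ring.
  have Ea' : / t' ^ 2 = a ^ 2 * (/ (1 + w)) ^ 2 by rewrite Et2 /a; field; split; lra.
  have hy : 1 - w <= / (1 + w).
    apply: (Rmult_le_reg_r (1 + w)); first lra.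
    by rewrite Rinv_l; nra.
  have hh1 : h <= 1/100 by [].
  have hy2 : 1 - 5/2 * h <= (/ (1 + w)) ^ 2 by nra.
  have hJa : 0 <= J * a ^ 2 by apply: Rmult_le_pos => //; apply: pow_le; lra.
  have -> : J / t ^ 2 = J * a ^ 2 by rewrite /a; field; lra.
  have -> : J / t' ^ 2 = J * a ^ 2 * (/ (1 + w)) ^ 2 by rewrite /Rdiv Ea'; ring.
  have -> : C7 * h / t ^ 2 * exp (- s) = 4 * h * (J * a ^ 2) * (exp 4 * exp (- s)).
    by rewrite /C7 /a; field; lra.
  have b1 := Rmult_le_compat_l _ _ _ hJa hy2.
  have b2 : 4 * h * (J * a ^ 2) * 1 <= 4 * h * (J * a ^ 2) * (exp 4 * exp (- s)).
    by apply: Rmult_le_compat_l; [apply: Rmult_le_pos; lra|apply: e4; lra].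
  have : 0 <= h * (J * a ^ 2) by apply: Rmult_le_pos; lra.
  lra.
have : 0 <= h * (B / t ^ 2 * exp (- (s - L / t))) by apply: Rmult_le_pos; lra.
rewrite Rplus_0_l in H; lra.
Qed.

Lemma from_nonneg lo : 0 <= lo -> forall s, from lo s -> 0 <= s.
Proof. by rewrite /from => h s; lra. Qed.

Lemma EEm_le Ep Em C K B t N k x : 0 <= C -> 1 <= t -> Rabs N <= K ->
  decay_lip (from 2) C (Gm Ep Em) -> 2 <= (x - k) / t ->
  EEm Ep Em B t N k x <= Em ((x - k) / t) + (K * C + B) / t ^ 2 * exp (- ((x - k) / t)).
Proof.
move=> hC ht hN lG hs; rewrite /EEm; set s := (x - k) / t in hs *.
have h := decay_lip_le_exp _ C _ s (from_nonneg 2 ltac:(lra)) lG hs hC.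
have := Rabs_mul_le _ _ _ _ hN h => /Rabs_le_between [_ h2].
have hi : 0 < / t ^ 2 by apply: Rinv_0_lt_compat; apply: pow_lt; lra.
have -> : N / t ^ 2 * Gm Ep Em s = (N * Gm Ep Em s) * / t ^ 2 by rewrite /Rdiv; ring.
have -> : (K * C + B) / t ^ 2 * exp (- s) = (K * (C * exp (- s))) * / t ^ 2 + B / t ^ 2 * exp (- s).
  by rewrite /Rdiv; ring.
by have := Rmult_le_compat_r _ _ _ (Rlt_le _ _ hi) h2; lra.
Qed.

Lemma EEp_le A C0 J Ep Em C K B t N k x : profile A C0 Ep Em -> 0 < C -> 0 <= J -> 1 <= t ->
  K <= t -> Rabs N <= K -> decay_lip (from (-1/2)) C Em ->
  decay_lip (from (1/2)) C (Gp Ep Em) -> 1/2 <= (x - k) / t ->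
  EEp A J K Ep Em B t N k x <=
    Ep ((x - k) / t) + (K * C + (2 * A * K + J) * exp 4 + B) / t ^ 2 * exp (- ((x - k) / t)).
Proof.
move=> hP hC hJ ht hKt hN lEm lG hs; rewrite /EEp; set s := (x - k) / t in hs *.
have hA := pr_A _ _ _ _ hP.
have hK : 0 <= K by have := Rabs_pos N; lra.
have hi : 0 < / t ^ 2 by apply: Rinv_0_lt_compat; apply: pow_lt; lra.
have hes := exp_pos (- s); have he4 := exp_pos 4.
have -> : (K * C + (2 * A * K + J) * exp 4 + B) / t ^ 2 * exp (- s)
  = (K * (C * exp (- s))) * / t ^ 2 + ((2 * A * K + J) * (exp 4 * exp (- s))) * / t ^ 2 + B / t ^ 2 * exp (- s).
  by rewrite /Rdiv; ring.
have nn1 : 0 <= (K * (C * exp (- s))) * / t ^ 2.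
  by apply: Rmult_le_pos; [apply: Rmult_le_pos; [|apply: Rmult_le_pos]|]; lra.
have nn0 : 0 <= 2 * A * K + J.
  by have := Rmult_le_pos A K; lra.
have nn2 : 0 <= ((2 * A * K + J) * (exp 4 * exp (- s))) * / t ^ 2.
  by apply: Rmult_le_pos; [apply: Rmult_le_pos; [|apply: Rmult_le_pos]|]; lra.
case: Rle_dec => h; cbn [is_left].
  have h1 := decay_lip_le_exp _ C _ s (from_nonneg (1/2) ltac:(lra)) lG hs (Rlt_le _ _ hC).
  have := Rabs_mul_le _ _ _ _ hN h1 => /Rabs_le_between [_ h2].
  have -> : N / t ^ 2 * Gp Ep Em s = (N * Gp Ep Em s) * / t ^ 2 by rewrite /Rdiv; ring.
  by have := Rmult_le_compat_r _ _ _ (Rlt_le _ _ hi) h2; lra.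
have [h1 _] := Ep_near3 _ _ _ _ _ hP lEm hC s hs.
have hs4 : s <= 4.
  apply: (Rmult_le_reg_r t); first lra.
  have -> : s * t = x - k by rewrite /s; field; lra.
  lra.
have e : 1 <= exp 4 * exp (- s) by rewrite -exp_plus; apply: exp_ge1; lra.
have h2 : N * (A / s) <= K * (2 * A).
  have hs2 : / s <= 2 by apply: (Rmult_le_reg_l s); rewrite ?Rinv_r; lra.
  have hs0 : 0 < / s by apply: Rinv_0_lt_compat; lra.
  have : Rabs (N * (A / s)) <= K * (2 * A).
    apply: Rabs_mul_le => //; rewrite Rabs_pos_eq /Rdiv; last by apply: Rmult_le_pos; lra.
    by rewrite Rmult_comm; apply: Rmult_le_compat_r; lra.
  by move/Rabs_le_between; lra.
have h3 : (N * (A / s) + J) * / t ^ 2 <= ((2 * A * K + J) * (exp 4 * exp (- s))) * / t ^ 2.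
  apply: Rmult_le_compat_r; first lra.
  apply: Rle_trans (_ : (2 * A * K + J) * 1 <= _); first lra.
  exact: Rmult_le_compat_l.
have -> : N / t ^ 2 * (A / s) = N * (A / s) * / t ^ 2 by rewrite /Rdiv; ring.
rewrite {4}/Rdiv; lra.
Qed.

Lemma transition_facts K K2 t t' N N' p L k k' : 0 <= K -> 0 <= K2 ->
  transition (4 * K + 1) K K2 t t' N N' p L k k' ->
  [/\ 1 <= t, K / t <= 1/4, t <= t', k <= k' & L <= t + K].
Proof.
move=> hK hK2 [hp h1 h2 hT /Rabs_le_between hM hL Et' hN hN' EN' Ek'].
have ht : 1 <= t by lra.
have hLp : 0 <= L / p by apply: Rdiv_le_0_compat; lra.
split=> //; try lra.
  apply: (Rmult_le_reg_r t); first lra.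
  have -> : K / t * t = K by field; lra.
  lra.
have : / t' <= / t by apply: Rinv_le_contravar; lra.
by rewrite Ek' => h; have := Rmult_le_pos K2 (/ t - / t') hK2; lra.
Qed.

Lemma shift_state K2 t t' k k' x : 1 <= t -> t <= t' -> k' = k + K2 * (/ t - / t') ->
  (x - k') / t' * t' = (x - k) / t * t - K2 * (/ t - / t').
Proof. by move=> h1 h2 ->; field; lra. Qed.

(** C4 is the amount by which [EEp] may exceed [Ep] and the barrier, by [EEp_le]. As s >= 2 and |t -
    L| <= t / 4, the complementary argument s - L / t is at least 3/4, inside the range of [Ep]. *)
Lemma minus_step A C0 J Ep Em C c K K2 B : profile A C0 Ep Em -> 0 < C -> 0 <= J -> 0 <= K ->
  decay_lip (from (-1/2)) C Em -> decay_lip (from (1/2)) C Ep ->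
  decay_lip (from 2) C (Dm Ep Em) -> decay_lip (from (1/2)) C (Dp Ep Em) ->
  decay_lip (from 2) C (Gm Ep Em) -> decay_lip (from (1/2)) C (Gp Ep Em) ->
  0 < c -> c <= Em 44 / 44 ->
  let C4 := K * C + (2 * A * K + J) * exp 4 in
  10 * (4 * C) + 21 * K * (4 * C) + 3 * K ^ 2 * (4 * C) + 4 * C4 <= B ->
  40 * B <= c * K2 ->
  forall t t' N N' p L k k' x, transition (4 * K + 1) K K2 t t' N N' p L k k' ->
  2 * t' <= x - k' ->
  (1 + / (p - 1)) * EEm Ep Em B t N k x + / (p - 1) * EEp A J K Ep Em B t N k (x - L)
    <= EEm Ep Em B t' N' k' x.
Proof.
move=> hP hC hJ hK lEm lEp lDm lDp lGm lGp hc hcE C4 hB hK2 t t' N N' p L k k' x tr hx.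
have hA := pr_A _ _ _ _ hP; have he4 := exp_pos 4.
have hC4 : 0 <= C4.
  rewrite /C4; apply: Rplus_le_le_0_compat; first by apply: Rmult_le_pos; lra.
  apply: Rmult_le_pos; last lra.
  by have := Rmult_le_pos A K; lra.
have hBnn : 0 <= B.
  have : 0 <= K * (4 * C) by apply: Rmult_le_pos; lra.
  have : 0 <= K ^ 2 * (4 * C) by apply: Rmult_le_pos; [apply: pow_le|]; lra.
  lra.
have hK20 : 0 <= K2 by apply: (Rmult_le_reg_l c) => //; lra.
have [ht hKt htt hkk hLt] := transition_facts _ _ _ _ _ _ _ _ _ _ hK hK20 tr.
case: (tr) => hp h1 h2 hT hM hL Et' hN hN' EN' Ek'.
set s := (x - k) / t; set s' := (x - k') / t'.
have hs' : 2 <= s'.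
  apply: (Rmult_le_reg_r t'); first lra.
  have -> : s' * t' = x - k' by rewrite /s'; field; lra.
  lra.
have hs : 2 <= s.
  apply: (Rmult_le_reg_r t); first lra.
  have -> : s * t = x - k by rewrite /s; field; lra.
  lra.
have Esa : s - L / t = (x - L - k) / t by rewrite /s; field; lra.
have hd : Rabs ((t - L) / t) <= 1/4.
  rewrite /Rdiv Rabs_mult (Rabs_pos_eq (/ t)); last by apply/Rlt_le/Rinv_0_lt_compat; lra.
  apply: Rle_trans hKt; apply: Rmult_le_compat_r => //; apply/Rlt_le/Rinv_0_lt_compat; lra.
have Ed : s - L / t = s - 1 + (t - L) / t by field; lra.
have /Rabs_le_between hd' := hd.
have hsa : 1/2 <= s - L / t by rewrite Ed; lra.
have := step_gen (from 2) Em (Dm Ep Em) Ep (Dp Ep Em) (Gm Ep Em) C c K K2 B C4 0.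
move=> /(_ (from_conv 2) (from_nonneg 2 ltac:(lra))).
have T a b : from 2 a -> from 2 b -> a <= b ->
     Em b + (a - b) * Dm Ep Em b - C * (b - a) ^ 2 * exp (- (3 * a)) <= Em a.
  move=> ha hb hab; have := taylor_left 2 C Em (Dm Ep Em) a b (Em_cont _ _ _ _ hP) (Em_der _ _ _ _ hP) lDm (conj ha hab).
  by move/Rabs_le_between; lra.
have S1 a b : from 2 a -> from 2 b -> a <= b -> Em b <= Em a.
  by move=> ha hb hab; have [] := Em_slope _ _ _ _ hP a b ha hab.
have S2 a b : from 2 a -> from 2 b -> a <= b -> b <= 44 -> Em b + c * (b - a) <= Em a.
  move=> ha hb hab h44; have [_ /(_ h44)] := Em_slope _ _ _ _ hP a b ha hab.
  have := Rmult_le_compat_r (b - a) _ _ ltac:(lra) hcE; lra.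
move=> /(_ T S1 S2 lGm (Rlt_le _ _ hC) hc hC4 (Rle_refl 0)) => H.
have {}H := H ltac:(lra) hK2 t t' N N' p L s s' hp h1 h2 ht hKt hM hL Et' hN hN' EN'
  (shift_state _ _ _ _ _ _ ht htt Ek') hs hs'.
have {}H : (1 + / (p - 1)) * (Em s + N / t ^ 2 * Gm Ep Em s + B / t ^ 2 * exp (- s))
  + / (p - 1) * (Ep (s - L / t) + (C4 + B) / t ^ 2 * exp (- (s - L / t))) + 0 * / (p - 1) / t ^ 2 * exp (- s)
    <= Em s' + N' / t' ^ 2 * Gm Ep Em s' + B / t' ^ 2 * exp (- s').
  apply: H.
  - by rewrite /Dm; field; lra.
  - have := Em_pos _ _ _ _ hP s; have := Ep_pos _ _ _ _ hP (s - 1) ltac:(lra) => p1 p2; split; first lra.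
    have q1 : Em s <= C * exp (- s).
      apply: Rle_trans (Rle_abs _) _; apply: (decay_lip_le_exp (from 2)) => //; try lra.
      - by rewrite /from => z hz; lra.
      - by apply: decay_lip_weaken lEm; rewrite /from; [move=> z hz; lra|lra].
    have q2 : Ep (s - 1) <= C * exp (- s).
      apply: Rle_trans (Rle_abs _) _; apply: Rle_trans (proj1 lEp (s - 1) _) _; first by rewrite /from; lra.
      by apply: Rmult_le_compat_l; [lra|apply: exp_mono; lra].
    have : 0 <= C * exp (- s) by apply: Rmult_le_pos; [lra|exact/Rlt_le/exp_pos].
    lra.
  - rewrite Ed; set d := (t - L) / t in hd hd' Ed *.
    have hd2 : 0 <= C * d ^ 2 by apply: Rmult_le_pos; [lra|exact: pow2_ge_0].
    have bnd a : s - 5/4 <= a -> C * d ^ 2 * exp (- (3 * a)) <= 4 * C * d ^ 2 * exp (- s).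
      move=> ha; have : C * d ^ 2 * exp (- (3 * a)) <= C * d ^ 2 * exp (- s).
        by apply: Rmult_le_compat_l => //; apply: exp_mono; lra.
      have : 0 <= C * d ^ 2 * exp (- s) by apply: Rmult_le_pos => //; exact/Rlt_le/exp_pos.
      lra.
    case: (Rle_dec 0 d) => hd0.
      have := taylor_right (1/2) C Ep (Dp Ep Em) (s - 1) (s - 1 + d) (Ep_cont _ _ _ _ hP) (Ep_der _ _ _ _ hP) lDp ltac:(lra).
      have -> : s - 1 + d - (s - 1) = d by ring.
      by move/Rabs_le_between; have := bnd (s - 1) ltac:(lra); lra.
    have := taylor_left (1/2) C Ep (Dp Ep Em) (s - 1 + d) (s - 1) (Ep_cont _ _ _ _ hP) (Ep_der _ _ _ _ hP) lDp ltac:(lra).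
    have -> : s - 1 + d - (s - 1) = d by ring.
    have -> : s - 1 - (s - 1 + d) = - d by ring.
    have -> : (- d) ^ 2 = d ^ 2 by ring.
    by move/Rabs_le_between; have := bnd (s - 1 + d) ltac:(lra); lra.
  - by [].
have hE := EEp_le A C0 J Ep Em C K B t N k (x - L) hP hC hJ ht ltac:(lra) hN lEm lGp.
rewrite -Esa in hE; have {}hE := hE hsa.
have hh : 0 < / (p - 1) by apply: Rinv_0_lt_compat; lra.
have := Rmult_le_compat_l _ _ _ (Rlt_le _ _ hh) hE.
rewrite -/C4 /EEm -/s -/s'.
lra.
Qed.

Lemma plus_step_pre A C0 J Ep Em C c K K2 B : profile A C0 Ep Em -> 0 < C -> 0 <= K ->
  C * K ^ 2 + K * (C + 2 * A) <= J ->
  decay_lip (from (-1/2)) C Em -> decay_lip (from (1/2)) C Ep ->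
  decay_lip (from 2) C (Dm Ep Em) -> decay_lip (from (1/2)) C (Dp Ep Em) ->
  decay_lip (from 2) C (Gm Ep Em) -> decay_lip (from (1/2)) C (Gp Ep Em) ->
  0 < c -> c <= Ep 44 / 44 ->
  10 * (4 * C) + 21 * K * (4 * C) + 3 * K ^ 2 * (4 * C) + 4 * (K * C) <= B ->
  40 * B <= c * K2 ->
  forall t t' N N' p L k k' x, transition (4 * K + 1) K K2 t t' N N' p L k k' ->
  t' / 2 <= x - k' -> 3 * t + K <= x - k ->
  2 * t <= x - L - k /\
  (1 + / (p - 1)) * EEp A J K Ep Em B t N k x + / (p - 1) * EEm Ep Em B t N k (x - L)
    <= EEp A J K Ep Em B t' N' k' x.
Proof.
move=> hP hC hK hJ lEm lEp lDm lDp lGm lGp hc hcE hB hK2 t t' N N' p L k k' x tr hx hpre.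
have hA := pr_A _ _ _ _ hP.
have hKC : 0 <= K * C by apply: Rmult_le_pos; lra.
have hBnn : 0 <= B.
  have : 0 <= K ^ 2 * (4 * C) by apply: Rmult_le_pos; [apply: pow_le|]; lra.
  lra.
have hK20 : 0 <= K2 by apply: (Rmult_le_reg_l c) => //; lra.
have [ht hKt htt hkk hLt] := transition_facts _ _ _ _ _ _ _ _ _ _ hK hK20 tr.
case: (tr) => hp h1 h2 hT hM hL Et' hN hN' EN' Ek'.
split; first lra.
set s := (x - k) / t; set s' := (x - k') / t'.
have Est : s * t = x - k by rewrite /s; field; lra.
have Est' : s' * t' = x - k' by rewrite /s'; field; lra.
have hs' : 1/2 <= s' by apply: (Rmult_le_reg_r t'); lra.
have hs : 3 <= s by apply: (Rmult_le_reg_r t); lra.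
have Esa : s - L / t = (x - L - k) / t by rewrite /s; field; lra.
have hsa : 2 <= s - L / t.
  by rewrite Esa; apply: (Rmult_le_reg_r t); [lra|have -> : (x - L - k) / t * t = x - L - k by field; lra]; lra.
have hd : Rabs ((t - L) / t) <= 1/4.
  rewrite /Rdiv Rabs_mult (Rabs_pos_eq (/ t)); last by apply/Rlt_le/Rinv_0_lt_compat; lra.
  apply: Rle_trans hKt; apply: Rmult_le_compat_r => //; apply/Rlt_le/Rinv_0_lt_compat; lra.
have Ed : s - L / t = s - 1 + (t - L) / t by field; lra.
have /Rabs_le_between hd' := hd.
have := step_gen (from (1/2)) Ep (Dp Ep Em) Em (Dm Ep Em) (Gp Ep Em) C c K K2 B (K * C) 0.
move=> /(_ (from_conv (1/2)) (from_nonneg (1/2) ltac:(lra))).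
have T a b : from (1/2) a -> from (1/2) b -> a <= b ->
     Ep b + (a - b) * Dp Ep Em b - C * (b - a) ^ 2 * exp (- (3 * a)) <= Ep a.
  move=> ha hb hab; have := taylor_left (1/2) C Ep (Dp Ep Em) a b (Ep_cont _ _ _ _ hP) (Ep_der _ _ _ _ hP) lDp (conj ha hab).
  by move/Rabs_le_between; lra.
have S1 a b : from (1/2) a -> from (1/2) b -> a <= b -> Ep b <= Ep a.
  by move=> ha hb hab; have [] := Ep_slope _ _ _ _ hP a b ha hab.
have S2 a b : from (1/2) a -> from (1/2) b -> a <= b -> b <= 44 -> Ep b + c * (b - a) <= Ep a.
  move=> ha hb hab h44; have [_ /(_ h44)] := Ep_slope _ _ _ _ hP a b ha hab.
  have := Rmult_le_compat_r (b - a) _ _ ltac:(lra) hcE; lra.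
move=> /(_ T S1 S2 lGp (Rlt_le _ _ hC) hc hKC (Rle_refl 0)) => H.
have hs12 : from (1/2) s by rewrite /from; lra.
have {}H := H ltac:(lra) hK2 t t' N N' p L s s' hp h1 h2 ht hKt hM hL Et' hN hN' EN'
  (shift_state _ _ _ _ _ _ ht htt Ek') hs12 hs'.
have {}H : (1 + / (p - 1)) * (Ep s + N / t ^ 2 * Gp Ep Em s + B / t ^ 2 * exp (- s))
  + / (p - 1) * (Em (s - L / t) + (K * C + B) / t ^ 2 * exp (- (s - L / t))) + 0 * / (p - 1) / t ^ 2 * exp (- s)
    <= Ep s' + N' / t' ^ 2 * Gp Ep Em s' + B / t' ^ 2 * exp (- s').
  apply: H.
  - by rewrite /Dp; field; lra.
  - have := Ep_pos _ _ _ _ hP s ltac:(lra); have := Em_pos _ _ _ _ hP (s - 1) => p1 p2; split; first lra.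
    have q1 : Ep s <= C * exp (- s).
      apply: Rle_trans (Rle_abs _) _; apply: (decay_lip_le_exp (from (1/2))) => //; try lra.
      by rewrite /from => z hz; lra.
    have q2 : Em (s - 1) <= C * exp (- s).
      apply: Rle_trans (Rle_abs _) _; apply: Rle_trans (proj1 lEm (s - 1) _) _; first by rewrite /from; lra.
      by apply: Rmult_le_compat_l; [lra|apply: exp_mono; lra].
    have : 0 <= C * exp (- s) by apply: Rmult_le_pos; [lra|exact/Rlt_le/exp_pos].
    lra.
  - rewrite Ed; rewrite Ed in hsa; set d := (t - L) / t in hd hd' Ed hsa *.
    have hd2 : 0 <= C * d ^ 2 by apply: Rmult_le_pos; [lra|exact: pow2_ge_0].
    have bnd a : s - 5/4 <= a -> C * d ^ 2 * exp (- (3 * a)) <= 4 * C * d ^ 2 * exp (- s).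
      move=> ha; have : C * d ^ 2 * exp (- (3 * a)) <= C * d ^ 2 * exp (- s).
        by apply: Rmult_le_compat_l => //; apply: exp_mono; lra.
      have : 0 <= C * d ^ 2 * exp (- s) by apply: Rmult_le_pos => //; exact/Rlt_le/exp_pos.
      lra.
    case: (Rle_dec 0 d) => hd0.
      have := taylor_right 2 C Em (Dm Ep Em) (s - 1) (s - 1 + d) (Em_cont _ _ _ _ hP) (Em_der _ _ _ _ hP) lDm ltac:(lra).
      have -> : s - 1 + d - (s - 1) = d by ring.
      by move/Rabs_le_between; have := bnd (s - 1) ltac:(lra); lra.
    have := taylor_left 2 C Em (Dm Ep Em) (s - 1 + d) (s - 1) (Em_cont _ _ _ _ hP) (Em_der _ _ _ _ hP) lDm ltac:(lra).
    have -> : s - 1 + d - (s - 1) = d by ring.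
    have -> : s - 1 - (s - 1 + d) = - d by ring.
    have -> : (- d) ^ 2 = d ^ 2 by ring.
    by move/Rabs_le_between; have := bnd (s - 1 + d) ltac:(lra); lra.
  - by rewrite /Gp Rmax_right //; lra.
have hE := EEm_le Ep Em C K B t N k (x - L) (Rlt_le _ _ hC) ht hN lGm.
rewrite -Esa in hE; have {}hE := hE hsa.
have hh : 0 < / (p - 1) by apply: Rinv_0_lt_compat; lra.
have hE2 := Rmult_le_compat_l _ _ _ (Rlt_le _ _ hh) hE.
rewrite /EEp -/s -/s'; case: (Rle_dec (3 * t + K) (x - k)) => h0; last by case: h0.
cbn [is_left].
suff : Ep s' + N' / t' ^ 2 * Gp Ep Em s' + B / t' ^ 2 * exp (- s') <=
  (if Rle_dec (3 * t' + K) (x - k')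
   then Ep s' + N' / t' ^ 2 * Gp Ep Em s' + B / t' ^ 2 * exp (- s')
   else A / s' - 1 + N' / t' ^ 2 * (A / s') + B / t' ^ 2 * exp (- s') + J / t' ^ 2) by lra.
(* In the other case the step has crossed the threshold. Then s' <= 3 + K / t', where [Ep] differs
   from A / s' - 1 by at most C (K / t')^2, and J is large enough to cover this and the change of
   corrector. *)
case: Rle_dec => hz; cbn [is_left]; first exact: Rle_refl.
have hi : 0 < / t' ^ 2 by apply: Rinv_0_lt_compat; apply: pow_lt; lra.
have hd3 : 0 <= K / t' by apply: Rdiv_le_0_compat; lra.
have [_ /(_ (K / t') hd3) hE3] := Ep_near3 _ _ _ _ _ hP lEm hC s' hs'.
have {}hE3 := hE3 ltac:(apply: (Rmult_le_reg_r t'); [lra|]; have -> : (3 + K / t') * t' = 3 * t' + K by [field; lra]; lra).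
have EK : C * (K / t') ^ 2 = C * K ^ 2 * / t' ^ 2 by field; lra.
have hG : Rabs (Gp Ep Em s') <= C.
  apply: Rle_trans (proj1 lGp s' hs') _.
  have : exp (- (3 * s')) <= 1 by rewrite -exp_0; apply: exp_mono; lra.
  by move=> h; have := Rmult_le_compat_l C _ _ ltac:(lra) h; lra.
have hAs : Rabs (A / s') <= 2 * A.
  have hs2 : / s' <= 2 by apply: (Rmult_le_reg_l s'); rewrite ?Rinv_r; lra.
  have hs0 : 0 < / s' by apply: Rinv_0_lt_compat; lra.
  rewrite Rabs_pos_eq /Rdiv; last by apply: Rmult_le_pos; lra.
  by have := Rmult_le_compat_l A _ _ ltac:(lra) hs2; lra.
have h5 := Rabs_mul_le _ _ _ _ hN' hG; have h6 := Rabs_mul_le _ _ _ _ hN' hAs.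
move/Rabs_le_between: h5 => h5; move/Rabs_le_between: h6 => h6.
have h7 : (C * K ^ 2 + N' * Gp Ep Em s' - N' * (A / s')) * / t' ^ 2 <= J * / t' ^ 2.
  by apply: Rmult_le_compat_r; lra.
have -> : N' / t' ^ 2 * Gp Ep Em s' = N' * Gp Ep Em s' * / t' ^ 2 by rewrite /Rdiv; ring.
have -> : N' / t' ^ 2 * (A / s') = N' * (A / s') * / t' ^ 2 by rewrite /Rdiv; ring.
rewrite {4}/Rdiv; lra.
Qed.

(** Since t and k only grow, x - k < 3t + K persists: the formula changes at most once and only in
    one direction. *)
Lemma plus_step_post A J Ep Em K K2 B : 0 < A -> 0 <= J -> 0 <= K ->
  let C := 4 * A * exp 12 in let C7 := 4 * J * exp 4 in
  10 * (4 * C) + 21 * K * (4 * C) + 3 * K ^ 2 * (4 * C) + C7 <= B ->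
  40 * B <= A / 16 * K2 -> 0 <= K2 ->
  forall t t' N N' p L k k' x, transition (4 * K + 1) K K2 t t' N N' p L k k' ->
  t' / 2 <= x - k' -> x - k < 3 * t + K ->
  (1 + / (p - 1)) * EEp A J K Ep Em B t N k x + / (p - 1) <= EEp A J K Ep Em B t' N' k' x.
Proof.
move=> hA hJ hK C C7 hB hK2 hK20 t t' N N' p L k k' x tr hx hpost.
have [ht hKt htt hkk hLt] := transition_facts _ _ _ _ _ _ _ _ _ _ hK hK20 tr.
case: (tr) => hp h1 h2 hT hM hL Et' hN hN' EN' Ek'.
rewrite /EEp; set s := (x - k) / t; set s' := (x - k') / t'.
have Est : s * t = x - k by rewrite /s; field; lra.
have Est' : s' * t' = x - k' by rewrite /s'; field; lra.
have hs'1 : 1/2 <= s' by apply: (Rmult_le_reg_r t'); lra.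
have hs1 : 1/2 <= s by apply: (Rmult_le_reg_r t); lra.
have hs4 : s <= 4 by apply: (Rmult_le_reg_r t); lra.
have hss : s' <= s.
  apply: (Rmult_le_reg_r t'); first lra.
  by have := Rmult_le_compat_l s _ _ ltac:(lra) htt; lra.
case: Rle_dec => h3; first lra.
case: Rle_dec => h4; first lra.
cbn [is_left].
apply: (post_step A J K K2 B hA hJ hK hB hK2 t t' N N' p L k k' s s' tr); lra.
Qed.

Lemma barriers A C0 Ep Em K : profile A C0 Ep Em -> 0 <= K -> exists J C B0 c,
  [/\ C * K ^ 2 <= J, 0 < C, 0 <= B0 & 0 < c] /\
  [/\ decay_lip (from (-1/2)) C Em, decay_lip (from (1/2)) C Ep, decay_lip (from 2) C (Gm Ep Em)
    & decay_lip (from (1/2)) C (Gp Ep Em)] /\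
  forall B K2, B0 <= B -> 40 * B <= c * K2 ->
  forall t t' N N' p L k k' x, transition (4 * K + 1) K K2 t t' N N' p L k k' ->
  [/\ 2 * t' <= x - k' ->
      (1 + / (p - 1)) * EEm Ep Em B t N k x + / (p - 1) * EEp A J K Ep Em B t N k (x - L)
       <= EEm Ep Em B t' N' k' x,
      t' / 2 <= x - k' -> 3 * t + K <= x - k ->
      2 * t <= x - L - k /\
      (1 + / (p - 1)) * EEp A J K Ep Em B t N k x + / (p - 1) * EEm Ep Em B t N k (x - L)
       <= EEp A J K Ep Em B t' N' k' x
    & t' / 2 <= x - k' -> x - k < 3 * t + K ->
      (1 + / (p - 1)) * EEp A J K Ep Em B t N k x + / (p - 1) <= EEp A J K Ep Em B t' N' k' x].
Proof.
move=> hP hK; have hA := pr_A _ _ _ _ hP.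
have [C hC [[lEm lEp lDm lDp] [lGm lGp]]] := profile_smooth _ _ _ _ hP.
have hKC : 0 <= K * C by apply: Rmult_le_pos; lra.
have hK2C : 0 <= K ^ 2 * C by apply: Rmult_le_pos; [apply: pow_le|]; lra.
have hKA : 0 <= K * A by apply: Rmult_le_pos; lra.
have hK2A : 0 <= K ^ 2 * A by apply: Rmult_le_pos; [apply: pow_le|]; lra.
pose J := C * K ^ 2 + K * (C + 2 * A).
have hJ : 0 <= J by rewrite /J; lra.
have he4 := exp_pos 4; have he12 := exp_pos 12.
pose C4 := K * C + (2 * A * K + J) * exp 4.
have hC4 : K * C <= C4.
  have : 0 <= (2 * A * K + J) * exp 4 by apply: Rmult_le_pos; lra.
  rewrite /C4; lra.
pose C' := 4 * A * exp 12.
have hC' : 0 < C' by apply: Rmult_lt_0_compat; lra.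
pose C7 := 4 * J * exp 4.
have hC7 : 0 <= C7 by apply: Rmult_le_pos; lra.
pose b z := 10 * (4 * z) + 21 * K * (4 * z) + 3 * K ^ 2 * (4 * z).
have hb z : 0 <= z -> 0 <= b z.
  move=> hz; have : 0 <= K * z by apply: Rmult_le_pos.
  have : 0 <= K ^ 2 * z by apply: Rmult_le_pos => //; apply: pow_le.
  rewrite /b; lra.
have hbC := hb C (Rlt_le _ _ hC); have hbC' := hb C' (Rlt_le _ _ hC').
have p1 := Em_pos _ _ _ _ hP 44; have p2 := Ep_pos _ _ _ _ hP 44 ltac:(lra).
pose c := Rmin (Rmin (Em 44 / 44) (Ep 44 / 44)) (A / 16).
have hc : 0 < c by rewrite /c; apply: Rmin_glb_lt; [apply: Rmin_glb_lt|]; lra.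
have hc3 : c <= A / 16 by exact: Rmin_r.
have hc0 : c <= Rmin (Em 44 / 44) (Ep 44 / 44) by exact: Rmin_l.
have hc1 : c <= Em 44 / 44 by apply: Rle_trans hc0 (Rmin_l _ _).
have hc2 : c <= Ep 44 / 44 by apply: Rle_trans hc0 (Rmin_r _ _).
exists J, C, (b C + b C' + 4 * C4 + C7), c.
split; first by split=> //; rewrite /J; lra.
split; first by [].
move=> B K2 hB hK2 t t' N N' p L k k' x tr.
have hK20 : 0 <= K2 by apply: (Rmult_le_reg_l c) => //; lra.
split.
- apply: (minus_step A C0 J Ep Em C c K K2 B hP hC hJ hK lEm lEp lDm lDp lGm lGp hc hc1 _ hK2
    t t' N N' p L k k' x tr).
  by rewrite -/C4 -/(b C); lra.
- apply: (plus_step_pre A C0 J Ep Em C c K K2 B hP hC hK (Rle_refl J) lEm lEp lDm lDp lGm lGp hc hc2 _ hK2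
    t t' N N' p L k k' x tr).
  by rewrite -/(b C); lra.
apply: (plus_step_post A J Ep Em K K2 B hA hJ hK _ _ hK20 t t' N N' p L k k' x tr).
  by rewrite -/C' -/C7 -/(b C'); lra.
by have := Rmult_le_compat_r K2 _ _ hK20 hc3; lra.
Qed.

(** * Mertens' theorem to second order *)

Fixpoint sumR (n : nat) (f : nat -> R) : R :=
  if n is m.+1 then sumR m f + f m else 0.

Lemma sumRS n f : sumR n.+1 f = sumR n f + f n. Proof. by []. Qed.

Lemma sumR_ext n f g : (forall k, (k < n)%N -> f k = g k) -> sumR n f = sumR n g.
Proof.
elim: n => //= n IHn h; rewrite IHn; last by move=> k hk; apply: h; lia.
by rewrite h.
Qed.

Lemma sumR_le n f g : (forall k, (k < n)%N -> f k <= g k) -> sumR n f <= sumR n g.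
Proof.
elim: n => /= [|n IHn] h; first exact: Rle_refl.
by apply: Rplus_le_compat; [apply: IHn => k hk; apply: h; lia|apply: h].
Qed.

Lemma sumR_plus n f g : sumR n (fun k => f k + g k) = sumR n f + sumR n g.
Proof. by elim: n => /= [|n ->]; ring. Qed.

Lemma sumR_scal n c f : sumR n (fun k => c * f k) = c * sumR n f.
Proof. by elim: n => /= [|n ->]; ring. Qed.

Lemma sumR_zero n f : (forall k, (k < n)%N -> f k = 0) -> sumR n f = 0.
Proof.
move=> h; rewrite (sumR_ext _ f (fun k => 0 * 0)); last by move=> k hk; rewrite h //; ring.
by rewrite sumR_scal; ring.
Qed.

Lemma sumR_pos n f : (forall k, (k < n)%N -> 0 <= f k) -> 0 <= sumR n f.
Proof.
move=> h; rewrite -(sumR_zero n (fun _ => 0)) //; exact: sumR_le.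
Qed.

Lemma sumR_abs n f : Rabs (sumR n f) <= sumR n (fun k => Rabs (f k)).
Proof.
elim: n => /= [|n IHn]; first by rewrite Rabs_R0; apply: Rle_refl.
by apply: Rle_trans (Rabs_triang _ _) _; apply: Rplus_le_compat_r.
Qed.

Lemma sumR_swap n m f :
  sumR n (fun i => sumR m (fun j => f i j)) = sumR m (fun j => sumR n (fun i => f i j)).
Proof.
elim: n => /= [|n IHn]; first by rewrite sumR_zero.
by rewrite IHn sumR_plus.
Qed.

Lemma sumR_widen n m f : (n <= m)%N -> (forall k, (n <= k < m)%N -> f k = 0) -> sumR m f = sumR n f.
Proof.
move=> hnm; elim: m hnm => [|m IHm] hnm h; first by have -> : n = 0%N by lia.
case: (ltngtP n m.+1) hnm => // [hn _|-> _] //=.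
by rewrite IHm ?h; [ring|lia|lia|move=> k hk; apply: h; lia].
Qed.

Lemma sumR_mono n m f : (n <= m)%N -> (forall k, 0 <= f k) -> sumR n f <= sumR m f.
Proof.
move=> hnm h; elim: m hnm => [|m IHm] hnm; first by (have -> : n = 0%N by lia); apply: Rle_refl.
case: (ltngtP n m.+1) hnm => // [hn _|-> _]; last exact: Rle_refl.
by rewrite /=; have := IHm ltac:(lia); have := h m; lra.
Qed.

Lemma sumR_single n k f : (k < n)%N -> (forall j, (j < n)%N -> j <> k -> f j = 0) -> sumR n f = f k.
Proof.
elim: n => //= n IHn hk h.
case: (ltngtP k n) => [hkn|hkn|E].
- rewrite IHn // ?(h n); [ring|lia|lia|].
  by move=> j hj hne; apply: h; lia.
- by lia.
rewrite E sumR_zero; first ring.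
by move=> j hj; apply: h; lia.
Qed.

Lemma INR_addn a b : INR (a + b)%N = INR a + INR b. Proof. exact: plus_INR. Qed.
Lemma INR_muln a b : INR (a * b)%N = INR a * INR b. Proof. exact: mult_INR. Qed.
Lemma INR_leq a b : (a <= b)%N -> INR a <= INR b. Proof. by move=> /leP; apply: le_INR. Qed.
Lemma INR_ltn a b : (a < b)%N -> INR a < INR b. Proof. by move=> /ltP; apply: lt_INR. Qed.
Lemma INR_expn a b : INR (expn a b) = INR a ^ b.
Proof. by elim: b => //= b IH; rewrite expnS INR_muln IH. Qed.
Lemma INR_gt0 a : (0 < a)%N -> 0 < INR a. Proof. exact: (INR_ltn 0 a). Qed.
Lemma INR_ge1 a : (0 < a)%N -> 1 <= INR a. Proof. exact: (INR_leq 1 a). Qed.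

Definition primeR (f : nat -> R) (p : nat) : R := if prime p then f p else 0.

Lemma primeR_pos f p : (prime p -> 0 <= f p) -> 0 <= primeR f p.
Proof. by rewrite /primeR; case: ifP => [_|_ _]; [apply|apply: Rle_refl]. Qed.

Lemma ln_ge0 x : 1 <= x -> 0 <= ln x.
Proof. by move=> h; rewrite -ln_1; apply: ln_le; lra. Qed.

Lemma ln_nat_ge0 k : 0 <= ln (INR k).
Proof.
case: k => [|k]; last by apply/ln_ge0/INR_ge1.
rewrite /ln [INR 0]/=; case: Rlt_dec => h; last exact: Rle_refl.
by case: (Rlt_irrefl _ h).
Qed.

Lemma ln_factor n k : (0 < k < n)%N ->
  ln (INR k) = sumR n (primeR (fun p => INR (logn p k) * ln (INR p))).
Proof.
elim/ltn_ind: k => k IHk hk.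
case: (ltngtP k 1) => [|h1|->]; first lia; last first.
  rewrite /= ln_1 sumR_zero // => p hp.
  by rewrite /primeR logn1 /=; case: ifP => _ //; ring.
have hp := pdiv_prime h1; have hd := pdiv_dvd k.
have hq0 : (0 < k %/ pdiv k)%N by rewrite divn_gt0 ?prime_gt0 // dvdn_leq //; lia.
have E : k = (pdiv k * (k %/ pdiv k))%N by rewrite mulnC divnK.
have hqk : (k %/ pdiv k < k)%N by apply: ltn_Pdiv => //; [apply: prime_gt1|lia].
rewrite {1}E INR_muln ln_mult; [|exact: (INR_gt0 _ (prime_gt0 hp))|exact: INR_gt0].
rewrite (IHk (k %/ pdiv k)%N) //; last by rewrite hq0 (ltn_trans hqk) //; lia.
have S : sumR n (primeR (fun p => INR (logn p (pdiv k)) * ln (INR p))) = ln (INR (pdiv k)).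
  rewrite (sumR_single n (pdiv k)).
  - by rewrite /primeR hp logn_prime // eqxx /=; ring.
  - by have := pdiv_leq (n := k) ltac:(lia); lia.
  move=> j _ hj; rewrite /primeR; case: ifP => // pj.
  rewrite logn_prime //; case: eqP => [e|_ /=]; last by ring.
  by case: hj.
rewrite -S -sumR_plus; apply: sumR_ext => p _.
rewrite /primeR; case: ifP => _; last ring.
have -> : logn p k = (logn p (pdiv k) + logn p (k %/ pdiv k))%N by rewrite {1}E (lognM p (prime_gt0 hp) hq0).
by rewrite INR_addn; ring.
Qed.

Lemma ln_sq_le x : 1 <= x -> ln x ^ 2 <= 16 * sqrt x.
Proof.
move=> hx; set r := sqrt (sqrt x).
have hs : 1 <= sqrt x by rewrite -sqrt_1; apply: sqrt_le_1; lra.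
have hr : 1 <= r by rewrite /r -sqrt_1; apply: sqrt_le_1; lra.
have Er : r * r = sqrt x by rewrite sqrt_sqrt; lra.
have Ex : x = (r * r) * (r * r) by rewrite Er sqrt_sqrt; lra.
have E : ln x = 4 * ln r by rewrite {1}Ex !ln_mult; nra.
have h : ln r <= r.
  have := exp_ineq1_le (ln r); rewrite exp_ln; lra.
have h0 := ln_ge0 r hr.
by rewrite E -Er; nra.
Qed.

(** Telescoping, as k^(-3/2) <= 2 ((k - 1)^(-1/2) - k^(-1/2)). *)
Lemma sum_pow32 n : sumR n.+2 (fun k => if (1 < k)%N then / (INR k * sqrt (INR k)) else 0)
   <= 2 - 2 * / sqrt (INR n.+1).
Proof.
set F := (F in sumR _ F).
elim: n => [|n IHn].
  by rewrite [sumR _ _]/= [INR 1]/= sqrt_1 /F /=; lra.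
have -> : sumR n.+3 F = sumR n.+2 F + / (INR n.+2 * sqrt (INR n.+2)) by [].
set a := sqrt (INR n.+1) in IHn; set b := sqrt (INR n.+2).
have h1 : 1 <= INR n.+1 by apply: INR_ge1.
have E : INR n.+2 = INR n.+1 + 1 by rewrite S_INR.
have ha : 1 <= a by rewrite /a -sqrt_1; apply: sqrt_le_1; lra.
have hab : a < b by apply: sqrt_lt_1; lra.
have Ea : a * a = INR n.+1 by apply: sqrt_sqrt; lra.
have Eb : b * b = INR n.+2 by apply: sqrt_sqrt; lra.
apply: Rle_trans (_ : 2 - 2 * / a + / (b * b * b) <= _).
  by rewrite -Eb; apply: Rplus_le_compat_r.
suff : / (b * b * b) <= 2 * (/ a - / b) by lra.
have -> : 2 * (/ a - / b) = 2 / (a * b * (a + b)).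
  apply: (Rmult_eq_reg_r (a * b * (a + b))); last by apply: Rgt_not_eq; nra.
  have -> : 2 / (a * b * (a + b)) * (a * b * (a + b)) = 2.
    by field; split; [|split]; lra.
  have -> : 2 * (/ a - / b) * (a * b * (a + b)) = 2 * (b * b - a * a) by field; lra.
  by rewrite Ea Eb E; ring.
have h2 : a * b * (a + b) <= 2 * (b * b * b).
  have : a * b <= b * b by apply: Rmult_le_compat_r; lra.
  nra.
have h0 : 0 < a * b * (a + b) by apply: Rmult_lt_0_compat; [apply: Rmult_lt_0_compat|]; lra.
have h3 : 0 < b * b * b by apply: Rmult_lt_0_compat; [apply: Rmult_lt_0_compat|]; lra.
apply: (Rmult_le_reg_r (a * b * (a + b))) => //.
have -> : 2 / (a * b * (a + b)) * (a * b * (a + b)) = 2 by field; split; [|split]; lra.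
have : / (b * b * b) * (a * b * (a + b)) <= / (b * b * b) * (2 * (b * b * b)).
  by apply: Rmult_le_compat_l => //; apply/Rlt_le/Rinv_0_lt_compat.
have -> : / (b * b * b) * (2 * (b * b * b)) = 2 by field; lra.
by [].
Qed.

Definition lnsq k := if (1 < k)%N then ln (INR k) ^ 2 / INR k ^ 2 else 0.

Lemma lnsq_pos k : 0 <= lnsq k.
Proof.
rewrite /lnsq; case: ifP => hk; last lra.
by apply: Rdiv_le_0_compat; [exact: pow2_ge_0|apply: pow_lt; apply: INR_gt0; lia].
Qed.

(** From ln^2 k <= 16 sqrt k. The convergent error sums over primes below are all compared with this
    one. *)
Lemma sum_lnsq n : sumR n lnsq <= 32.
Proof.
apply: Rle_trans (sumR_mono n n.+2 lnsq _ lnsq_pos) _; first lia.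
apply: Rle_trans (_ : 16 * sumR n.+2 (fun k => if (1 < k)%N then / (INR k * sqrt (INR k)) else 0) <= _).
  rewrite -sumR_scal; apply: sumR_le => k _; rewrite /lnsq; case: ifP => hk; last lra.
  have h1 : 1 <= INR k by apply: INR_ge1; lia.
  have hs : 1 <= sqrt (INR k) by rewrite -sqrt_1; apply: sqrt_le_1; lra.
  have Es : sqrt (INR k) * sqrt (INR k) = INR k by apply: sqrt_sqrt; lra.
  apply: Rle_trans (_ : 16 * sqrt (INR k) / INR k ^ 2 <= _).
    apply: Rmult_le_compat_r; last exact: ln_sq_le.
    by apply/Rlt_le/Rinv_0_lt_compat; apply: pow_lt; lra.
  apply: Req_le; rewrite -{2 3}Es; field; lra.
have := sum_pow32 n; have : 0 < / sqrt (INR n.+1).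
  by apply: Rinv_0_lt_compat; apply: sqrt_lt_R0; apply: INR_gt0.
lra.
Qed.

(** * Chebyshev's bound and Mertens' first theorem *)

Definition vth n := sumR n (primeR (fun p => ln (INR p))).
Definition th n := sumR n (primeR (fun p => ln (INR p) / INR p)).

Lemma bin_central_le m : ('C(2 * m, m) <= expn 4 m)%N.
Proof.
have -> : expn 4 m = expn (1 + 1) (2 * m) by rewrite expnM.
rewrite Pascal.
have hm : (m < (2 * m).+1)%N by lia.
rewrite (bigD1 (Ordinal hm)) //= !exp1n !muln1; exact: leq_addr.
Qed.

Lemma ln_INR_mono a b : (0 < a)%N -> (a <= b)%N -> ln (INR a) <= ln (INR b).
Proof. by move=> ha hab; apply: ln_le; [apply: INR_gt0|apply: INR_leq]. Qed.

Lemma prime_ndvd_fact p m : prime p -> (m < p)%N -> ~~ (p %| m`!)%N.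
Proof.
move=> pp; elim: m => [|m IHm] hm; first by rewrite Euclid_dvd1.
rewrite factS Euclid_dvdM // negb_or IHm ?andbT; last lia.
by apply/negP => /(dvdn_leq (ltn0Sn m)); lia.
Qed.

(** Every prime in (m, 2m] divides the central binomial coefficient, which is at most 4^m. *)
Lemma cheb_step m : vth (2 * m).+1 <= vth m.+1 + INR m * ln 4.
Proof.
set c := 'C(2 * m, m).
have c0 : (0 < c)%N by rewrite bin_gt0; lia.
have hc : ln (INR c) <= INR m * ln 4.
  apply: Rle_trans (ln_INR_mono _ _ c0 (bin_central_le m)) _.
  rewrite INR_expn ln_pow; last by apply: (INR_gt0 4).
  by apply: Req_le; congr (_ * ln _); rewrite /=; ring.
have E := ln_factor (maxn c.+1 (2 * m).+1) c ltac:(lia).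
have h1 : sumR (2 * m).+1 (primeR (fun p => INR (logn p c) * ln (INR p))) <= ln (INR c).
  rewrite E; apply: sumR_mono; first by rewrite leq_max leqnn orbT.
  move=> p; apply: primeR_pos => _; apply: Rmult_le_pos; [exact: pos_INR|exact: ln_nat_ge0].
have h2 : vth (2 * m).+1 <= sumR (2 * m).+1 (fun p => (if (p <= m)%N then primeR (fun p => ln (INR p)) p else 0)
     + primeR (fun p => INR (logn p c) * ln (INR p)) p).
  apply: sumR_le => p hp; rewrite /primeR; case: ifP => pp; last by case: ifP => _; lra.
  have l0 := ln_nat_ge0 p.
  case: ifP => hpm; first by have := Rmult_le_pos _ _ (pos_INR (logn p c)) l0; lra.
  have : 1 <= INR (logn p c); last by nra.
  apply: INR_ge1; rewrite logn_gt0 mem_primes pp c0 /=.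
  have := bin_fact (n := 2 * m) (m := m) ltac:(lia); rewrite -/c => Ef.
  have d : (p %| (2 * m)`!)%N by apply: dvdn_fact; rewrite prime_gt0 //=; lia.
  rewrite -Ef !Euclid_dvdM // in d.
  have nf : (p %| m`!)%N = false by apply/negbTE/prime_ndvd_fact => //; lia.
  have e2 : (2 * m - m)%N = m by lia.
  by rewrite e2 nf !orbF in d.
have h3 : sumR (2 * m).+1 (fun p => if (p <= m)%N then primeR (fun p => ln (INR p)) p else 0) = vth m.+1.
  rewrite (sumR_widen m.+1); [|lia|by move=> k hk; case: ifP => //; lia].
  by apply: sumR_ext => k hk; case: ifP => //; lia.
rewrite sumR_plus h3 in h2; lra.
Qed.

Lemma vth_S n : vth n.+1 <= vth n + INR n.
Proof.
rewrite /vth /=; apply: Rplus_le_compat_l; rewrite /primeR; case: ifP => pn; last exact: pos_INR.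
have := exp_ineq1_le (ln (INR n)); rewrite exp_ln; last by apply: INR_gt0; exact: prime_gt0.
lra.
Qed.

Lemma chebyshev n : vth n.+1 <= 8 * INR n.
Proof.
have l4 : ln 4 <= 3.
  have := exp_ineq1_le (ln 4); rewrite exp_ln; lra.
elim/ltn_ind: n => n IHn.
case: (posnP n) => [->|n0]; first by rewrite /vth /= /primeR /=; lra.
have [m [hm e]] : exists m, (m < n)%N /\ (n = 2 * m \/ n = (2 * m).+1)%N.
  by exists n./2; have := odd_double_half n; case: (odd n); lia.
have IH := IHn _ hm; have hs := cheb_step m.
have hp := pos_INR m.
have hm3 : INR m * ln 4 <= INR m * 3 by apply: Rmult_le_compat_l.
have E : INR (2 * m) = 2 * INR m by rewrite INR_muln /=; lra.
case: e => ->; first by rewrite E; lra.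
have := vth_S (2 * m).+1; rewrite !S_INR E; lra.
Qed.

Lemma ln_fact_bounds n : INR n * ln (INR n) - INR n <= ln (INR n`!) <= INR n * ln (INR n).
Proof.
elim: n => [|n IHn]; first by rewrite /= ln_1; lra.
have h1 : 0 < INR n.+1 by apply: INR_gt0.
have h2 : 0 < INR n`! by apply: INR_gt0; apply: fact_gt0.
rewrite factS INR_muln ln_mult // S_INR.
case: n IHn h1 h2 => [|n] IHn h1 h2; first by rewrite /= !Rplus_0_l ln_1; lra.
set x := INR n.+1 in IHn *.
have hx : 0 < x by apply: INR_gt0.
have l1 : ln x <= ln (x + 1) by apply: ln_le; lra.
have l2 : x * (ln (x + 1) - ln x) <= 1.
  have -> : ln (x + 1) - ln x = ln ((x + 1) / x) by rewrite ln_div; lra.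
  have := exp_ineq1_le (ln ((x + 1) / x)); rewrite exp_ln; last by apply: Rdiv_lt_0_compat; lra.
  move=> h; have {}h : ln ((x + 1) / x) <= / x.
    have e : (x + 1) / x = 1 + / x by field; lra.
    lra.
  have := Rmult_le_compat_l x _ _ (Rlt_le _ _ hx) h.
  by rewrite Rinv_r; lra.
by split; nra.
Qed.

Lemma sum_nat_INR n (f : nat -> nat) :
  INR (\sum_(1 <= k < n.+1) f k) = sumR n (fun k => INR (f k.+1)).
Proof.
elim: n => [|n IHn]; first by rewrite big_geq.
by rewrite big_nat_recr //= INR_addn IHn.
Qed.

Lemma INR_divn a b : (0 < b)%N -> INR a / INR b - 1 <= INR (a %/ b) <= INR a / INR b.
Proof.
move=> hb; have hb' := INR_gt0 b hb.
have E : INR a = INR (a %/ b) * INR b + INR (a %% b) by rewrite -INR_muln -INR_addn -divn_eq.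
have hr : INR (a %% b) < INR b by apply: INR_ltn; rewrite ltn_mod.
have h0 := pos_INR (a %% b).
split.
  apply: (Rmult_le_reg_r (INR b)) => //.
  have -> : (INR a / INR b - 1) * INR b = INR a - INR b by field; lra.
  lra.
apply: (Rmult_le_reg_r (INR b)) => //.
have -> : INR a / INR b * INR b = INR a by field; lra.
lra.
Qed.

Lemma geom_sum x n : 0 <= x <= 1/2 -> sumR n (fun k => x ^ k.+1) <= x + 2 * x ^ 2.
Proof.
move=> hx.
have E : (1 - x) * sumR n (fun k => x ^ k.+1) = x - x ^ n.+1.
  by elim: n => [|n IHn]; [rewrite /=; ring|rewrite [sumR _ _]/= Rmult_plus_distr_l IHn /=; ring].
have h0 : 0 <= x ^ n.+1 by apply: pow_le; lra.
have h1 : (1 - x) * (x + 2 * x ^ 2) >= x.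
  have -> : (1 - x) * (x + 2 * x ^ 2) = x + x ^ 2 * (1 - 2 * x) by ring.
  by have := Rmult_le_pos (x ^ 2) (1 - 2 * x) (pow2_ge_0 x) ltac:(lra); lra.
by apply: (Rmult_le_reg_l (1 - x)); lra.
Qed.

Lemma prime_ge2 p : prime p -> 2 <= INR p.
Proof. by move=> pp; apply: (INR_leq 2); apply: prime_gt1. Qed.

Lemma prime_inv p : prime p -> 0 < / INR p <= 1/2.
Proof.
move=> pp; have := prime_ge2 p pp => h; split; first by apply: Rinv_0_lt_compat; lra.
by rewrite /Rdiv Rmult_1_l; apply: Rinv_le_contravar; lra.
Qed.

Lemma ln_prime_ge p : prime p -> 1/2 <= ln (INR p).
Proof.
move=> pp; have := prime_ge2 p pp => h; have := ln_lt_2 => h2.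
by have := ln_le 2 (INR p) ltac:(lra) h; lra.
Qed.

Lemma ln_over_sq p : prime p -> ln (INR p) * (/ INR p) ^ 2 <= 2 * lnsq p.
Proof.
move=> pp; rewrite /lnsq prime_gt1 //.
have h := ln_prime_ge p pp; have [h1 h2] := prime_inv p pp; have h3 := prime_ge2 p pp.
have -> : ln (INR p) ^ 2 / INR p ^ 2 = ln (INR p) ^ 2 * (/ INR p) ^ 2 by field; lra.
have : ln (INR p) <= 2 * ln (INR p) ^ 2 by nra.
have : 0 <= (/ INR p) ^ 2 by exact: pow2_ge_0.
nra.
Qed.

Lemma sum_prime_lnsq n : sumR n (primeR (fun p => ln (INR p) * (/ INR p) ^ 2)) <= 64.
Proof.
apply: Rle_trans (_ : 2 * sumR n lnsq <= _); last by have := sum_lnsq n; lra.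
rewrite -sumR_scal; apply: sumR_le => p _; rewrite /primeR; case: ifP => pp; first exact: ln_over_sq.
by have := lnsq_pos p; lra.
Qed.

Lemma ln_fact_primes n : (0 < n)%N ->
  ln (INR n`!) = sumR n.+1 (primeR (fun p => INR (logn p n`!) * ln (INR p))).
Proof.
move=> n0; have f0 := fact_gt0 n.
rewrite (ln_factor (maxn n`!.+1 n.+1)); last by rewrite f0 leq_max leqnn.
apply: sumR_widen; first by rewrite leq_max leqnn orbT.
move=> p /andP [hp _]; rewrite /primeR; case: ifP => // pp.
have -> : logn p n`! = 0%N; last by rewrite /=; ring.
apply/eqP; rewrite -leqn0 leqNgt logn_gt0 mem_primes pp f0 /=; exact: prime_ndvd_fact.
Qed.

(** Legendre's formula for ln n!: the exponent of p lies between n/p - 1 and n (1/p + 2/p^2). The 1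
    sums to Chebyshev's function, the squares to a constant; 129 = 2 * 64 + 1, the last 1 from
    Stirling. *)
Lemma mertens1 n : (0 < n)%N -> Rabs (th n.+1 - ln (INR n)) <= 129.
Proof.
move=> n0; have hn : 1 <= INR n by apply: INR_ge1.
have [f1 f2] := ln_fact_bounds n.
have E := ln_fact_primes n n0.
have up_ : ln (INR n`!) <= INR n * (th n.+1 + 2 * sumR n.+1 (primeR (fun p => ln (INR p) * (/ INR p) ^ 2))).
  rewrite E /th -sumR_scal -sumR_plus -sumR_scal; apply: sumR_le => p _.
  rewrite /primeR; case: ifP => pp; last lra.
  have l0 := ln_nat_ge0 p; have hi := prime_inv p pp; have p2 := prime_ge2 p pp.
  rewrite logn_fact // sum_nat_INR.
  have : sumR n (fun k => INR (n %/ expn p k.+1)) <= INR n * (/ INR p + 2 * (/ INR p) ^ 2).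
    have g := geom_sum (/ INR p) n ltac:(lra).
    apply: Rle_trans (Rmult_le_compat_l (INR n) _ _ (pos_INR n) g).
    rewrite -sumR_scal; apply: sumR_le => k _.
    have q0 : (0 < expn p k.+1)%N by rewrite expn_gt0 (prime_gt0 pp).
    have [_ h] := INR_divn n (expn p k.+1) q0.
    by rewrite INR_expn in h; rewrite pow_inv.
  move=> h; have := Rmult_le_compat_r _ _ _ l0 h; rewrite /Rdiv; lra.
have lo_ : INR n * th n.+1 - vth n.+1 <= ln (INR n`!).
  rewrite E /th /vth -sumR_scal.
  have -> : forall a b, a - b = a + (-1) * b by move=> *; ring.
  rewrite -sumR_scal -sumR_plus; apply: sumR_le => p hp.
  rewrite /primeR; case: ifP => pp; last lra.
  have l0 := ln_nat_ge0 p; have hi := prime_inv p pp; have p2 := prime_ge2 p pp.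
  have [h _] := INR_divn n p (prime_gt0 pp).
  have : INR (n %/ p) <= INR (logn p n`!).
    rewrite logn_fact // big_nat_recl // expn1; apply: INR_leq; exact: leq_addr.
  move=> h2; have := Rmult_le_compat_r _ _ _ l0 (Rle_trans _ _ _ h h2).
  rewrite /Rdiv; lra.
have hc := chebyshev n; have hs := sum_prime_lnsq n.+1.
apply: Rabs_le; split.
  apply: (Rmult_le_reg_l (INR n)); first lra.
  have : INR n * (th n.+1 + 2 * sumR n.+1 (primeR (fun p => ln (INR p) * (/ INR p) ^ 2))) <= INR n * (th n.+1 + 128).
    by apply: Rmult_le_compat_l; lra.
  lra.
by apply: (Rmult_le_reg_l (INR n)); lra.
Qed.

(** * Harmonic sums and the second order term *)

Definition har n := sumR n (fun k => / INR k.+1).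

Lemma harS n : har n.+1 = har n + / INR n.+1. Proof. by []. Qed.

Lemma ln_succ n : (0 < n)%N -> / INR n.+1 <= ln (INR n.+1) - ln (INR n) <= / INR n.
Proof.
move=> n0; have h := INR_gt0 n n0; have h1 := INR_gt0 n.+1 isT.
have E : INR n.+1 = INR n + 1 by rewrite S_INR.
split.
  have -> : ln (INR n.+1) - ln (INR n) = - ln (INR n / INR n.+1) by rewrite ln_div //; ring.
  have := exp_ineq1_le (ln (INR n / INR n.+1)); rewrite exp_ln; last exact: Rdiv_lt_0_compat.
  have -> : INR n / INR n.+1 = 1 - / INR n.+1 by rewrite E; field; lra.
  lra.
have -> : ln (INR n.+1) - ln (INR n) = ln (INR n.+1 / INR n) by rewrite ln_div.
have := exp_ineq1_le (ln (INR n.+1 / INR n)); rewrite exp_ln; last exact: Rdiv_lt_0_compat.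
have -> : INR n.+1 / INR n = 1 + / INR n by rewrite E; field; lra.
lra.
Qed.

Lemma harmonic : exists g, forall m, (0 < m)%N -> 0 <= har m - ln (INR m) - g <= / INR m.
Proof.
pose u m := har m - ln (INR m); pose v m := har m - ln (INR m.+1).
have vincr k m : (k <= m)%N -> v k <= v m.
  elim: m => [|m IHm] hk; first by (have -> : k = 0%N by lia); apply: Rle_refl.
  case: (ltngtP k m.+1) => [hkm|hkm|->]; [|lia|exact: Rle_refl].
  apply: Rle_trans (IHm _) _; first lia.
  by rewrite /v harS; have := ln_succ m.+1 isT; lra.
have udecr k m : (0 < k)%N -> (k <= m)%N -> u m <= u k.
  move=> k0; elim: m => [|m IHm] hk; first lia.
  case: (ltngtP k m.+1) => [hkm|hkm|->]; [|lia|exact: Rle_refl].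
  apply: Rle_trans _ (IHm _); last lia.
  by rewrite /u harS; have := ln_succ m ltac:(lia); lra.
have vu m : (0 < m)%N -> v m <= u m <= v m + / INR m.
  by move=> m0; rewrite /u /v; have := ln_succ m m0; have := INR_gt0 m.+1 isT => h; have := Rinv_0_lt_compat _ h; lra.
have cross k m : (0 < m)%N -> v k <= u m.
  move=> m0; apply: Rle_trans (vincr k (maxn k m) _) _; first exact: leq_maxl.
  have := vu (maxn k m) ltac:(lia); have := udecr m (maxn k m) m0 ltac:(lia); lra.
pose E y := exists k, y = v k.
have [g [ub lub]] : {g | is_lub E g}.
  apply: completeness; last by exists (v 0%N), 0%N.
  by exists (u 1%N) => y [k ->]; apply: cross.
exists g => m m0; have : g <= u m by apply: lub => y [k ->]; apply: cross.
have : v m <= g by apply: ub; exists m.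
by have := vu m m0; rewrite /u; lra.
Qed.

(** The k-th increment of the sum and that of ln^2 / 2 differ by at most 12 ln^2 k / k^2; 384 = 12 *
    32. *)
Lemma sum_ln_over n : (0 < n)%N ->
  Rabs (sumR n (fun k => ln (INR k.+1) / INR k.+1) - ln (INR n) ^ 2 / 2) <= 384.
Proof.
move=> n0.
suff : Rabs (sumR n (fun k => ln (INR k.+1) / INR k.+1) - ln (INR n) ^ 2 / 2) <= 12 * sumR n.+1 lnsq.
  by have := sum_lnsq n.+1; lra.
case: n n0 => // n _; elim: n => [|n IHn].
  rewrite [sumR 1 _]/= [INR 1]/= ln_1.
  have -> : 0 + 0 / 1 - 0 ^ 2 / 2 = 0 by field.
  by rewrite Rabs_R0; have := sumR_pos 2 lnsq (fun k _ => lnsq_pos k); lra.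
set S := sumR n.+1 _ in IHn.
have -> : sumR n.+2 (fun k => ln (INR k.+1) / INR k.+1) = S + ln (INR n.+2) / INR n.+2 by [].
have -> : sumR n.+3 lnsq = sumR n.+2 lnsq + lnsq n.+2 by [].
have [d1 d2] := ln_succ n.+1 isT.
set b := ln (INR n.+1) in IHn d1 d2 *; set a := ln (INR n.+2) in d1 d2 *.
have x1 : 1 <= INR n.+1 by apply: INR_ge1.
have Ex : INR n.+2 = INR n.+1 + 1 by rewrite S_INR.
set x := INR n.+1 in x1 Ex d2 *.
rewrite Ex in d1 *.
have ha : 1/2 <= a.
  have := ln_lt_2 => h2; have : ln 2 <= a by apply: ln_le; [lra|rewrite Ex; lra].
  lra.
have El : lnsq n.+2 = a ^ 2 * (/ (x + 1)) ^ 2 by rewrite /lnsq (_ : (1 < n.+2)%N = true) // -/a Ex; field; lra.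
have y0 : 0 < / (x + 1) by apply: Rinv_0_lt_compat; lra.
have hxy : / x - / (x + 1) <= 2 * (/ (x + 1)) ^ 2.
  have -> : / x - / (x + 1) = / x * / (x + 1) by field; lra.
  have : / x <= 2 * / (x + 1).
    apply: (Rmult_le_reg_r (x * (x + 1))); first nra.
    have -> : / x * (x * (x + 1)) = x + 1 by field; lra.
    have -> : 2 * / (x + 1) * (x * (x + 1)) = 2 * x by field; lra.
    lra.
  nra.
have hx2 : / x <= 2 * / (x + 1).
  apply: (Rmult_le_reg_r (x * (x + 1))); first nra.
  have -> : / x * (x * (x + 1)) = x + 1 by field; lra.
  have -> : 2 * / (x + 1) * (x * (x + 1)) = 2 * x by field; lra.
  lra.
set y := / (x + 1) in d1 y0 hxy hx2 El *.
set d := a - b in d1 d2.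
have inc : Rabs (a / (x + 1) - (a ^ 2 - b ^ 2) / 2) <= 12 * (a ^ 2 * y ^ 2).
  have -> : a / (x + 1) - (a ^ 2 - b ^ 2) / 2 = - (a * (d - y)) + d ^ 2 / 2.
    by rewrite /d /y; field; lra.
  have e1 : 0 <= a * (d - y) <= a * (2 * y ^ 2).
    by split; [apply: Rmult_le_pos; lra|apply: Rmult_le_compat_l; lra].
  have e2 : 0 <= d ^ 2 <= (2 * y) ^ 2 by split; [exact: pow2_ge_0|apply: pow_incr; lra].
  have e3 : a * y ^ 2 <= 2 * (a ^ 2 * y ^ 2) by have := pow2_ge_0 y; nra.
  have e4 : y ^ 2 <= 4 * (a ^ 2 * y ^ 2) by have := pow2_ge_0 y; nra.
  by apply: Rabs_le; lra.
rewrite El Rmult_plus_distr_l.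
have -> : S + a / (x + 1) - a ^ 2 / 2 = (S - b ^ 2 / 2) + (a / (x + 1) - (a ^ 2 - b ^ 2) / 2) by field; lra.
apply: Rle_trans (Rabs_triang _ _) _; exact: Rplus_le_compat.
Qed.

Lemma sum_multiples n d : (0 < d)%N ->
  sumR n (fun i => INR (d %| i.+1) * / INR i.+1) = / INR d * har (n %/ d).
Proof.
move=> d0; elim: n => [|n IHn]; first by rewrite div0n /har /=; ring.
have -> : forall f, sumR n.+1 f = sumR n f + f n by [].
rewrite IHn divnS //.
case: (boolP (d %| n.+1)) => hd; last by rewrite add0n /=; ring.
rewrite add1n harS Rmult_plus_distr_l [INR true]/= Rmult_1_l.
congr (_ + _).
have e : (n.+1 = d * (n %/ d).+1)%N.
  by have := divnS n d0; rewrite hd add1n => <-; rewrite mulnC divnK.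
rewrite {1}e INR_muln Rinv_mult; ring.
Qed.

Lemma logn_sum n p k : prime p -> (0 < k <= n)%N ->
  INR (logn p k) = sumR n (fun j => INR (expn p j.+1 %| k)).
Proof.
move=> pp hk; rewrite logn_count_dvd //.
have : (k <= n)%N by lia.
case: k hk => // k hk hkn.
rewrite sum_nat_INR; symmetry; apply: sumR_widen; first lia.
move=> j hj; case: (boolP (_ %| _)) => // /(dvdn_leq (ltn0Sn k)).
have : (j.+1 < expn p j.+1)%N by apply: ltn_expl; exact: prime_gt1.
lia.
Qed.

Lemma logn_har n p : prime p ->
  sumR n (fun i => INR (logn p i.+1) * / INR i.+1) =
  sumR n (fun j => (/ INR p) ^ j.+1 * har (n %/ expn p j.+1)).
Proof.
move=> pp.
rewrite (sumR_ext _ _ (fun i => sumR n (fun j => INR (expn p j.+1 %| i.+1) * / INR i.+1))).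
  rewrite sumR_swap; apply: sumR_ext => j _.
  have q0 : (0 < expn p j.+1)%N by rewrite expn_gt0 (prime_gt0 pp).
  by rewrite sum_multiples // INR_expn pow_inv.
move=> i hi; rewrite (logn_sum n p i.+1 pp) //.
rewrite Rmult_comm -sumR_scal; apply: sumR_ext => j _; exact: Rmult_comm.
Qed.

Lemma geom_sum_lin x n : 0 <= x <= 1/2 -> sumR n (fun k => INR k.+2 * x ^ k) <= 8 - (INR n + 3) * (1/2) ^ n * 2.
Proof.
move=> hx; elim: n => [|n IHn]; first by rewrite /=; lra.
have -> : forall f, sumR n.+1 f = sumR n f + f n by [].
have h1 : x ^ n <= (1/2) ^ n by apply: pow_incr; lra.
have h2 : 0 <= x ^ n by apply: pow_le; lra.
rewrite !S_INR; have := pos_INR n => h3.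
have : (INR n + 1 + 1) * x ^ n <= (INR n + 1 + 1) * (1/2) ^ n by apply: Rmult_le_compat_l; lra.
have -> : (1/2) ^ n.+1 = 1/2 * (1/2) ^ n by [].
lra.
Qed.

Lemma sumR_shift n f : sumR n.+1 f = f 0%N + sumR n (fun k => f k.+1).
Proof.
elim: n => [|n IHn]; first by rewrite /=; ring.
have -> : sumR n.+2 f = sumR n.+1 f + f n.+1 by [].
rewrite IHn; have -> : sumR n.+1 (fun k => f k.+1) = sumR n (fun k => f k.+1) + f n.+1 by [].
ring.
Qed.

Definition is_euler g := forall m, (0 < m)%N -> 0 <= har m - ln (INR m) - g <= / INR m.

Lemma euler_bounds g : is_euler g -> 0 <= g <= 1.
Proof.
move=> /(_ 1%N isT); rewrite /har [sumR 1 _]/= [INR 1]/= ln_1 Rinv_1; lra.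
Qed.

(** The error is kept in the form d / n: weighted by ln p / p and summed over p <= n it becomes
    Chebyshev's function divided by n, which is bounded. *)
Lemma divn_log n d : (0 < d)%N -> (d <= n)%N ->
  0 <= ln (INR n) - ln (INR d) - ln (INR (n %/ d)) <= / INR (n %/ d)
  /\ / INR (n %/ d) <= 2 * INR d / INR n.
Proof.
move=> d0 hdn; set m := (n %/ d)%N.
have m0 : (0 < m)%N by rewrite divn_gt0.
have hm := INR_ge1 m m0; have hd := INR_gt0 d d0; have hn := INR_gt0 n ltac:(lia).
have e1 : INR m * INR d <= INR n by rewrite -INR_muln; apply: INR_leq; exact: leq_trunc_div.
have e2 : INR n <= INR m.+1 * INR d by rewrite -INR_muln; apply: INR_leq; have := ltn_ceil n d0; lia.
have [l1 l2] := ln_succ m m0; have hm1 := INR_gt0 m.+1 isT.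
have l3 : ln (INR m) + ln (INR d) <= ln (INR n).
  rewrite -ln_mult; try lra.
  by apply: ln_le => //; apply: Rmult_lt_0_compat; lra.
have l4 : ln (INR n) <= ln (INR m.+1) + ln (INR d).
  by rewrite -ln_mult; try lra; apply: ln_le.
split; first lra.
apply: (Rmult_le_reg_r (INR m * INR n)); first by apply: Rmult_lt_0_compat; lra.
have -> : / INR m * (INR m * INR n) = INR n by field; lra.
have -> : 2 * INR d / INR n * (INR m * INR n) = 2 * INR m * INR d by field; lra.
rewrite S_INR in e2; nra.
Qed.

Lemma har_floor g n d : is_euler g -> (0 < n)%N -> (0 < d)%N ->
  Rabs (har (n %/ d) - ln (INR n)) <= 2 + ln (INR d).
Proof.
move=> hg n0 d0; have hgb := euler_bounds g hg; have l0 := ln_nat_ge0 d.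
case: (leqP d n) => hdn; last first.
  rewrite divn_small // /har [sumR 0 _]/= Rminus_0_l Rabs_Ropp Rabs_pos_eq; last exact: ln_nat_ge0.
  by have := ln_INR_mono n d n0 ltac:(lia); lra.
have m0 : (0 < n %/ d)%N by rewrite divn_gt0.
have [[h1 h2] h3] := divn_log n d d0 hdn.
have h4 := hg _ m0.
have h5 : / INR (n %/ d) <= 1 by rewrite -Rinv_1; apply: Rinv_le_contravar; [lra|apply: INR_ge1].
by apply: Rabs_le; lra.
Qed.

Lemma pow2_ge_lin n : INR n.+1 * (1/2) ^ n <= 1.
Proof.
elim: n => [|n IHn]; first by rewrite /=; lra.
have -> : (1/2) ^ n.+1 = 1/2 * (1/2) ^ n by [].
have h := pow_lt (1/2) n ltac:(lra); have := pos_INR n; rewrite !S_INR in IHn *; nra.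
Qed.

(** The first power of p needs the harmonic sum up to O(p / n); the higher powers have weight x^2,
    and there the crude [har_floor], which also covers p^j > n, replaces the harmonic sum by ln
    n. *)
Lemma prime_power_estimate g n p : is_euler g -> (0 < n)%N -> prime p -> (p <= n)%N ->
  let x := / INR p in
  Rabs (sumR n (fun j => x ^ j.+1 * har (n %/ expn p j.+1))
        - x * (ln (INR n) - ln (INR p) + g) - ln (INR n) * (x ^ 2 / (1 - x)))
  <= 4 / INR n + 20 * x ^ 2 * ln (INR p).
Proof.
move=> hg n0 pp hpn x; have p0 := prime_gt0 pp.
have hx := prime_inv p pp; rewrite -/x in hx.
have hp2 := prime_ge2 p pp; have hl := ln_prime_ge p pp; have hn := INR_gt0 n n0.
case: n n0 hpn hn => // n n0 hpn hn.
rewrite sumR_shift.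
set S := sumR n _.
set T := sumR n (fun j => x ^ j.+2).
have hT : (1 - x) * T = x ^ 2 - x ^ n.+2.
  rewrite /T; elim: (n) => [|k IHk]; first by rewrite /=; ring.
  have -> : forall f, sumR k.+1 f = sumR k f + f k by [].
  by rewrite Rmult_plus_distr_l IHk /=; ring.
have hST : Rabs (S - ln (INR n.+1) * T) <= x ^ 2 * (4 + 8 * ln (INR p)).
  have -> : S - ln (INR n.+1) * T = S + (- ln (INR n.+1)) * T by ring.
  rewrite /S /T -sumR_scal -sumR_plus.
  apply: Rle_trans (sumR_abs _ _) _.
  apply: Rle_trans (_ : sumR n (fun j => x ^ 2 * (2 * x ^ j) + x ^ 2 * (ln (INR p) * (INR j.+2 * x ^ j))) <= _).
    apply: sumR_le => j _.
    have q0 : (0 < expn p j.+2)%N by rewrite expn_gt0 p0.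
    have -> : x ^ j.+2 * har (n.+1 %/ expn p j.+2) + - ln (INR n.+1) * x ^ j.+2
       = x ^ j.+2 * (har (n.+1 %/ expn p j.+2) - ln (INR n.+1)) by ring.
    have hxj : 0 <= x ^ j.+2 by apply: pow_le; lra.
    rewrite Rabs_mult (Rabs_pos_eq (x ^ j.+2)) //.
    have := Rmult_le_compat_l _ _ _ hxj (har_floor g n.+1 (expn p j.+2) hg n0 q0).
    rewrite INR_expn ln_pow; last lra.
    have -> : x ^ j.+2 = x ^ 2 * x ^ j by rewrite /=; ring.
    move=> h; apply: Rle_trans h _; apply: Req_le; ring.
  rewrite sumR_plus !sumR_scal.
  have g1 := geom_sum_lin x n ltac:(lra).
  have g1' : sumR n (fun k => INR k.+2 * x ^ k) <= 8.
    have := Rmult_le_pos (INR n + 3) ((1/2) ^ n) ltac:(have := pos_INR n; lra) ltac:(apply: pow_le; lra).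
    lra.
  have g2 : sumR n (fun j => x ^ j) <= 2.
    suff : (1 - x) * sumR n (fun j => x ^ j) <= 1.
      have := sumR_pos n (fun j => x ^ j) (fun j _ => pow_le x j ltac:(lra)); nra.
    have -> : (1 - x) * sumR n (fun j => x ^ j) = 1 - x ^ n.
      elim: (n) => [|k IHk]; first by rewrite /=; ring.
      have -> : forall f, sumR k.+1 f = sumR k f + f k by [].
      by rewrite Rmult_plus_distr_l IHk /=; ring.
    by have := pow_le x n ltac:(lra); lra.
  have hx2 := pow2_ge_0 x.
  have a1 : x ^ 2 * (2 * sumR n (fun j => x ^ j)) <= x ^ 2 * 4 by apply: Rmult_le_compat_l; lra.
  have a2 : x ^ 2 * (ln (INR p) * sumR n (fun j => INR j.+2 * x ^ j)) <= x ^ 2 * (ln (INR p) * 8).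
    by apply: Rmult_le_compat_l => //; apply: Rmult_le_compat_l; lra.
  by apply: Rle_trans (Rplus_le_compat _ _ _ _ a1 a2) _; lra.
have hTl : Rabs (ln (INR n.+1) * T - ln (INR n.+1) * (x ^ 2 / (1 - x))) <= 2 * x ^ 2.
  have -> : ln (INR n.+1) * T - ln (INR n.+1) * (x ^ 2 / (1 - x)) = - (ln (INR n.+1) * x ^ n * (x ^ 2 / (1 - x))).
    apply: (Rmult_eq_reg_r (1 - x)); last lra.
    have -> : (ln (INR n.+1) * T - ln (INR n.+1) * (x ^ 2 / (1 - x))) * (1 - x)
      = ln (INR n.+1) * ((1 - x) * T - x ^ 2) by field; lra.
    by rewrite hT; have -> : x ^ n.+2 = x ^ n * x ^ 2 by [rewrite /=; ring]; field; lra.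
  rewrite Rabs_Ropp Rabs_pos_eq; last first.
    apply: Rmult_le_pos; first by apply: Rmult_le_pos; [exact: ln_nat_ge0|apply: pow_le; lra].
    by apply: Rdiv_le_0_compat; [exact: pow2_ge_0|lra].
  have b1 : ln (INR n.+1) * x ^ n <= 1.
    have c1 : ln (INR n.+1) <= INR n.+1.
      by have := exp_ineq1_le (ln (INR n.+1)); rewrite exp_ln //; lra.
    have c2 : x ^ n <= (1/2) ^ n by apply: pow_incr; lra.
    apply: Rle_trans (pow2_ge_lin n); apply: Rmult_le_compat => //; [exact: ln_nat_ge0|apply: pow_le; lra].
  have b2 : x ^ 2 / (1 - x) <= 2 * x ^ 2.
    apply: (Rmult_le_reg_r (1 - x)); first lra.
    have -> : x ^ 2 / (1 - x) * (1 - x) = x ^ 2 by field; lra.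
    by have := pow2_ge_0 x; nra.
  have b3 : 0 <= x ^ 2 / (1 - x) by apply: Rdiv_le_0_compat; [exact: pow2_ge_0|lra].
  have b4 := Rmult_le_compat_r _ _ _ b3 b1; lra.
have h0 : Rabs (x ^ 1 * har (n.+1 %/ expn p 1) - x * (ln (INR n.+1) - ln (INR p) + g)) <= 4 / INR n.+1.
  rewrite expn1 pow_1 -Rmult_minus_distr_l Rabs_mult (Rabs_pos_eq x); last lra.
  have [[h1 h2] h3] := divn_log n.+1 p p0 hpn.
  have m0 : (0 < n.+1 %/ p)%N by rewrite divn_gt0.
  have h4 := hg (n.+1 %/ p)%N m0.
  have h6 : 0 <= 2 * INR p / INR n.+1 by apply: Rdiv_le_0_compat; lra.
  have h7 : 4 * INR p / INR n.+1 = 2 * (2 * INR p / INR n.+1) by field; lra.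
  have h5 : Rabs (har (n.+1 %/ p) - (ln (INR n.+1) - ln (INR p) + g)) <= 4 * INR p / INR n.+1.
    by apply: Rabs_le; lra.
  have := Rmult_le_compat_l x _ _ ltac:(lra) h5.
  have -> : x * (4 * INR p / INR n.+1) = 4 / INR n.+1 by rewrite /x; field; lra.
  by [].
move/Rabs_le_between: hST => hST; move/Rabs_le_between: hTl => hTl; move/Rabs_le_between: h0 => h0.
have hfin : x ^ 2 * (4 + 8 * ln (INR p)) + 2 * x ^ 2 <= 20 * x ^ 2 * ln (INR p).
  by have := pow2_ge_0 x; nra.
by apply: Rabs_le; lra.
Qed.

(** The contribution of the higher powers, the sum of ln p / p^j over j >= 2. *)
Definition cc p := ln (INR p) * ((/ INR p) ^ 2 / (1 - / INR p)).

Lemma cc_bounds p : prime p -> 0 <= cc p /\ cc p * ln (INR p) <= 2 * lnsq p /\ cc p <= 4 * lnsq p.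
Proof.
move=> pp; have hx := prime_inv p pp; have hl := ln_prime_ge p pp; have hp := prime_ge2 p pp.
set x := / INR p in hx; set l := ln (INR p) in hl.
have b2 : x ^ 2 / (1 - x) <= 2 * x ^ 2.
  apply: (Rmult_le_reg_r (1 - x)); first lra.
  have -> : x ^ 2 / (1 - x) * (1 - x) = x ^ 2 by field; lra.
  by have := pow2_ge_0 x; nra.
have b3 : 0 <= x ^ 2 / (1 - x) by apply: Rdiv_le_0_compat; [exact: pow2_ge_0|lra].
have e : lnsq p = l ^ 2 * x ^ 2.
  by rewrite /lnsq prime_gt1 // /x /l; field; lra.
have -> : cc p = l * (x ^ 2 / (1 - x)) by [].
rewrite e; set w := x ^ 2 / (1 - x) in b2 b3 *.
have := pow2_ge_0 x; set z := x ^ 2 in b2 * => hz.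
have h1 : 0 <= l * w by apply: Rmult_le_pos; lra.
have h2 : l * l * w <= l * l * (2 * z) by apply: Rmult_le_compat_l => //; nra.
rewrite -/l; split=> //; split; first lra.
have : l * w <= 2 * (l * l * w) by nra.
lra.
Qed.

(** The tail is needed with rate 1 / ln n, as it will be multiplied by ln n. In the tail ln p >= ln
    n, and cc(p) ln p is already summable. *)
Lemma cc_limit : exists c, 0 <= c /\ forall n, (0 < n)%N ->
  Rabs (c - sumR n.+1 (primeR cc)) * ln (INR n) <= 64.
Proof.
have mono a b : (a <= b)%N -> sumR a (primeR cc) <= sumR b (primeR cc).
  by move=> hab; apply: sumR_mono => // k; apply: primeR_pos => pk; exact: (proj1 (cc_bounds k pk)).
have tail n d : (0 < n)%N -> (sumR (n.+1 + d) (primeR cc) - sumR n.+1 (primeR cc)) * ln (INR n)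
    <= 2 * (sumR (n.+1 + d) lnsq - sumR n.+1 lnsq).
  move=> n0; elim: d => [|d IHd]; first by rewrite addn0; lra.
  rewrite addnS !(sumRS (n.+1 + d)).
  have : primeR cc (n.+1 + d) * ln (INR n) <= 2 * lnsq (n.+1 + d); last lra.
  rewrite /primeR; case: ifP => pp; last by have := lnsq_pos (n.+1 + d); lra.
  have [c1 [c2 _]] := cc_bounds _ pp.
  apply: Rle_trans c2; apply: Rmult_le_compat_l => //; apply: ln_INR_mono => //; lia.
pose E y := exists k, y = sumR k (primeR cc).
have [c [ub lub]] : {c | is_lub E c}.
  apply: completeness; last by exists 0, 0%N.
  exists 128 => y [k ->].
  apply: Rle_trans (_ : sumR k (fun j => 4 * lnsq j) <= _); last by rewrite sumR_scal; have := sum_lnsq k; lra.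
  apply: sumR_le => j _; rewrite /primeR; case: ifP => pj; first by have [_ [_]] := cc_bounds j pj.
  by have := lnsq_pos j; lra.
exists c; split; first by apply: ub; exists 0%N.
move=> n n0; have h1 : sumR n.+1 (primeR cc) <= c by apply: ub; exists n.+1.
rewrite Rabs_pos_eq; last lra.
have l0 := ln_nat_ge0 n.
case: (Req_dec (ln (INR n)) 0) => [->|hne]; first lra.
have l1 : 0 < ln (INR n) by lra.
have : c <= sumR n.+1 (primeR cc) + 64 / ln (INR n).
  apply: lub => y [k ->].
  have hk : sumR k (primeR cc) <= sumR (n.+1 + k) (primeR cc) by apply: mono; lia.
  have ht := tail n k n0.
  have h2 := sum_lnsq (n.+1 + k); have h3 := sumR_pos n.+1 lnsq (fun j _ => lnsq_pos j).
  have : sumR (n.+1 + k) (primeR cc) - sumR n.+1 (primeR cc) <= 64 / ln (INR n).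
    apply: (Rmult_le_reg_r (ln (INR n))) => //.
    have -> : 64 / ln (INR n) * ln (INR n) = 64 by field.
    lra.
  lra.
move=> h; have := Rmult_le_compat_r _ _ _ l0 h.
have -> : (sumR n.+1 (primeR cc) + 64 / ln (INR n)) * ln (INR n) = sumR n.+1 (primeR cc) * ln (INR n) + 64 by field.
lra.
Qed.

(** The sum of ln k / k over k <= n is evaluated twice: directly it is ln^2 n / 2 + O(1), and by
    factoring every k it is the wanted sum plus gamma [th] plus ln n times the sum of [cc]. As [th]
    = ln n + O(1) and the last sum is c + O(1 / ln n), the constant is E = gamma + c. *)
Lemma mertens2 : exists E K, forall n, (0 < n)%N ->
  Rabs (sumR n.+1 (primeR (fun p => ln (INR p) / INR p * (ln (INR n) - ln (INR p))))
        - (ln (INR n) ^ 2 / 2 - E * ln (INR n))) <= K.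
Proof.
have [g hg] := harmonic; have hgb := euler_bounds g hg.
have [c [c0 hc]] := cc_limit.
exists (g + c), (384 + 129 + 64 + (32 + 640)) => n n0.
have hn := INR_gt0 n n0.
set ell := ln (INR n).
have hQ := sum_ln_over n n0.
set Q := sumR n _ in hQ.
have EQ : Q = sumR n.+1 (primeR (fun p => ln (INR p) * sumR n (fun j => (/ INR p) ^ j.+1 * har (n %/ expn p j.+1)))).
  rewrite /Q (sumR_ext _ _ (fun k => sumR n.+1 (fun p => primeR (fun p => INR (logn p k.+1) * ln (INR p)) p * / INR k.+1))).
    rewrite sumR_swap; apply: sumR_ext => p _.
    rewrite /primeR; case: ifP => pp; last by rewrite sumR_zero // => k _; ring.
    rewrite -logn_har // -sumR_scal; apply: sumR_ext => k _; ring.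
  move=> k hk; rewrite (ln_factor n.+1 k.+1) ?hk //.
  rewrite /Rdiv Rmult_comm -sumR_scal; apply: sumR_ext => p _; exact: Rmult_comm.
set A := sumR n.+1 _.
have key : Rabs (Q - (A + g * th n.+1 + ell * sumR n.+1 (primeR cc))) <= 32 + 640.
  have -> : Q - (A + g * th n.+1 + ell * sumR n.+1 (primeR cc))
     = Q + ((-1) * A + ((- g) * th n.+1 + (- ell) * sumR n.+1 (primeR cc))) by ring.
  rewrite EQ /A /th -!sumR_scal -!sumR_plus.
  apply: Rle_trans (sumR_abs _ _) _.
  apply: Rle_trans (_ : sumR n.+1 (fun p => 4 / INR n * primeR (fun p => ln (INR p)) p + 20 * lnsq p) <= _).
    apply: sumR_le => p hp; rewrite /primeR; case: ifP => pp; last first.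
      by rewrite !Rmult_0_r !Rplus_0_r Rabs_R0; have := lnsq_pos p; lra.
    have l0 := ln_nat_ge0 p.
    have := prime_power_estimate g n p hg n0 pp ltac:(lia).
    set x := / INR p; set S := sumR n _ => h.
    have -> : ln (INR p) * S + (-1 * (ln (INR p) / INR p * (ell - ln (INR p))) + (- g * (ln (INR p) / INR p) + - ell * cc p))
      = ln (INR p) * (S - x * (ell - ln (INR p) + g) - ell * (x ^ 2 / (1 - x))).
      by rewrite /cc -/x /Rdiv -/x; ring.
    rewrite Rabs_mult (Rabs_pos_eq (ln _)) //.
    apply: Rle_trans (Rmult_le_compat_l _ _ _ l0 h) _.
    have -> : lnsq p = ln (INR p) ^ 2 * x ^ 2.
      by rewrite /lnsq prime_gt1 // /x; have := prime_ge2 p pp => ?; field; lra.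
    by apply: Req_le; ring.
  rewrite sumR_plus !sumR_scal.
  have h1 := chebyshev n; have h2 := sum_lnsq n.+1.
  have h3 : 4 / INR n * vth n.+1 <= 4 / INR n * (8 * INR n).
    by apply: Rmult_le_compat_l => //; apply/Rlt_le/Rdiv_lt_0_compat; lra.
  have e3 : 4 / INR n * (8 * INR n) = 32 by field; lra.
  rewrite -/(vth n.+1); lra.
have h1 := mertens1 n n0; rewrite -/ell in h1.
have h2 := hc n n0; rewrite -/ell in h2.
have l0 : 0 <= ell by exact: ln_nat_ge0.
have h1' : Rabs (g * (th n.+1 - ell)) <= 1 * 129 by apply: Rabs_mul_le => //; rewrite Rabs_pos_eq; lra.
have h2' : Rabs ((c - sumR n.+1 (primeR cc)) * ell) <= 64.
  by rewrite Rabs_mult (Rabs_pos_eq ell).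
rewrite -/ell in hQ.
move/Rabs_le_between: key => key; move/Rabs_le_between: hQ => hQ.
move/Rabs_le_between: h1' => h1'; move/Rabs_le_between: h2' => h2'.
by apply: Rabs_le; lra.
Qed.

(* The logarithmic scale E + th is chosen so that its deviation from ln p is not
   only bounded but also has bounded mean against the weights ln p / p. *)
Lemma mertens_scale : exists E K, 0 <= K /\ forall n, (0 < n)%N ->
  Rabs (E + th n - ln (INR n)) <= K /\
  Rabs (sumR n (primeR (fun p => ln (INR p) / INR p * (E + th p - ln (INR p))))) <= K.
Proof.
have [E [K2 h2]] := mertens2.
pose K1 := 130 + Rabs E.
have K2p : 0 <= K2 by apply: Rle_trans (h2 1%N isT); exact: Rabs_pos.
have hE := Rabs_pos E.
have thn n : (0 < n)%N -> 0 <= th n.+1 - th n <= 1.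
  move=> n0; have -> : th n.+1 = th n + primeR (fun p => ln (INR p) / INR p) n by [].
  have hn := INR_gt0 n n0.
  have hl : ln (INR n) / INR n <= 1.
    apply: (Rmult_le_reg_r (INR n)) => //.
    have -> : ln (INR n) / INR n * INR n = ln (INR n) by field; lra.
    by have := exp_ineq1_le (ln (INR n)); rewrite exp_ln //; lra.
  have hl0 : 0 <= ln (INR n) / INR n by apply: Rdiv_le_0_compat => //; exact: ln_nat_ge0.
  by rewrite /primeR; case: ifP => _; lra.
have b1 n : (0 < n)%N -> Rabs (E + th n - ln (INR n)) <= K1.
  move=> n0; have := mertens1 n n0; have := thn n n0 => h3 /Rabs_le_between h4.
  have := Rle_abs E; have := Rle_abs (- E); rewrite Rabs_Ropp => h5 h6.
  by apply: Rabs_le; rewrite /K1; lra.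
exists E, (K1 + K1 ^ 2 / 2 + K2 + E ^ 2 / 2 + 16).
have hK1 : 0 <= K1 by rewrite /K1; lra.
have q1 := pow2_ge_0 K1; have q2 := pow2_ge_0 E.
split; first lra.
move=> n n0; have hb := b1 n n0; split; first lra.
set t := E + th n; set ell := ln (INR n).
(* Summation by squares: at a prime p the scale grows by d = ln p / p, and its square by 2 d (E + th
   p) + d^2. *)
have s1 : sumR n (primeR (fun p => ln (INR p) / INR p * (E + th p)))
   = t ^ 2 / 2 - E ^ 2 / 2 - sumR n (primeR (fun p => (ln (INR p) / INR p) ^ 2)) / 2.
  rewrite /t; elim: (n) => [|m IHm]; first by rewrite /th /=; field.
  rewrite !(sumRS m).
  have -> : th m.+1 = th m + primeR (fun p => ln (INR p) / INR p) m by [].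
  by rewrite IHm /primeR; case: ifP => pm; field; have := prime_ge2 m pm; lra.
have s2 := h2 n n0; rewrite -/ell in s2.
have -> : sumR n (primeR (fun p => ln (INR p) / INR p * (E + th p - ln (INR p))))
  = sumR n (primeR (fun p => ln (INR p) / INR p * (E + th p))) - ell * th n
    + sumR n.+1 (primeR (fun p => ln (INR p) / INR p * (ell - ln (INR p)))).
  have -> : forall f, sumR n.+1 f = sumR n f + f n by [].
  have -> : primeR (fun p => ln (INR p) / INR p * (ell - ln (INR p))) n = 0.
    by rewrite /primeR; case: ifP => _ //; rewrite /ell; ring.
  rewrite Rplus_0_r.
  have -> : forall a b c, a - b + c = a + ((-1) * b + c) by move=> *; ring.
  rewrite /th -!sumR_scal -!sumR_plus; apply: sumR_ext => p _.
  by rewrite /primeR; case: ifP => _; ring.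
have s3 : 0 <= sumR n (primeR (fun p => (ln (INR p) / INR p) ^ 2)) <= 32.
  split; first by apply: sumR_pos => p _; apply: primeR_pos => _; exact: pow2_ge_0.
  apply: Rle_trans (sum_lnsq n); apply: sumR_le => p _; rewrite /primeR; case: ifP => pp; last exact: lnsq_pos.
  rewrite /lnsq prime_gt1 //; have := prime_ge2 p pp => ?.
  by apply: Req_le; field; lra.
rewrite s1; set Z := sumR n _ in s3 *.
(* With [s1] and [mertens2] the sum is t^2/2 - ell (t - E) + ell^2/2 - E ell + O(1) = (t - ell)^2 /
   2 + O(1): the choice of E removes the linear terms. *)
have hb2 : (t - ell) ^ 2 <= K1 ^ 2.
  rewrite -(pow2_abs (t - ell)); apply: pow_incr; split=> //; exact: Rabs_pos.
have hb3 := pow2_ge_0 (t - ell).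
have e : th n = t - E by rewrite /t; ring.
rewrite e; move/Rabs_le_between: s2 => s2.
by apply: Rabs_le; lra.
Qed.

(** * The sieve bounds *)

Definition hits (r : nat -> nat) (t q : nat) : bool := (t %% q)%N == (r q %% q)%N.
Definition avoids r n t : bool := all (fun p => prime p ==> ~~ hits r t p) (seq.iota 0 n).
(** Buchstab's identity leads to the sifting of a residue class modulo p, so the imposed classes
    belong to the state: D lists their moduli, distinct primes not below the sifting level. *)
Definition sifted r D n b : nat := count (fun t => all (hits r t) D && avoids r n t) (seq.iota 0 b).

Definition primeset n (D : seq nat) : bool := uniq D && all (fun q => prime q && (n <= q)%N) D.

Lemma avoidsS r n t : avoids r n.+1 t = avoids r n t && (prime n ==> ~~ hits r t n).
Proof. by rewrite /avoids -addn1 iotaD all_cat /= andbT. Qed.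

Lemma sifted_prime r D n b : prime n ->
  (sifted r D n b = sifted r D n.+1 b + sifted r (n :: D) n b)%N.
Proof.
move=> pn; rewrite /sifted; elim: (seq.iota 0 b) => //= t s ->.
rewrite avoidsS pn /=; case: (hits r t n) => /=; case: (all _ D) => /=; case: (avoids r n t) => /=; lia.
Qed.

Lemma sifted_nonprime r D n b : ~~ prime n -> sifted r D n.+1 b = sifted r D n b.
Proof.
move=> pn; rewrite /sifted; apply: eq_count => t.
by rewrite avoidsS (negbTE pn) /= andbT.
Qed.

Lemma primeset_cons n D : prime n -> primeset n.+1 D -> primeset n (n :: D).
Proof.
move=> pn /andP [uD aD]; rewrite /primeset /= pn leqnn uD /= andbT.
apply/andP; split.
  by apply/negP => /(allP aD) /andP [_]; rewrite ltnn.
by apply/allP => q /(allP aD) /andP [-> /ltnW ->].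
Qed.

Lemma primeset_weak n D : primeset n.+1 D -> primeset n D.
Proof.
move=> /andP [uD aD]; rewrite /primeset uD /=.
by apply/allP => q /(allP aD) /andP [-> /ltnW ->].
Qed.

Lemma primeset_coprime n q D : primeset n (q :: D) -> coprime q (\prod_(p <- D) p).
Proof.
move=> /andP [/= /andP [nq uD] /andP [/andP [pq _] aD]].
elim: D nq uD aD => [|p D IHD]; first by rewrite big_nil coprimen1.
rewrite inE negb_or big_cons coprimeMr => /andP [hqp hq] /= /andP [_ uD] /andP [/andP [pp _] aD].
by rewrite IHD // prime_coprime // dvdn_prime2 // hqp.
Qed.

Lemma primeset_prod_gt0 n D : primeset n D -> (0 < \prod_(p <- D) p)%N.
Proof.
move=> /andP [_ aD]; elim: D aD => [|p D IHD]; first by rewrite big_nil.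
by rewrite big_cons /= => /andP [/andP [pp _] aD]; rewrite muln_gt0 prime_gt0 //= IHD.
Qed.

Lemma primeset_tail n q D : primeset n (q :: D) -> primeset n D.
Proof. by move=> /andP [/= /andP [_ uD] /andP [_ aD]]; rewrite /primeset uD aD. Qed.

Lemma crt_class r n D : primeset n D ->
  exists a, forall t, all (hits r t) D = (t == a %[mod \prod_(p <- D) p]).
Proof.
elim: D => [|q D IHD] hD.
  by exists 0%N => t; rewrite big_nil !modn1.
have [a ha] := IHD (primeset_tail _ _ _ hD).
have co := primeset_coprime _ _ _ hD.
exists (chinese q (\prod_(p <- D) p) (r q) a) => t.
rewrite big_cons /= ha chinese_remainder // /hits.
by rewrite (chinese_modl co) (chinese_modr co).
Qed.

Lemma count_class m a b : (0 < m)%N ->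
  count (fun t => t == a %[mod m]) (seq.iota 0 b) = ((b + (m.-1 - a %% m)) %/ m)%N.
Proof.
move=> m0; have ha := ltn_pmod a m0.
elim: b => [|b IHb]; first by rewrite divn_small // add0n; lia.
rewrite -addn1 iotaD count_cat IHb /= addn0 addn1 addSn divnS // addnC; congr (_ + _)%N.
rewrite -(eqn_modDr (m - a %% m)) addnC.
have -> : (b + (m.-1 - a %% m)).+1 = (b + (m - a %% m))%N by lia.
rewrite /dvdn [(m - _ + b)%N]addnC; congr (nat_of_bool (_ == _)).
by rewrite -modnDml subnKC ?modnn // ltnW.
Qed.

Lemma count_class_bounds m a b : (0 < m)%N ->
  Rabs (INR (count (fun t => t == a %[mod m]) (seq.iota 0 b)) - INR b / INR m) <= 1.
Proof.
move=> m0; rewrite count_class //.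
set c := (m.-1 - a %% m)%N; have hm := INR_gt0 m m0.
have [h1 h2] := INR_divn (b + c) m m0.
have hc : INR c <= INR m by apply: INR_leq; rewrite /c; lia.
have hc0 := pos_INR c.
rewrite INR_addn /Rdiv Rmult_plus_distr_r in h1 h2.
have i1 : INR c * / INR m <= 1.
  apply: (Rmult_le_reg_r (INR m)) => //.
  have -> : INR c * / INR m * INR m = INR c by field; lra.
  lra.
have i2 : 0 <= INR c * / INR m by apply: Rmult_le_pos => //; apply/Rlt_le/Rinv_0_lt_compat.
by apply: Rabs_le; rewrite /Rdiv; lra.
Qed.

Definition modulus (D : seq nat) : R := INR (\prod_(p <- D) p).

Lemma modulus_cons q D : modulus (q :: D) = INR q * modulus D.
Proof. by rewrite /modulus big_cons INR_muln. Qed.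

Lemma modulus_gt0 n D : primeset n D -> 0 < modulus D.
Proof. by move=> h; apply: INR_gt0; exact: primeset_prod_gt0 h. Qed.

Lemma sifted0 r D b : primeset 0 D -> Rabs (INR (sifted r D 0 b) - INR b / modulus D) <= 1.
Proof.
move=> hD; have [a ha] := crt_class r 0 D hD.
have -> : sifted r D 0 b = count (fun t => t == a %[mod \prod_(p <- D) p]) (seq.iota 0 b).
  by apply: eq_count => t; rewrite /avoids /= andbT ha.
by apply: count_class_bounds; exact: primeset_prod_gt0 hD.
Qed.

Fixpoint mert (n : nat) : R :=
  if n is m.+1 then mert m * (if prime m then 1 - / INR m else 1) else 1.

Lemma mertS_prime n : prime n -> mert n.+1 = mert n * (1 - / INR n).
Proof. by move=> pn /=; rewrite pn. Qed.

Lemma mertS_nonprime n : ~~ prime n -> mert n.+1 = mert n.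
Proof. by move=> /negbTE pn /=; rewrite pn Rmult_1_r. Qed.

Lemma mert_bounds n : 0 < mert n <= 1.
Proof.
elim: n => [|n IHn]; first by rewrite /=; lra.
case: (boolP (prime n)) => pn; last by rewrite mertS_nonprime.
by rewrite mertS_prime //; have := prime_inv n pn; nra.
Qed.

(** The error doubles at every step. This is affordable because it is applied only at the fixed
    starting level n0. *)
Lemma sifted_legendre r D n b : primeset n D ->
  Rabs (INR (sifted r D n b) - INR b / modulus D * mert n) <= 2 ^ n.
Proof.
elim: n D => [|n IHn] D hD; first by rewrite /= Rmult_1_r; apply: sifted0.
have p2 : 0 < 2 ^ n by apply: pow_lt; lra.
have -> : 2 ^ n.+1 = 2 * 2 ^ n by [].
case: (boolP (prime n)) => pn; last first.
  by rewrite sifted_nonprime // mertS_nonprime //; have := IHn D (primeset_weak _ _ hD); lra.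
have h1 := IHn D (primeset_weak _ _ hD); have h2 := IHn _ (primeset_cons _ _ pn hD).
have hm := modulus_gt0 _ _ hD; have hn := prime_ge2 n pn.
have e := sifted_prime r D n b pn.
have -> : INR (sifted r D n.+1 b) = INR (sifted r D n b) - INR (sifted r (n :: D) n b).
  by rewrite e INR_addn; ring.
rewrite mertS_prime // modulus_cons in h2 *.
have e2 : INR b / (INR n * modulus D) * mert n = INR b / modulus D * mert n * / INR n by field; lra.
rewrite e2 in h2; set u := INR b / modulus D * mert n in h1 h2.
have -> : INR b / modulus D * (mert n * (1 - / INR n)) = u - u * / INR n by rewrite /u; ring.
by move/Rabs_le_between: h1 => h1; move/Rabs_le_between: h2 => h2; apply: Rabs_le; lra.
Qed.

Lemma nat_above (x : R) : exists n0 : nat, forall n, (n0 <= n)%N -> x <= INR n.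
Proof.
exists (Z.to_nat (up x)) => n hn; apply: Rle_trans (INR_leq _ _ hn).
have [h _] := archimed x; rewrite INR_IZR_INZ.
case: (Z_le_dec 0 (up x)) => h0; first by rewrite Z2Nat.id //; lra.
have : IZR (up x) <= 0 by apply: IZR_le; lia.
have := pos_INR (Z.to_nat (up x)); rewrite INR_IZR_INZ; lra.
Qed.

Lemma scale_large K T : 0 <= K -> 1 <= T -> exists n0 : nat, forall n t, (n0 <= n)%N ->
  Rabs (t - ln (INR n)) <= K ->
  [/\ T <= t, (1 < n)%N, / (INR n - 1) <= 1/100 & / (INR n - 1) <= (/ t) ^ 2].
Proof.
move=> hK hT.
have [n1 h1] := nat_above (exp (T + K)).
(* Then sqrt n >= 34 + 2K^2, so n - 1 exceeds 32 sqrt n + 2K^2 >= 2 ln^2 n + 2K^2 >= t^2. *)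
have [n2 h2] := nat_above ((34 + 2 * K ^ 2) ^ 2).
exists (maxn n1 n2) => n t hn ht.
have {}h1 := h1 n ltac:(lia); have {}h2 := h2 n ltac:(lia).
have hK2 := pow2_ge_0 K.
have hn0 : 34 ^ 2 <= INR n by apply: Rle_trans h2; apply: pow_incr; lra.
have hl : T + K <= ln (INR n).
  by rewrite -(ln_exp (T + K)); apply: ln_le => //; exact: exp_pos.
move/Rabs_le_between: ht => ht.
have hs : 34 + 2 * K ^ 2 <= sqrt (INR n).
  by rewrite -(sqrt_pow2 (34 + 2 * K ^ 2)); [apply: sqrt_le_1; try lra; exact: pow2_ge_0|lra].
have Es : sqrt (INR n) * sqrt (INR n) = INR n by apply: sqrt_sqrt; lra.
have hsq := ln_sq_le (INR n) ltac:(lra).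
have ht2 : t ^ 2 <= INR n - 1.
  have : t ^ 2 <= (ln (INR n) + K) ^ 2 by apply: pow_incr; lra.
  have : (ln (INR n) + K) ^ 2 <= 2 * ln (INR n) ^ 2 + 2 * K ^ 2.
    by have := pow2_ge_0 (ln (INR n) - K); lra.
  nra.
split; first lra.
- by case: n hn0 {hn h1 h2 hl ht hs Es hsq ht2} => [|[|n]] //=; lra.
- by apply: (Rmult_le_reg_l (INR n - 1)); [lra|rewrite Rinv_r; lra].
have t0 : 0 < t ^ 2 by apply: pow_lt; lra.
by rewrite pow_inv; apply: Rinv_le_contravar.
Qed.

(** * Induction over the primes *)

Section SieveInduction.
Variables (A C0 : R) (Ep Em : R -> R) (E K1 : R).
Hypothesis hP : profile A C0 Ep Em.
Hypothesis hK1 : 0 <= K1.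
Hypothesis hscale : forall n, (0 < n)%N -> Rabs (E + th n - ln (INR n)) <= K1 /\
  Rabs (sumR n (primeR (fun p => ln (INR p) / INR p * (E + th p - ln (INR p))))) <= K1.
Variables (J C B K2 : R) (n0 : nat).
Let K := 2 * K1.
Hypothesis hJ : C * K ^ 2 <= J.
Hypothesis hC : 0 < C.
Hypothesis lEm : decay_lip (from (-1/2)) C Em.
Hypothesis hbar : forall t t' N N' p L k k' x, transition (4 * K + 1) K K2 t t' N N' p L k k' ->
  [/\ 2 * t' <= x - k' ->
      (1 + / (p - 1)) * EEm Ep Em B t N k x + / (p - 1) * EEp A J K Ep Em B t N k (x - L)
       <= EEm Ep Em B t' N' k' x,
      t' / 2 <= x - k' -> 3 * t + K <= x - k ->
      2 * t <= x - L - k /\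
      (1 + / (p - 1)) * EEp A J K Ep Em B t N k x + / (p - 1) * EEm Ep Em B t N k (x - L)
       <= EEp A J K Ep Em B t' N' k' x
    & t' / 2 <= x - k' -> x - k < 3 * t + K ->
      (1 + / (p - 1)) * EEp A J K Ep Em B t N k x + / (p - 1) <= EEp A J K Ep Em B t' N' k' x].
Let ts n := E + th n.
(** Counted from n0, so that N and k start at 0. N is a difference of two sums bounded by K1, hence
    K = 2 K1; the shifts telescope, so k never exceeds K2 / t(n0). *)
Let Ns n := sumR n (primeR (fun p => ln (INR p) / INR p * (E + th p - ln (INR p))))
          - sumR n0 (primeR (fun p => ln (INR p) / INR p * (E + th p - ln (INR p)))).
Let ks n := K2 * (/ ts n0 - / ts n).
Hypothesis n0pos : (0 < n0)%N.
Hypothesis hlarge : forall n, (n0 <= n)%N ->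
  [/\ 4 * K + 1 <= ts n, (1 < n)%N, / (INR n - 1) <= 1/100 & / (INR n - 1) <= (/ ts n) ^ 2].
Hypothesis hK2 : 0 <= K2.
Hypothesis hB : 2 ^ n0 * ts n0 ^ 2 / mert n0 <= B.

Let bounds n := forall r D b, primeset n D -> (0 < b)%N ->
  let X := INR b / modulus D in
  (ts n / 2 <= ln X - ks n ->
     INR (sifted r D n b) <= X * mert n * (1 + EEp A J K Ep Em B (ts n) (Ns n) (ks n) (ln X))) /\
  (2 * ts n <= ln X - ks n ->
     X * mert n * (1 - EEm Ep Em B (ts n) (Ns n) (ks n) (ln X)) <= INR (sifted r D n b)).

(** The barrier alone pays for Legendre's error: since t >= 1, X e^(-ln X / t) >= 1, and B was
    chosen so that B V(n0) / t^2 >= 2^n0. *)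
Lemma sieve_base : bounds n0.
Proof.
move=> r D b hD hb X.
have [T0 _ _ _] := hlarge n0 (leqnn n0).
have hK : 0 <= K by rewrite /K; lra.
have k0 : ks n0 = 0 by rewrite /ks; ring.
have N0 : Ns n0 = 0 by rewrite /Ns; ring.
have hm := modulus_gt0 _ _ hD.
have X0 : 0 < X by apply: Rdiv_lt_0_compat => //; exact: INR_gt0.
have [m0 m1] := mert_bounds n0.
have hleg := sifted_legendre r D n0 b hD; rewrite -/X in hleg.
move/Rabs_le_between: hleg => hleg.
have hB' := hB.
set t := ts n0 in T0 hB' *.
have t2 : 0 < t ^ 2 by apply: pow_lt; lra.
have p2 : 0 < 2 ^ n0 by apply: pow_lt; lra.
have barrier s : s = ln X / t -> 0 <= ln X -> 2 ^ n0 <= X * mert n0 * (B / t ^ 2 * exp (- s)).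
  move=> -> hx.
  have e1 : 1 <= X * exp (- (ln X / t)).
    rewrite -{1}(exp_ln X) // -exp_plus; apply: exp_ge1.
    have : ln X / t <= ln X * 1.
      by apply: Rmult_le_compat_l => //; rewrite -Rinv_1; apply: Rinv_le_contravar; lra.
    lra.
  have e2 : 2 ^ n0 <= mert n0 * (B / t ^ 2).
    apply: (Rmult_le_reg_r (t ^ 2 / mert n0)); first exact: Rdiv_lt_0_compat.
    have -> : mert n0 * (B / t ^ 2) * (t ^ 2 / mert n0) = B by field; lra.
    by have -> : 2 ^ n0 * (t ^ 2 / mert n0) = 2 ^ n0 * t ^ 2 / mert n0 by [field; lra]; lra.
  have -> : X * mert n0 * (B / t ^ 2 * exp (- (ln X / t))) = (mert n0 * (B / t ^ 2)) * (X * exp (- (ln X / t))) by ring.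
  by have := Rmult_le_compat (2 ^ n0) (mert n0 * (B / t ^ 2)) 1 (X * exp (- (ln X / t))); lra.
have nn : 0 < X * mert n0 by apply: Rmult_lt_0_compat.
rewrite k0 N0 !Rminus_0_r; split=> hx.
  have hx0 : 0 <= ln X by lra.
  have hb2 := barrier _ erefl hx0.
  suff : B / t ^ 2 * exp (- (ln X / t)) <= EEp A J K Ep Em B t 0 0 (ln X).
    by move=> h; have := Rmult_le_compat_l _ _ _ (Rlt_le _ _ nn) h; lra.
  rewrite /EEp Rminus_0_r; set s := ln X / t in hb2 *.
  have hs : 1/2 <= s.
    apply: (Rmult_le_reg_r t); first lra.
    by have -> : s * t = ln X by [rewrite /s; field; lra]; lra.
  have pp := Ep_pos _ _ _ _ hP s hs.
  have -> : 0 / t ^ 2 = 0 by rewrite /Rdiv; ring.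
  rewrite !Rmult_0_l; case: Rle_dec => h; cbn [is_left]; first lra.
  have hd : 0 <= K / t by apply: Rdiv_le_0_compat; lra.
  have [_ /(_ (K / t) hd)] := Ep_near3 _ _ _ _ _ hP lEm hC s hs.
  move=> h3; have {}h3 : Ep s <= A / s - 1 + C * (K / t) ^ 2.
    apply: h3; apply: (Rmult_le_reg_r t); first lra.
    have -> : s * t = ln X by rewrite /s; field; lra.
    by have -> : (3 + K / t) * t = 3 * t + K by [field; lra]; lra.
  have : C * (K / t) ^ 2 <= J / t ^ 2.
    have -> : C * (K / t) ^ 2 = C * K ^ 2 * / t ^ 2 by field; lra.
    by apply: Rmult_le_compat_r => //; apply/Rlt_le/Rinv_0_lt_compat.
  lra.
have hx0 : 0 <= ln X by lra.
have hb2 := barrier _ erefl hx0.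
suff : B / t ^ 2 * exp (- (ln X / t)) <= EEm Ep Em B t 0 0 (ln X).
  by move=> h; have := Rmult_le_compat_l _ _ _ (Rlt_le _ _ nn) h; lra.
rewrite /EEm Rminus_0_r.
have -> : 0 / t ^ 2 = 0 by rewrite /Rdiv; ring.
by rewrite Rmult_0_l; have := Em_pos _ _ _ _ hP (ln X / t); lra.
Qed.

Lemma sieve_transition n : (n0 <= n)%N -> prime n ->
  transition (4 * K + 1) K K2 (ts n) (ts n.+1) (Ns n) (Ns n.+1) (INR n) (ln (INR n)) (ks n) (ks n.+1).
Proof.
move=> hn pn.
have [T0 n1 h1 h2] := hlarge n hn.
have [s1 s2] := hscale n ltac:(lia); have [s3 s4] := hscale n.+1 ltac:(lia).
have [_ s5] := hscale n0 n0pos.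
have eth : th n.+1 = th n + ln (INR n) / INR n.
  by rewrite {1}/th sumRS /primeR pn.
split=> //.
- by have := prime_ge2 n pn; lra.
- by rewrite /K /ts; lra.
- exact: ln_nat_ge0.
- by rewrite /ts eth; ring.
- by move/Rabs_le_between: s2 => s2; move/Rabs_le_between: s5 => s5; apply: Rabs_le; rewrite /Ns /K; lra.
- by move/Rabs_le_between: s4 => s4; move/Rabs_le_between: s5 => s5; apply: Rabs_le; rewrite /Ns /K; lra.
- by rewrite /Ns sumRS {2}/primeR pn /ts; ring.
by rewrite /ks; ring.
Qed.

Lemma sieve_induction n : (n0 <= n)%N -> bounds n.
Proof.
elim: n => [|n IHn] hn; first by have -> : 0%N = n0 by [lia]; exact: sieve_base.
case: (ltngtP n0 n.+1) hn => // [hn _|<- _]; last exact: sieve_base.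
have {}IHn := IHn ltac:(lia).
case: (boolP (prime n)) => pn; last first.
  move=> r D b hD hb X; have := IHn r D b (primeset_weak _ _ hD) hb.
  rewrite sifted_nonprime // mertS_nonprime //.
  have e1 : ts n.+1 = ts n by rewrite /ts {1}/th sumRS /primeR (negbTE pn) Rplus_0_r.
  have e2 : Ns n.+1 = Ns n by rewrite /Ns sumRS {2}/primeR (negbTE pn) Rplus_0_r.
  by rewrite /ks e1 e2.
have tr := sieve_transition n ltac:(lia) pn.
have hK : 0 <= K by rewrite /K; lra.
have [ht hKt htt hkk hLt] := transition_facts _ _ _ _ _ _ _ _ _ _ hK hK2 tr.
have [T0 _ _ _] := hlarge n ltac:(lia).
move=> r D b hD hb X.
have hD1 := primeset_weak _ _ hD; have hD2 := primeset_cons _ _ pn hD.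
have [u1 l1] := IHn r D b hD1 hb; have [u2 l2] := IHn r (n :: D) b hD2 hb.
have hm := modulus_gt0 _ _ hD; have n2 := prime_ge2 n pn.
have X0 : 0 < X by apply: Rdiv_lt_0_compat => //; exact: INR_gt0.
have eX : INR b / modulus (n :: D) = X / INR n by rewrite modulus_cons /X; field; lra.
have elX : ln (X / INR n) = ln X - ln (INR n) by rewrite ln_div; lra.
rewrite eX elX in u2 l2; rewrite -/X in u1 l1.
have e : INR (sifted r D n.+1 b) = INR (sifted r D n b) - INR (sifted r (n :: D) n b).
  by rewrite (sifted_prime r D n b pn) INR_addn; ring.
rewrite e mertS_prime //.
set p := INR n in tr n2 eX elX u2 l2 *; set L := ln p in tr hLt elX u2 l2 *; set x := ln X in u1 l1 u2 l2 elX *.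
set V := mert n in u1 l1 u2 l2 *.
have [V0 _] := mert_bounds n; rewrite -/V in V0.
have XV : 0 < X * V by apply: Rmult_lt_0_compat.
(* The barriers are stated relative to X V at the new level; multiplying by 1 - 1/p returns to the
   old one, as (1 - 1/p)(1 + 1/(p - 1)) = 1. *)
have step Y Z W : (1 + / (p - 1)) * Y + / (p - 1) * Z <= W -> Y + Z / p <= (1 - / p) * W.
  move=> h; have hp : 0 <= 1 - / p.
    have : / p <= 1 by rewrite -Rinv_1; apply: Rinv_le_contravar; lra.
    lra.
  have := Rmult_le_compat_l _ _ _ hp h.
  have -> : (1 - / p) * ((1 + / (p - 1)) * Y + / (p - 1) * Z) = Y + Z / p by field; lra.
  by [].
have [b1 b2 b3] := hbar _ _ _ _ _ _ _ _ x tr.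
split=> hx.
  have {}u1 := u1 ltac:(lra).
  case: (Rle_dec (3 * ts n + K) (x - ks n)) => hc3.
    have [hx2 hb2] := b2 hx hc3.
    have {}l2 := l2 ltac:(lra).
    have := Rmult_le_compat_l _ _ _ (Rlt_le _ _ XV) (step _ _ _ hb2).
    rewrite /Rdiv in l2 *; lra.
  (* The subtracted count is only known to be nonnegative here, which is the lower bound with
     deficit Z = 1. *)
  have hb3 := b3 hx ltac:(lra).
  rewrite -{2}(Rmult_1_r (/ (p - 1))) in hb3.
  have := Rmult_le_compat_l _ _ _ (Rlt_le _ _ XV) (step _ _ _ hb3).
  have := pos_INR (sifted r (n :: D) n b); rewrite /Rdiv in u1 *; lra.
have {}l1 := l1 ltac:(lra).
have {}u2 := u2 ltac:(lra).
have := Rmult_le_compat_l _ _ _ (Rlt_le _ _ XV) (step _ _ _ (b1 hx)).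
rewrite /Rdiv in u2 *; lra.
Qed.
End SieveInduction.

(** What the application needs: kap bounds all shifts, the lower bound is taken at s >= 2 + 1/t,
    where f is already of order 1/t, and the upper bound only with a constant U. *)
Lemma sieve_estimates : exists (t : nat -> R) (n0 : nat) (K kap c U : R),
  [/\ 0 <= K, 0 <= kap, 0 < c & 0 < U] /\ (0 < n0)%N /\
  forall n, (n0 <= n)%N ->
  [/\ 1 <= t n, Rabs (t n - ln (INR n)) <= K, c <= mert n * t n ^ 2,
      (forall r b, (0 < b)%N -> 2 * t n + kap + 1 <= ln (INR b) ->
         INR b * mert n * (c / t n) <= INR (sifted r [::] n b))
    & (forall r b q, (0 < b)%N -> prime q -> (n <= q)%N -> t n / 2 + kap <= ln (INR b / INR q) ->
         INR (sifted r [:: q] n b) <= INR b / INR q * mert n * U)].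
Proof.
have [A [C0 [Ep [Em hP]]]] := profile_exists.
have [E [K1 [hK1 hscale]]] := mertens_scale.
set K := 2 * K1; have hK : 0 <= K by rewrite /K; lra.
have [J [C [B0 [c [[hJ hC hB0 hc] [[lEm lEp lGm lGp] hbar]]]]]] := barriers A C0 Ep Em K hP hK.
have [n0' hn0'] := scale_large K1 (4 * K + 1) hK1 ltac:(lra).
(* With y = 1/p, the inequality (1 - y)(1 + 3y/4)^2 >= 1 used below fails for p = 2 and holds for p
   >= 3. *)
pose n0 := maxn n0' 3.
have hlarge n : (n0 <= n)%N -> [/\ 4 * K + 1 <= E + th n, (1 < n)%N, / (INR n - 1) <= 1/100
    & / (INR n - 1) <= (/ (E + th n)) ^ 2].
  by move=> hn; apply: hn0'; [lia|have [] := hscale n; [lia|]].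
have [m0 m1] := mert_bounds n0.
have hA := pr_A _ _ _ _ hP.
have [T0 _ _ _] := hlarge n0 (leqnn n0).
set b0 := 2 ^ n0 * (E + th n0) ^ 2 / mert n0.
have hb0 : 0 <= b0.
  apply: Rdiv_le_0_compat => //; apply: Rmult_le_pos; [apply: pow_le; lra|exact: pow2_ge_0].
pose B := B0 + b0; pose K2 := 40 * B / c.
have hB : 0 <= B by rewrite /B; lra.
have hK2 : 0 <= K2 by apply: Rdiv_le_0_compat; lra.
have hcK2 : 40 * B <= c * K2 by rewrite /K2; apply: Req_le; field; lra.
have hJ0 : 0 <= J by apply: Rle_trans hJ; apply: Rmult_le_pos; [lra|exact: pow2_ge_0].
have main := sieve_induction A C0 Ep Em E K1 hP hK1 hscale J C B K2 n0 hJ hC lEm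
  (hbar B K2 ltac:(rewrite /B; lra) hcK2) ltac:(lia) hlarge hK2 ltac:(rewrite -/b0 /B; lra).
pose ks n := K2 * (/ (E + th n0) - / (E + th n)).
pose kap := K2 * / (E + th n0).
have hks n : (n0 <= n)%N -> ks n <= kap.
  move=> hn; have [Tn _ _ _] := hlarge n hn.
  have : 0 < / (E + th n) by apply: Rinv_0_lt_compat; lra.
  by move=> h; have := Rmult_le_pos K2 _ hK2 (Rlt_le _ _ h); rewrite /ks /kap; lra.
have c20 : 0 < Em 44 / 44 by apply: Rdiv_lt_0_compat; [exact: (Em_pos _ _ _ _ hP)|lra].
set c2 := Em 44 / 44 in c20.
have hD0 : 0 <= K * C + B by have := Rmult_le_pos K C hK ltac:(lra); lra.
have hT2 : 0 <= 2 * (K * C + B) / c2 by apply: Rdiv_le_0_compat; lra.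
(* From this size of t on, the second order terms (K C + B) / t^2 take at most half of the gain c2 /
   t. *)
have [n1' hn1'] := scale_large K1 (4 * K + 1 + 2 * (K * C + B) / c2) hK1 ltac:(lra).
pose n1 := maxn n0 n1'.
pose c3 := mert n0 * (E + th n0) ^ 2.
have hc3 : 0 < c3 by apply: Rmult_lt_0_compat => //; apply: pow_lt; lra.
have he4 := exp_pos 4.
pose C4 := K * C + (2 * A * K + J) * exp 4.
have hC4 : 0 <= C4.
  rewrite /C4; apply: Rplus_le_le_0_compat; first by apply: Rmult_le_pos; lra.
  by apply: Rmult_le_pos; [have := Rmult_le_pos A K|]; lra.
have hmin : 0 < Rmin (c2 / 2) c3 by apply: Rmin_glb_lt; lra.
exists (fun n => E + th n), n1, K, kap, (Rmin (c2 / 2) c3), (1 + C + C4 + B).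
split; first split=> //; try lra.
  by rewrite /kap; apply: Rmult_le_pos => //; apply/Rlt_le/Rinv_0_lt_compat; lra.
split; first lia.
move=> n hn; have hn0 : (n0 <= n)%N by lia.
have [Tn _ _ _] := hlarge n hn0.
have [hs1 hs2] := hscale n ltac:(lia); have [_ hs3] := hscale n0 ltac:(lia).
have [T2 _ _ _] := hn1' n (E + th n) ltac:(lia) hs1.
have V0 := proj1 (mert_bounds n).
set t := E + th n in Tn T2 hs1 *.
have t2 : 0 < t ^ 2 by apply: pow_lt; lra.
have it2 : / t ^ 2 <= 1.
  by rewrite -Rinv_1; apply: Rinv_le_contravar; [lra|rewrite -(pow1 2); apply: pow_incr; lra].
have it20 : 0 < / t ^ 2 by exact: Rinv_0_lt_compat.
set N := sumR n (primeR (fun p => ln (INR p) / INR p * (E + th p - ln (INR p))))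
    - sumR n0 (primeR (fun p => ln (INR p) / INR p * (E + th p - ln (INR p)))).
have hN : Rabs N <= K.
  by move/Rabs_le_between: hs2 => hs2; move/Rabs_le_between: hs3 => hs3; apply: Rabs_le; rewrite /N /K; lra.
have hkn := hks n hn0.
split=> //; try lra.
- by rewrite /K; lra.
(* V t^2 never decreases: a prime p costs 1 - 1/p, but t grows by ln p / p with ln p >= 3t/4. The
   true order of V is 1/t; this weaker bound serves against a term that is smaller by a power of
   z. *)
- apply: Rle_trans (Rmin_r _ _) _; rewrite /c3 /t.
  have [d ->] : exists d, n = (n0 + d)%N by exists (n - n0)%N; lia.
  elim: d => [|d IHd]; first by rewrite addn0; lra.
  apply: Rle_trans IHd _; rewrite addnS; set k := (n0 + d)%N.
  have [Tk _ _ _] := hlarge k ltac:(rewrite /k; lia).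
  have [/Rabs_le_between hk _] := hscale k ltac:(rewrite /k; lia).
  case: (boolP (prime k)) => pk; last first.
    have -> : th k.+1 = th k by rewrite {1}/th sumRS /primeR (negbTE pk) Rplus_0_r.
    by rewrite mertS_nonprime //; lra.
  have Vk := proj1 (mert_bounds k).
  have -> : th k.+1 = th k + ln (INR k) / INR k by rewrite {1}/th sumRS /primeR pk.
  rewrite mertS_prime // Rmult_assoc; apply: Rmult_le_compat_l; first lra.
  set u := E + th k in Tk hk *; set l := ln (INR k) in hk *.
  have p3 : 3 <= INR k by have /INR_leq : (3 <= k)%N by [rewrite /k /n0; lia]; rewrite /=; lra.
  set y := / INR k.
  have hy : 0 < y <= / 3.
    by split; [apply: Rinv_0_lt_compat; lra|apply: Rinv_le_contravar; lra].
  have -> : E + (th k + l / INR k) = u + l * y by rewrite /u /y /Rdiv; ring.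
  have hlu : 3/4 * u <= l by rewrite /K in Tk; lra.
  have hu2 : u * (1 + 3/4 * y) <= u + l * y by nra.
  have hu3 : (u * (1 + 3/4 * y)) ^ 2 <= (u + l * y) ^ 2 by apply: pow_incr; split=> //; nra.
  have h1y : 1 <= (1 - y) * (1 + 3/4 * y) ^ 2.
    have -> : (1 - y) * (1 + 3/4 * y) ^ 2 = 1 + y * (1/2 - 15/16 * y - 9/16 * y ^ 2) by field.
    have : y ^ 2 <= / 3 * / 3 by nra.
    by move=> h; have := Rmult_le_pos y (1/2 - 15/16 * y - 9/16 * y ^ 2); lra.
  have hu4 : u ^ 2 <= (1 - y) * (u * (1 + 3/4 * y)) ^ 2.
    have -> : (1 - y) * (u * (1 + 3/4 * y)) ^ 2 = u ^ 2 * ((1 - y) * (1 + 3/4 * y) ^ 2) by ring.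
    by have := Rmult_le_compat_l (u ^ 2) _ _ (pow2_ge_0 u) h1y; lra.
  have := Rmult_le_compat_l (1 - y) _ _ ltac:(lra) hu3; lra.
- move=> r b hb hx.
  have [_ lo_] := main n hn0 r [::] b erefl hb.
  have m1' : modulus [::] = 1 by rewrite /modulus big_nil.
  rewrite m1' Rdiv_1_r -/t -/N -/(ks n) in lo_.
  have {}lo_ := lo_ ltac:(lra).
  apply: Rle_trans lo_.
  have hb' := INR_gt0 b hb.
  apply: Rmult_le_compat_l; first by apply: Rmult_le_pos; lra.
  set s := (ln (INR b) - ks n) / t.
  have Est : s * t = ln (INR b) - ks n by rewrite /s; field; lra.
  have hti : 0 < / t <= 1.
    by split; [apply: Rinv_0_lt_compat; lra|rewrite -Rinv_1; apply: Rinv_le_contravar; lra].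
  have htt : / t * t = 1 by apply: Rinv_l; lra.
  have hs : 2 + / t <= s by apply: (Rmult_le_reg_r t); lra.
  have h1 := EEm_le Ep Em C K B t N (ks n) (ln (INR b)) (Rlt_le _ _ hC) ltac:(lra) hN lGm ltac:(rewrite -/s; lra).
  rewrite -/s in h1.
  have [h2 _] := Em_slope _ _ _ _ hP (2 + / t) s ltac:(lra) hs.
  have [_ /(_ ltac:(lra)) h3] := Em_slope _ _ _ _ hP 2 (2 + / t) ltac:(lra) ltac:(lra).
  rewrite (Em_le2 _ _ _ _ hP 2) in h3; last lra.
  have h4 : (K * C + B) / t ^ 2 * exp (- s) <= (K * C + B) / t ^ 2 * 1.
    apply: Rmult_le_compat_l; first by apply: Rdiv_le_0_compat.
    by rewrite -exp_0; apply: exp_mono; lra.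
  have h5 : (K * C + B) / t ^ 2 <= c2 / 2 / t.
    have e1 : (K * C + B) / t ^ 2 = (2 * (K * C + B) / c2) * (c2 / 2 / t ^ 2) by field; lra.
    have e2 : c2 / 2 / t = t * (c2 / 2 / t ^ 2) by field; lra.
    rewrite e1 e2; apply: Rmult_le_compat_r; last lra.
    by apply: Rdiv_le_0_compat; lra.
  have h6 : Rmin (c2 / 2) c3 / t <= c2 / 2 / t.
    by apply: Rmult_le_compat_r; [lra|exact: Rmin_l].
  have e3 : c2 / 2 / t = c2 * / t / 2 by field; lra.
  rewrite -/c2 in h3; lra.
move=> r b q hb pq hq hx.
have hD : primeset n [:: q] by rewrite /primeset /= pq hq.
have [up_ _] := main n hn0 r [:: q] b hD hb.
have m1' : modulus [:: q] = INR q by rewrite /modulus big_cons big_nil muln1.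
rewrite m1' -/t -/N -/(ks n) in up_.
have {}up_ := up_ ltac:(lra).
apply: Rle_trans up_ _.
have q2 := prime_ge2 q pq; have hb' := INR_gt0 b hb.
apply: Rmult_le_compat_l; first by apply: Rmult_le_pos; [apply: Rdiv_le_0_compat|]; lra.
set s := (ln (INR b / INR q) - ks n) / t.
have Est : s * t = ln (INR b / INR q) - ks n by rewrite /s; field; lra.
have hs : 1/2 <= s by apply: (Rmult_le_reg_r t); lra.
have h1 := EEp_le A C0 J Ep Em C K B t N (ks n) (ln (INR b / INR q)) hP hC hJ0 ltac:(lra) ltac:(lra) hN lEm lGp hs.
rewrite -/s -/C4 in h1.
have h2 : Ep s <= C * 1.
  apply: Rle_trans (Rle_abs _) _; apply: Rle_trans (proj1 lEp s hs) _.
  by apply: Rmult_le_compat_l; [lra|rewrite -exp_0; apply: exp_mono; lra].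
have h3 : (C4 + B) / t ^ 2 * exp (- s) <= (C4 + B) * 1 * 1.
  apply: Rmult_le_compat; [|exact/Rlt_le/exp_pos| |by rewrite -exp_0; apply: exp_mono; lra].
    by apply: Rdiv_le_0_compat; lra.
  by apply: Rmult_le_compat_l; lra.
rewrite -/K; lra.
Qed.

(** * Jacobsthal's function *)

Lemma count_union (P : nat -> pred nat) m s :
  INR (count (fun t => has (fun q => P q t) (seq.iota 0 m)) s) <= sumR m (fun q => INR (count (P q) s)).
Proof.
elim: m => [|m IHm]; first by rewrite (eq_count (a2 := pred0)) // count_pred0 /=; lra.
rewrite sumRS.
have h : (count (fun t => has (fun q => P q t) (seq.iota 0 m.+1)) s <=
          count (fun t => has (fun q => P q t) (seq.iota 0 m)) s + count (P m) s)%N.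
  rewrite -count_predUI; apply: leq_trans (leq_addr _ _); apply: sub_count => t.
  by rewrite -addn1 iotaD has_cat /= orbF.
by move/INR_leq: h; rewrite INR_addn; lra.
Qed.

(** Here z is the sifting level, w = z^(1/4), lz = ln z, m = V(z), b the length of the interval and
    ell = ln n. Each term on the left is at most half of the right side: the first because ell / z
    <= 1 / B1 and 4U < c B1, the second because it is at most M3 w^6 / lz, against w^8 divided by a
    cube of logarithms. *)
Lemma sieve_numeric z w t lz m c U b B1 M3 ell : 1 <= lz -> 0 < t <= 2 * lz -> 0 < c -> 0 < U ->
  4 * U < c * B1 -> 1 <= B1 -> 0 <= ell -> B1 * ell <= z -> 0 < m -> c <= m * t ^ 2 ->
  z ^ 2 <= b -> z = w ^ 4 -> lz ^ 2 <= 64 * w -> 1 <= w -> 0 <= M3 -> 1024 * M3 <= c ^ 2 * w ->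
  (b / z * m * U + M3 * w ^ 2) * (ell / lz) < b * m * (c / t).
Proof.
move=> hl [t0 ht] hc hU hB hB1 he hez m0 hm hb hz hlw hw hM hMw.
have z1 : 1 <= z by rewrite hz -(pow1 4); apply: pow_incr; lra.
have b0 : 0 < b by have := pow_R1_Rle z 2 z1; lra.
have bm : 0 < b * m by exact: Rmult_lt_0_compat.
have ct : c / (2 * lz) <= c / t by apply: Rmult_le_compat_l; [lra|apply: Rinv_le_contravar; lra].
have ct' := Rmult_le_compat_l _ _ _ (Rlt_le _ _ bm) ct.
have p1 : b / z * m * U * (ell / lz) < b * m * (c / t) / 2.
  have h1 : ell / z <= / B1.
    apply: (Rmult_le_reg_r (B1 * z)); first by apply: Rmult_lt_0_compat; lra.
    have -> : ell / z * (B1 * z) = B1 * ell by field; lra.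
    by have -> : / B1 * (B1 * z) = z by [field; lra].
  have h2 : U / B1 < c / 4.
    apply: (Rmult_lt_reg_r (4 * B1)); first lra.
    have -> : U / B1 * (4 * B1) = 4 * U by field; lra.
    lra.
  have -> : b / z * m * U * (ell / lz) = b * m * (U * (ell / z) / lz) by field; lra.
  have h3 : U * (ell / z) < c / 4 by have := Rmult_le_compat_l _ _ _ (Rlt_le _ _ hU) h1; rewrite /Rdiv in h2 *; lra.
  have h4 : U * (ell / z) / lz < c / (2 * lz) / 2.
    have -> : c / (2 * lz) / 2 = c / 4 / lz by field; lra.
    by apply: Rmult_lt_compat_r => //; apply: Rinv_0_lt_compat; lra.
  by have := Rmult_lt_compat_l _ _ _ bm h4; lra.
have p2 : M3 * w ^ 2 * (ell / lz) <= b * m * (c / t) / 2.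
  have t3 : 0 < t ^ 3 by exact: pow_lt.
  have l3 : 0 < lz ^ 3 by apply: pow_lt; lra.
  have l2 : 0 < lz ^ 2 by apply: pow_lt; lra.
  have w6 : 0 < w ^ 6 by apply: pow_lt; lra.
  have w8 : 0 < w ^ 8 by apply: pow_lt; lra.
  have h1 : w ^ 8 * c ^ 2 / t ^ 3 <= b * m * (c / t).
    have -> : w ^ 8 * c ^ 2 / t ^ 3 = w ^ 8 * c * (c / t ^ 3) by field; lra.
    have -> : b * m * (c / t) = b * (m * t ^ 2) * (c / t ^ 3) by field; lra.
    apply: Rmult_le_compat_r; first by apply: Rdiv_le_0_compat; lra.
    apply: Rmult_le_compat; try lra.
    have -> : w ^ 8 = z ^ 2 by rewrite hz; ring.
    lra.
  have h2 : w ^ 8 * c ^ 2 / (8 * lz ^ 3) <= w ^ 8 * c ^ 2 / t ^ 3.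
    apply: Rmult_le_compat_l; first by apply: Rmult_le_pos; [lra|exact: pow2_ge_0].
    apply: Rinv_le_contravar => //.
    have -> : 8 * lz ^ 3 = (2 * lz) ^ 3 by ring.
    by apply: pow_incr; lra.
  have h3 : ell <= w ^ 4 by rewrite -hz; have := Rmult_le_compat_r _ _ _ he hB1; lra.
  have h4 : M3 * w ^ 2 * (ell / lz) <= M3 * w ^ 6 / lz.
    have -> : M3 * w ^ 2 * (ell / lz) = M3 * w ^ 2 / lz * ell by field; lra.
    have -> : M3 * w ^ 6 / lz = M3 * w ^ 2 / lz * w ^ 4 by field; lra.
    apply: Rmult_le_compat_l => //; apply: Rdiv_le_0_compat; last lra.
    by apply: Rmult_le_pos => //; exact: pow2_ge_0.
  have h5 : M3 * w ^ 6 / lz <= w ^ 8 * c ^ 2 / (8 * lz ^ 3) / 2.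
    apply: (Rmult_le_reg_r (16 * lz ^ 3)); first lra.
    have -> : M3 * w ^ 6 / lz * (16 * lz ^ 3) = 16 * (M3 * w ^ 6) * lz ^ 2 by field; lra.
    have -> : w ^ 8 * c ^ 2 / (8 * lz ^ 3) / 2 * (16 * lz ^ 3) = w ^ 7 * (c ^ 2 * w) by field; lra.
    have w7 : 0 <= w ^ 7 by apply: pow_le; lra.
    have Mw : 0 <= 16 * (M3 * w ^ 6) by have := Rmult_le_pos _ _ hM (Rlt_le _ _ w6); lra.
    have := Rmult_le_compat_l _ _ _ Mw hlw; have := Rmult_le_compat_l _ _ _ w7 hMw; lra.
  lra.
have -> : (b / z * m * U + M3 * w ^ 2) * (ell / lz) = b / z * m * U * (ell / lz) + M3 * w ^ 2 * (ell / lz) by ring.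
lra.
Qed.

Lemma sifted_single r q n b : prime q -> INR (sifted r [:: q] n b) <= INR b / INR q + 1.
Proof.
move=> pq; have /Rabs_le_between := count_class_bounds q (r q) b (prime_gt0 pq).
have /INR_leq : (sifted r [:: q] n b <= count (fun t => t == r q %[mod q]) (seq.iota 0 b))%N.
  by apply: sub_count => t /=; rewrite andbT => /andP [].
lra.
Qed.

Theorem jacobsthal : exists K0 : nat, forall n r b, (0 < n)%N -> (K0 * expn (trunc_log 2 n).+1 2 <= b)%N ->
  exists t, (t < b)%N /\ forall p, prime p -> p %| n -> (t %% p)%N <> (r p %% p)%N.
Proof.
have [t [n0 [K [kap [c [U [[hK hkap hc hU] [n0pos est]]]]]]]] := sieve_estimates.
(* For primes q so large that b' / q is too short for the sieve bound, the trivial count b' / q + 1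
   is used. Then b' / q < e^(t/2 + kap) <= e^(kap + K/2) sqrt z, and the summand 1 of M3 covers the
   rounding. *)
pose M3 := exp (kap + K / 2) + 1.
have hM3 : 0 < M3 by have := exp_pos (kap + K / 2); rewrite /M3; lra.
have [B1 /(_ B1 (leqnn B1)) hB1] := nat_above (4 * U / c + 2).
have [n1 /(_ n1 (leqnn n1)) hn1] := nat_above (exp (K + 1)).
have [n2 /(_ n2 (leqnn n2)) hn2] := nat_above ((1024 * M3 / c ^ 2 + 1) ^ 4).
(* As t <= ln z + K, this gives ln (M2 z^2) >= 2t + kap + 1, the hypothesis of the lower bound. *)
have [M2 /(_ M2 (leqnn M2)) hM2] := nat_above (exp (2 * K + kap + 1)).
pose N1 := (n0 + n1 + n2)%N.
exists (M2 * expn (N1 + B1) 2)%N => n r b npos hb.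
set l := (trunc_log 2 n).+1 in hb.
(* N1 puts z beyond every threshold; B1 l >= B1 ln n makes the number of prime factors of n above z
   a small multiple of z / ln z. Since z <= (N1 + B1) l, the length b' fits into b. *)
pose z := (N1 + B1 * l)%N; pose b' := (M2 * expn z 2)%N.
have M2pos : (0 < M2)%N.
  by case: (M2) hM2 => // /=; have := exp_pos (2 * K + kap + 1); lra.
have bb : (b' <= b)%N.
  apply: leq_trans hb; rewrite /b' -mulnA leq_mul2l -expnMn leq_exp2r // mulnDl.
  by apply/orP; right; rewrite leq_add2r leq_pmulr.
have z0 : (n0 <= z)%N by rewrite /z /N1; lia.
have zpos : (0 < z)%N by lia.
have b0 : (0 < b')%N by rewrite /b' muln_gt0 M2pos expn_gt0 zpos.
have [t1 /Rabs_le_between tK hm lower upper] := est z z0.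
have Z1 := INR_gt0 z zpos.
have hz1 : exp (K + 1) <= INR z by apply: Rle_trans hn1 _; apply: INR_leq; rewrite /z /N1; lia.
have hz2 : (1024 * M3 / c ^ 2 + 1) ^ 4 <= INR z.
  by apply: Rle_trans hn2 _; apply: INR_leq; rewrite /z /N1; lia.
have lz : K + 1 <= ln (INR z) by rewrite -(ln_exp (K + 1)); apply: ln_le => //; exact: exp_pos.
have c2 : 0 < c ^ 2 by exact: pow_lt.
set w := sqrt (sqrt (INR z)).
have hw : INR z = w ^ 4.
  have -> : w ^ 4 = (w * w) * (w * w) by ring.
  by rewrite /w !sqrt_sqrt //; [lra|exact: sqrt_pos].
have Mc : 0 < 1024 * M3 / c ^ 2 by apply: Rdiv_lt_0_compat; lra.
have hw1 : 1024 * M3 / c ^ 2 + 1 <= w.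
  have -> : 1024 * M3 / c ^ 2 + 1 = sqrt (sqrt ((1024 * M3 / c ^ 2 + 1) ^ 4)).
    have -> : (1024 * M3 / c ^ 2 + 1) ^ 4 = ((1024 * M3 / c ^ 2 + 1) ^ 2) ^ 2 by ring.
    by rewrite !sqrt_pow2 //; [lra|exact: pow2_ge_0].
  by apply: sqrt_le_1_alt; apply: sqrt_le_1_alt.
have hlw : ln (INR z) ^ 2 <= 64 * w.
  have sz : 1 <= sqrt (INR z).
    by rewrite -sqrt_1; apply: sqrt_le_1_alt; apply: INR_ge1.
  have := ln_sq_le (sqrt (INR z)) sz; rewrite -/w.
  have -> : ln (INR z) = 2 * ln (sqrt (INR z)).
    have {1}-> : INR z = sqrt (INR z) * sqrt (INR z) by rewrite sqrt_sqrt //; lra.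
    by rewrite ln_mult; lra.
  lra.
have hB : INR b' = INR M2 * INR z ^ 2 by rewrite /b' INR_muln INR_expn.
have M2R : 1 <= INR M2 by exact: INR_ge1.
have z2 : 0 < INR z ^ 2 by exact: pow_lt.
have low : INR b' * mert z * (c / t z) <= INR (sifted r [::] z b').
  apply: lower => //; rewrite hB ln_mult //; last lra.
  have -> : ln (INR z ^ 2) = 2 * ln (INR z) by rewrite ln_pow //=; lra.
  have : 2 * K + kap + 1 <= ln (INR M2).
    by rewrite -(ln_exp (2 * K + kap + 1)); apply: ln_le => //; exact: exp_pos.
  lra.
set W := INR b' / INR z * mert z * U + M3 * w ^ 2.
have [V0 _] := mert_bounds z.
have Bd0 : 0 < INR b' / INR z * mert z * U.
  by have b0' := INR_gt0 b' b0; do 2 apply: Rmult_lt_0_compat => //; exact: Rdiv_lt_0_compat.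
have w2 : 0 <= w ^ 2 by exact: pow2_ge_0.
have W0 : 0 < W by have := Rmult_le_pos M3 _ ltac:(lra) w2; rewrite /W; lra.
have term q : prime q -> (z <= q)%N -> INR (sifted r [:: q] z b') <= W.
  move=> pq zq; have q2 := prime_ge2 q pq; have zqR := INR_leq _ _ zq.
  have b0' := INR_gt0 b' b0.
  case: (Rle_dec (t z / 2 + kap) (ln (INR b' / INR q))) => hq.
    apply: Rle_trans (upper r b' q b0 pq zq hq) _.
    have : INR b' / INR q * mert z * U <= INR b' / INR z * mert z * U.
      apply: Rmult_le_compat_r; first lra.
      apply: Rmult_le_compat_r; first lra.
      by apply: Rmult_le_compat_l; [lra|exact: Rinv_le_contravar].
    by have := Rmult_le_pos M3 _ ltac:(lra) w2; rewrite /W; lra.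
  apply: Rle_trans (sifted_single r q z b' pq) _.
  have h1 : INR b' / INR q <= exp (kap + K / 2) * exp (ln (INR z) / 2).
    rewrite -exp_plus -{1}(exp_ln (INR b' / INR q)); first by apply: exp_mono; lra.
    by apply: Rdiv_lt_0_compat; lra.
  have h2 : exp (ln (INR z) / 2) = w ^ 2.
    have -> : ln (INR z) / 2 = ln (w ^ 2).
      by rewrite hw; have -> : w ^ 4 = w ^ 2 * w ^ 2 by [ring]; rewrite ln_mult; try lra; apply: pow_lt; lra.
    by rewrite exp_ln //; apply: pow_lt; lra.
  have w21 : 1 <= w ^ 2 by rewrite -(pow1 2); apply: pow_incr; lra.
  have : M3 * w ^ 2 = exp (kap + K / 2) * w ^ 2 + w ^ 2 by rewrite /M3; ring.
  rewrite h2 in h1; rewrite /W; lra.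
have lnn : ln (INR n) <= INR l.
  have /INR_ltn : (n < expn 2 l)%N by exact: trunc_log_ltn.
  rewrite INR_expn => hl.
  have : ln (INR n) <= ln (INR 2 ^ l) by apply: ln_le; [exact: INR_gt0|lra].
  rewrite ln_pow; last by rewrite /=; lra.
  have -> : INR 2 = 2 by [].
  have l2 : ln 2 <= 1.
    by rewrite -(ln_exp 1); apply: ln_le; [lra|have := exp_ineq1_le 1; lra].
  by have := Rmult_le_compat_l _ _ _ (pos_INR l) l2; lra.
pose hit q t := [&& prime q, q %| n, (z <= q)%N & hits r t q && avoids r z t].
(* Every prime factor q >= z of n contributes at least ln z to ln n, which bounds their number
   without listing them. *)
have tot : sumR n.+1 (fun q => INR (count (hit q) (seq.iota 0 b'))) <= W * (ln (INR n) / ln (INR z)).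
  have -> : W * (ln (INR n) / ln (INR z)) = W / ln (INR z) * ln (INR n) by field; lra.
  rewrite (ln_factor n.+1 n) ?npos ?ltnSn // -sumR_scal; apply: sumR_le => q _.
  rewrite /primeR; case: (boolP (prime q)) => pq; last first.
    by rewrite Rmult_0_r (eq_count (a2 := pred0)) ?count_pred0 /=; [lra|move=> x; rewrite /hit (negbTE pq)].
  have q2 := prime_ge2 q pq.
  have nn : 0 <= W / ln (INR z) * (INR (logn q n) * ln (INR q)).
    apply: Rmult_le_pos; first by apply: Rdiv_le_0_compat; lra.
    by apply: Rmult_le_pos; [exact: pos_INR|exact: ln_nat_ge0].
  case: (boolP (q %| n)) => qn; last first.
    by rewrite (eq_count (a2 := pred0)) ?count_pred0 //; move=> x; rewrite /hit pq (negbTE qn).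
  case: (boolP (z <= q)%N) => zq; last first.
    by rewrite (eq_count (a2 := pred0)) ?count_pred0 //; move=> x; rewrite /hit pq qn (negbTE zq).
  have -> : count (hit q) (seq.iota 0 b') = sifted r [:: q] z b'.
    by apply: eq_count => x; rewrite /hit pq qn zq /= andbT.
  apply: Rle_trans (term q pq zq) _.
  have lq : ln (INR z) <= ln (INR q) by apply: ln_le => //; exact: INR_leq.
  have lg : 1 <= INR (logn q n) by apply: INR_ge1; rewrite -pfactor_dvdn // expn1.
  have {1}-> : W = W / ln (INR z) * (1 * ln (INR z)) by field; lra.
  apply: Rmult_le_compat_l; first by apply: Rdiv_le_0_compat; lra.
  by apply: Rmult_le_compat; lra.
have hn0 : 0 <= ln (INR n) by exact: ln_nat_ge0.
have num : W * (ln (INR n) / ln (INR z)) < INR b' * mert z * (c / t z).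
  have u0 : 0 < U / c by exact: Rdiv_lt_0_compat.
  apply: (sieve_numeric (INR z) w (t z) (ln (INR z)) (mert z) c U (INR b') (INR B1)) => //; try lra.
  - have e : 4 * U / c * c = 4 * U by field; lra.
    by have := Rmult_le_compat_r c _ _ (Rlt_le _ _ hc) hB1; lra.
  - apply: Rle_trans (_ : INR B1 * INR l <= _).
      by apply: Rmult_le_compat_l => //; exact: pos_INR.
    by rewrite -INR_muln; apply: INR_leq; rewrite /z; lia.
  - by rewrite hB; have := Rmult_le_compat_r _ _ _ (Rlt_le _ _ z2) M2R; lra.
  - have e : 1024 * M3 / c ^ 2 * c ^ 2 = 1024 * M3 by field; lra.
    by have := Rmult_le_compat_r _ _ _ (Rlt_le _ _ c2) hw1; lra.
have un := count_union hit n.+1 (seq.iota 0 b').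
have lt : (count (fun t => has (fun q => hit q t) (seq.iota 0 n.+1)) (seq.iota 0 b') <
  count (avoids r z) (seq.iota 0 b'))%N.
  rewrite ltnNge; apply/negP => /INR_leq.
  have -> : count (avoids r z) (seq.iota 0 b') = sifted r [::] z b' by exact: eq_count.
  lra.
have [x xb /andP [avx nhit]] : exists2 x, x \in seq.iota 0 b' &
    avoids r z x && ~~ has (fun q => hit q x) (seq.iota 0 n.+1).
  apply/hasP; apply: contraTT lt; rewrite -leqNgt -all_predC => /allP h.
  rewrite (eq_in_count (a2 := fun x => avoids r z x && has (fun q => hit q x) (seq.iota 0 n.+1))).
    by apply: sub_count => x /andP [].
  by move=> x /h /=; rewrite negb_and negbK; case: (avoids r z x).
exists x; rewrite mem_iota /= in xb; split; first by lia.
move=> p pp pn; apply/eqP.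
case: (leqP z p) => zp.
  apply: contraNN nhit => hx; apply/hasP; exists p.
    by rewrite mem_iota /= ltnS dvdn_leq.
  by rewrite /hit pp pn zp /hits hx avx.
by move/allP/(_ p): avx; rewrite mem_iota /= pp /=; apply.
Qed.

End JacobsthalBound.

Set Implicit Arguments.
Unset Strict Implicit.
Unset Printing Implicit Defensive.
Import Order.TTheory GRing.Theory Num.Theory.

(** * Coprime representations *)

(** The Chinese remainder theorem gives a multiple of d congruent to c; dividing it by d solves the
    congruence, and any other solution agrees modulo p as d cancels. *)
Lemma modn_root (d p c : nat) : (0 < d)%N -> coprime d p ->
  exists x, forall t, d * t = c %[mod p] -> t = x %[mod p].
Proof.
move=> d0 co; pose m := chinese d p 0 c; exists (m %/ d)%N => t ht.
have dm : d %| m by rewrite /dvdn (chinese_modl co) mod0n.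
have : d * t == d * (m %/ d) %[mod p].
  by rewrite ht [(d * _)%N]mulnC divnK // (chinese_modr co).
wlog le : t {ht} / (m %/ d <= t)%N => [hw|].
  case: (leqP (m %/ d)%N t) => [/hw //|/ltnW le].
  rewrite eq_sym eqn_mod_dvd ?leq_mul2l ?le ?orbT // -mulnBr Gauss_dvdr 1?coprime_sym //.
  by rewrite -eqn_mod_dvd // => /eqP.
rewrite eqn_mod_dvd ?leq_mul2l ?le ?orbT // -mulnBr Gauss_dvdr 1?coprime_sym //.
by rewrite -eqn_mod_dvd // => /eqP.
Qed.

(** The start u < a2 uses up less than a1 a2 of n; this is why b + 1 multiples of a1 a2 are asked
    for, and then v - a1 t is a true difference for all t < b. *)
Lemma coprime_solution (a1 a2 n b : nat) : (0 < a1)%N -> (0 < a2)%N -> coprime a1 a2 ->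
  (b.+1 * (a1 * a2) <= n)%N ->
  (forall r, exists t, (t < b)%N /\ forall p, prime p -> p %| n -> t %% p <> r p %% p) ->
  exists x1 x2 : nat, n = (a1 * x1 + a2 * x2)%N /\ coprime x1 x2.
Proof.
move=> a10 a20 co hn hJ.
pose u := (chinese a1 a2 0 n %/ a1 %% a2)%N.
have ua2 : (u < a2)%N by rewrite ltn_pmod.
have hu : (a1 * u = n %[mod a2])%N.
  have d : a1 %| chinese a1 a2 0 n by rewrite /dvdn (chinese_modl co) mod0n.
  by rewrite /u modnMmr mulnC divnK // (chinese_modr co).
have le1 : (a1 * u <= n)%N by nia.
have : (a2 %| n - a1 * u)%N by rewrite -eqn_mod_dvd //; apply/eqP.
move=> /dvdnP [v hv].
have ev : n = (a1 * u + a2 * v)%N by lia.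
(* The bad class modulo p. If p divides a2, it does not divide a1 and p | v - a1 t determines t;
   otherwise p | u + a2 t does. The factor p - 1 stands for -1, natural numbers having no
   negatives. *)
pose cond p x := if p %| a2 then (forall t, a1 * t = v %[mod p] -> t = x %[mod p])
   else (forall t, a2 * t = u * p.-1 %[mod p] -> t = x %[mod p]).
have /choice [r hr] : forall p, exists x, prime p -> cond p x.
  move=> p; case: (boolP (prime p)) => [pp|_]; last by exists 0%N.
  rewrite /cond; case: (boolP (p %| a2)) => pa.
    have cp : coprime a1 p.
      by rewrite coprime_sym prime_coprime //; apply/negP => pa1; move: (dvdn_gcd p a1 a2);
        rewrite pa1 pa (eqP co) dvdn1; case: p pp {pa pa1} => [|[]].
    by have [x hx] := modn_root v a10 cp; exists x.
  have cp : coprime a2 p by rewrite coprime_sym prime_coprime.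
  by have [x hx] := modn_root (u * p.-1) a20 cp; exists x.
have [t [tb ht]] := hJ r.
have le2 : (a1 * t <= v)%N.
  rewrite -(leq_pmul2l a20); have : (a1 * a2 * t.+1 <= a1 * a2 * b.+1)%N by rewrite leq_mul2l ltnS ltnW ?orbT.
  nia.
have en : n = (a1 * (u + a2 * t) + a2 * (v - a1 * t))%N by nia.
exists (u + a2 * t)%N, (v - a1 * t)%N; split=> //.
rewrite /coprime; apply/negPn/negP => hg.
have n0 : (0 < n)%N by apply: leq_trans hn; rewrite !muln_gt0 a10.
set x1 := (u + a2 * t)%N in en hg; set x2 := (v - a1 * t)%N in en hg.
have g1 : (1 < gcdn x1 x2)%N.
  have : (0 < gcdn x1 x2)%N by rewrite gcdn_gt0; lia.
  by case: gcdn hg => [|[]].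
have pp := pdiv_prime g1; set p := pdiv _ in pp.
have := pdiv_dvd (gcdn x1 x2); rewrite -/p dvdn_gcd => /andP [p1 p2].
have pn : p %| n by rewrite en dvdn_add ?dvdn_mull.
apply: (ht p pp pn); have := hr p pp; rewrite /cond; case: ifP => pa; apply.
  by apply/eqP; rewrite eq_sym eqn_mod_dvd.
have hp : (u * p.-1 + u = u * p)%N by rewrite -mulnSr prednK // prime_gt0.
apply/eqP; rewrite -(eqn_modDr u) hp [(a2 * t + u)%N]addnC modnMl; exact: p1.
Qed.

Lemma cube_le_exp2 m : (m.+1 ^ 3 <= 8 * 2 ^ m)%N.
Proof.
case: (leqP m 3) => [|lt]; first by case: m => [|[|[|[|m]]]].
rewrite -(subnK lt); elim: (m - 4)%N => [//|k IHk].
rewrite addSn [(2 ^ _.+1)%N]expnS mulnCA; apply: leq_trans (_ : 2 * (k + 4).+1 ^ 3 <= _)%N; last by rewrite leq_mul2l.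
by rewrite !expnS !expn0; nia.
Qed.

(** Passes from log n to log P. With q = n / P, the logarithm of n is at most l plus that of q, up
    to rounding. The square of l is controlled by the hypothesis on n, that of the logarithm of q by
    q itself; each part takes at most q / 4, and q >= 4 leaves room for the final 1. *)
Lemma log_absorb (K0 P n : nat) : (0 < P)%N ->
  ((8 * K0 + (32 * K0) ^ 3 + 4) * P * (trunc_log 2 P).+1 ^ 2 < n)%N ->
  ((K0 * (trunc_log 2 n).+1 ^ 2).+1 * P <= n)%N.
Proof.
move=> P0; set K1 := (_ + 4)%N; set l := (trunc_log 2 P).+1 => hn.
pose q := (n %/ P)%N.
have hq : (K1 * l ^ 2 <= q)%N by rewrite leq_divRL // mulnAC ltnW.
have q1 : (4 <= q)%N.
  by apply: leq_trans hq; rewrite -[4%N]muln1; apply: leq_mul; [rewrite /K1; lia|rewrite expn_gt0].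
pose u := trunc_log 2 q.
have qu : (2 ^ u <= q)%N by apply: trunc_logP => //; lia.
have qu2 : (q < 2 ^ u.+1)%N by exact: trunc_log_ltn.
have hPl : (P < 2 ^ l)%N by exact: trunc_log_ltn.
have nlt : (n < 2 ^ (l + u.+1))%N.
  have : (n < P * q.+1)%N by rewrite mulnC ltn_ceil.
  rewrite expnD; move: qu2 hPl; set x := (2 ^ u.+1)%N; set y := (2 ^ l)%N => h1 h2 h3.
  by apply: leq_trans h3 _; apply: leq_mul; lia.
have hm : ((trunc_log 2 n).+1 <= l + u.+1)%N.
  rewrite -(ltn_exp2l _ _ (isT : 1 < 2)%N); apply: leq_ltn_trans nlt.
  by apply: trunc_logP => //; lia.
have hc := cube_le_exp2 u.
rewrite -leq_divRL // -/q.
have sq : ((trunc_log 2 n).+1 ^ 2 <= (l + u.+1) ^ 2)%N by rewrite leq_exp2r.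
have sq2 : ((l + u.+1) ^ 2 <= 2 * l ^ 2 + 2 * u.+1 ^ 2)%N.
  by rewrite sqrnD; have [] := nat_Cauchy l u.+1; lia.
have A1 : (8 * K0 * l ^ 2 <= q)%N by apply: leq_trans hq; rewrite leq_mul2r; apply/orP; right; rewrite /K1; lia.
have A2 : (8 * K0 * u.+1 ^ 2 <= q)%N.
  (* For large u the cubic bound (u + 1)^3 <= 8 * 2^u <= 8q suffices. For small u the left side is
     at most 8 K0 (64 K0)^2 = (32 K0)^3, the reason for this summand in the constant. *)
  case: (leqP (64 * K0) u.+1) => h.
    have : (64 * K0 * u.+1 ^ 2 <= u.+1 ^ 3)%N by rewrite [(_ ^ 3)%N]expnS leq_mul2r h orbT.
    lia.
  have h1 : (u.+1 ^ 2 <= (64 * K0) ^ 2)%N by rewrite leq_exp2r // ltnW.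
  have h2 : ((32 * K0) ^ 3 <= q)%N.
    by apply: leq_trans hq; rewrite -[X in (X <= _)%N]muln1; apply: leq_mul; [rewrite /K1; lia|rewrite expn_gt0].
  have h3 : (8 * K0 * u.+1 ^ 2 <= 8 * K0 * (64 * K0) ^ 2)%N by rewrite leq_mul2l h1 orbT.
  apply: leq_trans h3 _; apply: leq_trans h2.
  by rewrite !expnMn !expnS !expn0; nia.
have : (K0 * (trunc_log 2 n).+1 ^ 2 <= K0 * (2 * l ^ 2 + 2 * u.+1 ^ 2))%N.
  by rewrite leq_mul2l (leq_trans sq sq2) orbT.
move: A1 A2 q1; rewrite -!mulnA mulnDr ![(K0 * (2 * _))%N]mulnCA.
by move: (K0 * l ^ 2)%N (K0 * u.+1 ^ 2)%N (K0 * _)%N => x y w; lia.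
Qed.

Lemma product_not_rep (a1 a2 x1 x2 : nat) : (1 < a1)%N -> (1 < a2)%N -> coprime a1 a2 ->
  (a1 * a2 = a1 * x1 + a2 * x2)%N -> ~~ coprime x1 x2.
Proof.
move=> h1 h2 co e.
have d1 : a2 %| x1.
  by rewrite -(Gauss_dvdr _ (n := a1)) 1?coprime_sym // -(dvdn_addl _ (dvdn_mulr x2 (dvdnn a2))) -e dvdn_mull.
have d2 : a1 %| x2.
  by rewrite -(Gauss_dvdr _ (n := a2)) // -(dvdn_addr _ (dvdn_mulr x1 (dvdnn a1))) -e dvdn_mulr.
move/dvdnP: d1 e => [k ->]; move/dvdnP: d2 => [m ->] e.
have hk : (k + m = 1)%N.
  by apply/eqP; rewrite -(eqn_pmul2l (m := a1 * a2)) ?muln_gt0; [apply/eqP; lia|lia].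
case: k hk {e} => [|[|k]] hk; last lia.
  by rewrite mul0n /coprime gcd0n (_ : m = 1%N) ?mul1n; lia.
by rewrite (_ : m = 0%N) ?mul0n /coprime ?gcdn0; lia.
Qed.

Local Open Scope ring_scope.

Lemma trunc_log_ln (R : realType) (P : nat) : (1 < P)%N ->
  (trunc_log 2 P).+1%:R <= 2 / ln 2 * ln (P%:R : R).
Proof.
move=> P1; have l2 : 0 < ln (2 : R) by rewrite ln_gt0 // ltr1n.
have k1 : (1 <= trunc_log 2 P)%N by rewrite trunc_log_gt0.
have h : (trunc_log 2 P)%:R * ln 2 <= ln (P%:R : R).
  rewrite mulr_natl -lnXn // ler_ln ?posrE ?exprn_gt0 ?ltr0n //; last by lia.
  by rewrite -natrX ler_nat trunc_logP //; lia.
rewrite mulrAC ler_pdivlMr //; apply: le_trans (_ : 2 * ((trunc_log 2 P)%:R * ln 2) <= _).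
  by rewrite mulrA ler_pM2r // -natrM ler_nat; lia.
by rewrite ler_pM2l.
Qed.

Theorem theorem4 (R : realType) :
  exists2 C : R, 0 < C &
    forall a1 a2 : int, 1 < a1 -> a1 < a2 -> coprimez a1 a2 ->
      exists G : int,
        [/\ is_coprime_frobenius a1 a2 G,
            a1 * a2 <= G
          & G%:~R <= C * (a1 * a2)%:~R * ln (a1 * a2)%:~R ^+ 2].
Proof.
have [K0 hK0] := JacobsthalBound.jacobsthal.
have [K1 K1pos habs] : exists2 K1, (0 < K1)%N & forall P n, (0 < P)%N ->
    (K1 * P * (trunc_log 2 P).+1 ^ 2 < n)%N -> ((K0 * (trunc_log 2 n).+1 ^ 2).+1 * P <= n)%N.
  by exists (8 * K0 + (32 * K0) ^ 3 + 4)%N => [|P n]; [lia|exact: log_absorb].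
have l2 : 0 < ln (2 : R) by rewrite ln_gt0 // ltr1n.
exists (K1%:R * (2 / ln 2) ^+ 2).
  by apply: mulr_gt0; [rewrite ltr0n|rewrite exprn_gt0 // divr_gt0].
move=> [a1|//] [a2|]; last by move=> *; lia.
rewrite !ltz_nat => h1 h12 co; have h2 : (1 < a2)%N by lia.
have {}co : coprime a1 a2 by [].
pose P := (a1 * a2)%N; have P1 : (1 < P)%N by rewrite /P; nia.
pose N0 := (K1 * P * (trunc_log 2 P).+1 ^ 2)%N.
have above : coprime_rep_above a1 a2 N0.
  move=> [n|//]; rewrite ltz_nat => hn.
  have hb := habs _ _ (ltnW P1) hn.
  have n0 : (0 < n)%N by lia.
  have [|x1 [x2 [e c]]] := coprime_solution (ltnW h1) (ltnW h2) co hb.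
    by move=> r; exact: hK0.
  by exists x1, x2; split=> //; rewrite e PoszD !PoszM.
have lower g : coprime_rep_above a1 a2 g -> P%:Z <= g.
  move=> hg; rewrite leNgt; apply/negP => /hg [x1 [x2 [e c]]].
  have : ~~ coprime x1 x2 by apply: (product_not_rep h1 h2 co); lia.
  by rewrite c.
have ex : exists k : nat, `[< coprime_rep_above a1 a2 k >] by exists N0; apply/asboolP.
(* The least admissible natural number is the least admissible integer, because [lower] excludes the
   negative ones. *)
case: (ex_minnP ex) => G /asboolP hG minG.
exists G; split.
- split=> // -[g|g] hg; last by have := lower _ hg; lia.
  by rewrite lez_nat; apply: minG; apply/asboolP.
- by rewrite -PoszM; exact: lower.
have GN : (G <= N0)%N by apply: minG; apply/asboolP.
rewrite -PoszM -/P.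
apply: le_trans (_ : N0%:R <= _); first by rewrite -[_%:~R]/(G%:R) ler_nat.
have lP : 0 <= 2 / ln 2 * ln (P%:R : R).
  by rewrite mulr_ge0 // ?divr_ge0 ?ln_ge0 ?ler1n ?(ltW l2) // ltnW.
have ht : (trunc_log 2 P).+1%:R ^+ 2 <= (2 / ln 2 * ln P%:R) ^+ 2 :> R.
  by apply: lerXn2r (trunc_log_ln R P1) => //; rewrite nnegrE.
move: ht; rewrite exprMn /N0 -[(Posz P)%:~R]/(P%:R) => ht.
rewrite natrM natrX natrM.
apply: le_trans (ler_wpM2l _ ht) _; first by rewrite mulr_ge0.
by rewrite mulrA [K1%:R * _ * _]mulrAC.
Qed.
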